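(* Let $n\ge 2$ and let $X_1(t),\dots,X_n(t)$, $t\ge 0$, be independent Goldstein-Kac telegraph processes on $\mathbb{R}$ with speeds $c_k>0$, Poisson rates $\lambda_k>0$ and starting points $x_k^0\in\mathbb{R}$, $k=1,\dots,n$. Let $a_1,\dots,a_n$ be real non-zero constants, and let $L(t)=\sum_{k=1}^n a_kX_k(t)$, $t\ge 0$. Under Kac's scaling conditions $$\lambda_k\to+\infty,\qquad c_k\to+\infty,\qquad \frac{c_k^2}{\lambda_k}\to\varrho_k,\quad \varrho_k>0,\qquad k=1,\dots,n,$$ the weak convergence $L(t)\Rightarrow W(t)$ of the process $L(t)$ to the process $W(t)$ takes place, where $W(t)$ is the homogeneous Wiener process on $\mathbb{R}$ with expectation and diffusion coefficient given, respectively, by $$\mathbb{E}\,W(t)=\sum_{k=1}^n a_kx_k^0,\qquad \sigma_W^2=\sum_{k=1}^n\varrho_k a_k^2 .$$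
   Context: Telegraph process: given $c>0$, $\lambda>0$, $x^0\in\mathbb{R}$, the Goldstein-Kac telegraph process with speed $c$, rate $\lambda$ and starting point $x^0$ is the position $X(t)$ of a particle that starts from $x^0$ at time $0$, picks an initial direction (positive or negative) at random with probabilities $1/2$ each, moves with constant speed $c$, and instantaneously reverses direction at every event of a homogeneous Poisson process $N(t)$ of rate $\lambda$. The Poisson processes $N_1(t),\dots,N_n(t)$ governing $X_1(t),\dots,X_n(t)$ are independent as well. The homogeneous Wiener process with (constant) expectation $m$ and diffusion coefficient $\sigma^2$ is the Brownian motion with zero drift started at $m$, that is, $W(t)=m+\sigma B(t)$ with $B$ a standard Brownian motion started at $0$; its characteristic function at time $t$ is $\exp\left(i\alpha m-\tfrac12\sigma^2\alpha^2t\right)$, $\alpha\in\mathbb{R}$. The coefficients $a_k$ and starting points $x_k^0$ are fixed, while all the pairs $(c_k,\lambda_k)$, $k=1,\dots,n$, vary simultaneously in the limit. *)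

(* Defs.v *)
From mathcomp Require Export all_boot all_order all_algebra.
From mathcomp Require Export all_classical all_reals all_analysis.
Export Order.TTheory GRing.Theory Num.Theory.
Export numFieldNormedType.Exports.

Set Implicit Arguments.
Unset Strict Implicit.
Unset Printing Implicit Defensive.

Local Open Scope classical_set_scope.
Local Open Scope ring_scope.

(* Stochastic processes are functions of a real time and of a sample point;
   only the times t >= 0 are meaningful, the values at t < 0 are junk. *)

Section Independence.
Context {R : realType} {d : measure_display} {T : measurableType d}.
Variable P : probability T R.

(* For families of sigma-algebras (the only ones used below). *)
Definition mutually_independent (I : finType) (S : I -> set_system T) : Prop :=
  forall (J : {set I}) (E : I -> set T),
    (forall i, i \in J -> S i (E i)) ->
    P (\bigcap_(i in [set` J]) E i) = (\prod_(i in J) P (E i))%E.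

Definition process_sigma_algebra {d'} {U : measurableType d'}
    (X : R -> T -> U) : set_system T :=
  <<s \bigcup_(t in [set t | 0 <= t]) g_sigma_algebra_preimage (X t) >>.

Definition independent_processes {d'} {U : measurableType d'} (n : nat)
    (X : 'I_n -> R -> T -> U) : Prop :=
  mutually_independent (fun k => process_sigma_algebra (X k)).

Definition independent_increments (X : R -> T -> R) : Prop :=
  forall (m : nat) (t : nat -> R), 0 <= t 0%N -> nondecreasing_seq t ->
    mutually_independent (fun i : 'I_m =>
      g_sigma_algebra_preimage (fun w => X (t i.+1) w - X (t i) w)).

End Independence.

Section Processes.
Context {R : realType} {d : measure_display} {T : measurableType d}.
Variable P : probability T R.

(* The paths are nondecreasing, right-continuous and nat-valued at every
   sample point; nat carries its discrete topology. *)
Record poisson_process (lam : R) (N : R -> T -> nat) : Prop := PoissonProcess {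
  poisson_measurable : forall t, 0 <= t -> measurable_fun setT (N t) ;
  poisson_start : forall w, N 0 w = 0%N ;
  poisson_nondecreasing : forall w s t, 0 <= s -> s <= t -> (N s w <= N t w)%N ;
  poisson_right_continuous :
    forall w t, 0 <= t -> N s w @[s --> t^'+] --> N t w ;
  poisson_independent_increments :
    independent_increments P (fun t w => (N t w)%:R) ;
  poisson_increments : forall s t k, 0 <= s -> s < t ->
    P [set w | N t w = (N s w + k)%N] = (poisson_pmf (lam * (t - s)) k)%:E
}.

(* D is the initial direction; the velocity at time s is c D (-1)^N(s), that
   is, the direction is reversed at each jump of N. *)
Definition telegraph_process (c lam x0 : R) (N : R -> T -> nat)
    (X : R -> T -> R) : Prop :=
  exists D : T -> R,
    [/\ measurable_fun setT D,
        (forall w, D w = 1 \/ D w = -1),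
        P [set w | D w = 1] = (2^-1)%:E /\ P [set w | D w = -1] = (2^-1)%:E,
        poisson_process lam N &
        mutually_independent P (fun b : bool =>
          if b then g_sigma_algebra_preimage D else process_sigma_algebra N)]
    /\ forall t w, 0 <= t ->
         X t w = x0 + \int[lebesgue_measure]_(s in `[0, t])
                        (c * D w * (-1) ^+ N s w).

(* The second parameter of normal_prob is the standard deviation. *)
Record standard_brownian_motion (B : R -> T -> R) : Prop :=
  StandardBrownianMotion {
  brownian_measurable : forall t, 0 <= t -> measurable_fun setT (B t) ;
  brownian_start : forall w, B 0 w = 0 ;
  brownian_continuous : forall w, {within `[0, +oo[, continuous (B ^~ w)} ;
  brownian_independent_increments : independent_increments P B ;
  brownian_increments : forall s t A, 0 <= s -> s < t -> measurable A ->
    P [set w | A (B t w - B s w)] = normal_prob 0 (Num.sqrt (t - s)) A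
}.

Definition wiener_process (m sigma2 : R) (W : R -> T -> R) : Prop :=
  exists B : R -> T -> R, standard_brownian_motion B /\
    forall t w, 0 <= t -> W t w = m + Num.sqrt sigma2 * B t w.

End Processes.

Definition linear_combination {R : realType} {T : Type} {n : nat}
    (a : 'I_n -> R) (X : 'I_n -> R -> T -> R) : R -> T -> R :=
  fun t w => \sum_(k < n) a k * X k t w.

(* Topology of uniform convergence on every [0, b].  It does not see the values
   at negative times, so that, restricted to continuous_paths, it is the usual
   topology of C([0, +oo[). *)
Notation path_space R :=
  {family [set `[0, b]%classic | b in [set: Real.sort R]],
     Real.sort R -> Real.sort R}.

Definition continuous_paths {R : realType} : set (path_space R) :=
  [set f | {within `[0, +oo[, continuous (f : R -> R)}].

(* Weak convergence of the laws on C([0, +oo[); the processes are meant to have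
   continuous paths.  Each Y j may live on its own probability space. *)
Definition weak_convergence {R : realType}
    {d : nat -> measure_display} {T : forall j, measurableType (d j)}
    (P : forall j, probability (T j) R) (Y : forall j, R -> T j -> R)
    {d' : measure_display} {T' : measurableType d'}
    (Q : probability T' R) (Z : R -> T' -> R) : Prop :=
  forall F : path_space R -> R,
    {within continuous_paths, continuous F} ->
    (exists M : R, forall f, continuous_paths f -> `|F f| <= M) ->
    ('E_(P j)[fun w => F (Y j ^~ w)] @[j --> \oo]
       --> 'E_Q[fun w => F (Z ^~ w)])%E.

Definition kac_scaling {R : realType} (lam c : nat -> R) (rho : R) : Prop :=
  [/\ lam j @[j --> \oo] --> +oo, c j @[j --> \oo] --> +oo &
      c j ^+ 2 / lam j @[j --> \oo] --> rho].

(* Main.v *)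
(* Tightness is replaced by a quantitative argument.  Both the combinations L_j
   and W start from a fixed point and satisfy E (Y t - Y s)^4 <= C (t - s)^2 with
   one constant C.  Chaining over dyadic times then puts their paths, up to
   probability e, in a class with a fixed modulus of continuity, compact by
   Arzela-Ascoli.  On this class a continuous functional is uniformly
   approximated by cylinder functionals (Stone-Weierstrass), so that the
   convergence of E cos(sum_p p.1 Y(p.2) + phi) for all finite families suffices.

   For one telegraph process the velocity is c D (-1)^N.  Observed on a grid,
   (-1)^N is a product of independent identically distributed signs, so its
   partial sums are a martingale up to a bounded boundary term; expanding the
   cosine along the martingale yields the Gaussian characteristic function with
   an error of order c / lambda, and the fourth moments of the partial sums give
   the increment bound 24 (c^2 / lambda)^2 (t - s)^2.  Independence over k turns
   the characteristic function of L into a product, because the sine parts vanish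
   by the symmetry of D. *)

Require Import Defs.
From mathcomp Require Import measurable_realfun zify ring lra.

Set Implicit Arguments.
Unset Strict Implicit.
Unset Printing Implicit Defensive.

Local Open Scope classical_set_scope.
Local Open Scope ring_scope.

(** * Expectations of bounded functions and independence *)

(** A telegraph process does not have independent increments, because the direction is remembered;
    what is independent is the sequence of parities of the Poisson increments on a grid. Adding
    [kap] times the current direction, with [kap] close to c / (2 lambda), turns the displacement
    into a martingale whose steps have conditional variance close to (c^2 / lambda) h for mesh h.
    This gives both the limit variance and the size of the error, since c / lambda = (c^2 / lambda)
    / c tends to 0 when c grows and the ratio converges.

    Two limits are taken in succession. The mesh vanishes at fixed c and lambda, with explicit
    bounds, which leaves inequalities in c and lambda alone; only then does Kac's scaling act. The
    Gaussian side is computed on the same grids, so that both sides meet in [covariance_form].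

    A continuous functional of the paths is not known to be measurable on the sample spaces. Its
    expectation is therefore only compared with that of a measurable cylinder functional, up to an
    event of small probability. *)

Lemma measurable_cos {R : realType} : measurable_fun [set: R] (@cos R).
Proof. exact: (continuous_measurable_fun (@continuous_cos R)). Qed.

Lemma measurable_sin {R : realType} : measurable_fun [set: R] (@sin R).
Proof. exact: (continuous_measurable_fun (@continuous_sin R)). Qed.

Section BoundedMeasurable.
Context {R : realType} {d : measure_display} {T : measurableType d}.
Variable P : probability T R.
Implicit Types f g : T -> R.

Definition bounded_measurable f :=
  measurable_fun setT f /\ exists M, forall x, `|f x| <= M.

Lemma bounded_measurable_cst a : bounded_measurable (fun=> a).
Proof. by split=> //; exists `|a|. Qed.

Lemma bounded_measurableD f g : bounded_measurable f -> bounded_measurable g ->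
  bounded_measurable (fun x => f x + g x).
Proof.
move=> [mf [M fM]] [mg [K gK]]; split; first exact: measurable_funD.
by exists (M + K) => x; rewrite (le_trans (ler_normD _ _))// lerD.
Qed.

Lemma bounded_measurableM f g : bounded_measurable f -> bounded_measurable g ->
  bounded_measurable (fun x => f x * g x).
Proof.
move=> [mf [M fM]] [mg [K gK]]; split; first exact: measurable_funM.
by exists (M * K) => x; rewrite normrM ler_pM.
Qed.

Lemma bounded_measurableZ a f : bounded_measurable f ->
  bounded_measurable (fun x => a * f x).
Proof. exact/bounded_measurableM/bounded_measurable_cst. Qed.

Lemma bounded_measurableB f g : bounded_measurable f -> bounded_measurable g ->
  bounded_measurable (fun x => f x - g x).
Proof.
move=> bf bg; have := bounded_measurableD bf (bounded_measurableZ (-1) bg).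
by congr bounded_measurable; apply/funext => x; rewrite mulN1r.
Qed.

Lemma bounded_measurableX n f : bounded_measurable f ->
  bounded_measurable (fun x => f x ^+ n).
Proof.
move=> bf; elim: n => [|n ih].
  by under eq_fun do rewrite expr0; exact: bounded_measurable_cst.
by under eq_fun do rewrite exprS; exact: bounded_measurableM.
Qed.

Lemma bounded_measurable_sum I (r : seq I) (Q : pred I) (f : I -> T -> R) :
  (forall i, bounded_measurable (f i)) ->
  bounded_measurable (fun x => \sum_(i <- r | Q i) f i x).
Proof.
move=> bf; elim: r => [|i r ih].
  by under eq_fun do rewrite big_nil; exact: bounded_measurable_cst.
under eq_fun do rewrite big_cons.
by case: (Q i) => //; exact: bounded_measurableD.
Qed.

Lemma bounded_measurable_prod I (r : seq I) (Q : pred I) (f : I -> T -> R) :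
  (forall i, bounded_measurable (f i)) ->
  bounded_measurable (fun x => \prod_(i <- r | Q i) f i x).
Proof.
move=> bf; elim: r => [|i r ih].
  by under eq_fun do rewrite big_nil; exact: bounded_measurable_cst.
under eq_fun do rewrite big_cons.
by case: (Q i) => //; exact: bounded_measurableM.
Qed.

Lemma bounded_measurable_cos f : measurable_fun setT f ->
  bounded_measurable (fun x => cos (f x)).
Proof.
move=> mf; split; first exact: measurableT_comp measurable_cos _.
by exists 1 => x; rewrite ler_norml cos_geN1 cos_le1.
Qed.

Lemma bounded_measurable_sin f : measurable_fun setT f ->
  bounded_measurable (fun x => sin (f x)).
Proof.
move=> mf; split; first exact: measurableT_comp measurable_sin _.
by exists 1 => x; rewrite ler_norml sin_geN1 sin_le1.
Qed.

Lemma bounded_measurable_norm f : bounded_measurable f ->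
  bounded_measurable (fun x => `|f x|).
Proof.
move=> [mf [M fM]]; split; first exact: measurableT_comp.
by exists M => x; rewrite normr_id.
Qed.

Lemma bounded_measurable_indic (A : set T) : measurable A ->
  bounded_measurable (\1_A : T -> R).
Proof.
move=> mA; split; first exact: measurable_indic.
by exists 1 => x; rewrite indicE; case: (_ \in _); rewrite ?normr0 ?normr1.
Qed.

Lemma bounded_measurable_integrable f : bounded_measurable f ->
  P.-integrable setT (EFin \o f).
Proof.
move=> [mf [M fM]]; apply: measurable_bounded_integrable => //.
  by rewrite (le_lt_trans (probability_le1 _ _))// ltry.
exists M; split; first exact: num_real.
by move=> K MK x _; exact: le_trans (fM x) (ltW MK).
Qed.

Local Notation E f := (\int[P]_x f x).

Lemma expect_cst a : E (fun=> a) = a.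
Proof. by rewrite Rintegral_cst//= probability_setT mulr1. Qed.

Lemma expectD f g : bounded_measurable f -> bounded_measurable g ->
  E (fun x => f x + g x) = E f + E g.
Proof. by move=> bf bg; rewrite RintegralD//; exact: bounded_measurable_integrable. Qed.

Lemma expectB f g : bounded_measurable f -> bounded_measurable g ->
  E (fun x => f x - g x) = E f - E g.
Proof. by move=> bf bg; rewrite RintegralB//; exact: bounded_measurable_integrable. Qed.

Lemma expectZ a f : bounded_measurable f -> E (fun x => a * f x) = a * E f.
Proof. by move=> bf; rewrite RintegralZl//; exact: bounded_measurable_integrable. Qed.

Lemma expect_le f g : bounded_measurable f -> bounded_measurable g ->
  (forall x, f x <= g x) -> E f <= E g.
Proof.
by move=> bf bg fg; apply: le_Rintegral => //; exact: bounded_measurable_integrable.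
Qed.

Lemma expect_norm_le f g : bounded_measurable f -> bounded_measurable g ->
  (forall x, `|f x| <= g x) -> `|E f| <= E g.
Proof.
move=> bf bg fg; rewrite (le_trans (le_normr_Rintegral _ _))//.
  exact: bounded_measurable_integrable.
by apply: expect_le => //; exact: bounded_measurable_norm.
Qed.

Lemma expect_norm_le_cst f M : bounded_measurable f ->
  (forall x, `|f x| <= M) -> `|E f| <= M.
Proof.
move=> bf fM; rewrite -[leRHS]expect_cst.
by apply: expect_norm_le => //; exact: bounded_measurable_cst.
Qed.

Lemma expect_dist_le f g e : bounded_measurable f -> bounded_measurable g ->
  (forall x, `|f x - g x| <= e) -> `|E f - E g| <= e.
Proof.
move=> bf bg fg; rewrite -expectB//.
by apply: expect_norm_le_cst => //; exact: bounded_measurableB.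
Qed.

Lemma expect_sum I (r : seq I) (Q : pred I) (f : I -> T -> R) :
  (forall i, bounded_measurable (f i)) ->
  E (fun x => \sum_(i <- r | Q i) f i x) = \sum_(i <- r | Q i) E (f i).
Proof.
move=> bf; elim: r => [|i r ih].
  by under eq_Rintegral do rewrite big_nil; rewrite big_nil expect_cst.
under eq_Rintegral do rewrite big_cons; rewrite big_cons.
case: (Q i) => //; rewrite expectD// ?ih//.
exact: bounded_measurable_sum.
Qed.

Lemma expect_indic (A : set T) : measurable A -> E (\1_A) = fine (P A).
Proof. by move=> mA; rewrite /Rintegral integral_indic// setIT. Qed.

(** Dominated convergence under a constant bound. The regularity of the limit is part of the
    conclusion, so that it need not be proved separately at each use. *)
Lemma expect_cvg (f_ : nat -> T -> R) f M :
  (forall n, measurable_fun setT (f_ n)) ->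
  (forall n x, `|f_ n x| <= M) ->
  (forall x, f_ ^~ x @ \oo --> f x) ->
  bounded_measurable f /\ E (f_ n) @[n --> \oo] --> E f.
Proof.
move=> mf fM ff.
have mF : measurable_fun setT f.
  by apply: (measurable_fun_cvg (h := f_)) => // x _; exact: ff.
have bf : bounded_measurable f.
  split=> //; exists M => x.
  have cn : `|f_ n x| @[n --> \oo] --> `|f x| by apply: cvg_norm; exact: ff.
  rewrite -(cvg_lim _ cn)//; apply: limr_le; first by apply: cvgP cn.
  by apply: nearW => n; exact: fM.
split=> //.
have [|||||_ _ h] := @dominated_convergence _ T R P setT measurableT
  (fun n => EFin \o f_ n) (EFin \o f) (cst M%:E).
- by move=> n; exact/measurable_EFinP.
- exact/measurable_EFinP.
- by apply: aeW => x _ /=; apply: cvg_EFin; [exact: nearW|exact: ff].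
- exact: finite_measure_integrable_cst.
- by apply: aeW => x n _ /=; rewrite lee_fin.
apply: fine_cvg; rewrite fineK//.
exact: integrable_fin_num (bounded_measurable_integrable bf).
Qed.

Lemma EFin_expect f : bounded_measurable f -> ('E_P[f])%E = (E f)%:E.
Proof.
move=> bf; rewrite unlock fineK//.
exact: integrable_fin_num (bounded_measurable_integrable bf).
Qed.

End BoundedMeasurable.

Lemma cvgr_prod {R : realType} {S : Type} (F : set_system S) {FF : Filter F}
    (I : Type) (r : seq I) (Q : pred I) (f : I -> S -> R) (l : I -> R) :
  (forall i, Q i -> f i x @[x --> F] --> l i) ->
  \prod_(i <- r | Q i) f i x @[x --> F] --> \prod_(i <- r | Q i) l i.
Proof. by move=> fl; apply: cvg_big => //; exact: mul_continuous. Qed.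

Section IndependentProducts.
Context {R : realType} {d : measure_display} {T : measurableType d}.
Variable P : probability T R.
Local Notation E f := (\int[P]_x f x).

(** The case of simple functions. Distributivity turns the product of sums into a sum over choice
    functions, and each product of indicators is the indicator of an intersection, to which
    independence applies. *)
Lemma expect_prod_indic (I : finType) (S : I -> set_system T)
    (K : nat) (u : I -> 'I_K -> R) (A : I -> 'I_K -> set T) :
  mutually_independent P S -> (forall i B, S i B -> measurable B) ->
  (forall i k, S i (A i k)) ->
  E (fun x => \prod_i \sum_k u i k * \1_(A i k) x) =
  \prod_i E (fun x => \sum_k u i k * \1_(A i k) x).
Proof.
move=> indep mS SA.
have mA i k : measurable (A i k) by apply: (mS i).
have bA i k : bounded_measurable (fun x => u i k * \1_(A i k) x : R).
  by apply: bounded_measurableZ; exact: bounded_measurable_indic.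
under eq_Rintegral do rewrite bigA_distr_bigA.
rewrite expect_sum; last by move=> f; apply: bounded_measurable_prod.
have Eik i : E (fun x => \sum_k u i k * \1_(A i k) x) =
    \sum_k u i k * fine (P (A i k)).
  rewrite expect_sum//; apply: eq_bigr => k _.
  by rewrite expectZ ?expect_indic//; exact: bounded_measurable_indic.
under [RHS]eq_bigr do rewrite Eik.
rewrite bigA_distr_bigA; apply: eq_bigr => /= f _.
under eq_Rintegral => x _.
  rewrite big_split/= (_ : \prod_i \1_(A i (f i)) x =
    \1_(\bigcap_(i in [set` finset.setT]) A i (f i)) x); last first.
    have [xA|xA] := boolP (x \in \bigcap_(i in [set` finset.setT]) A i (f i)).
      rewrite indicE xA big1// => i _; rewrite indicE mem_set//.
      by move: xA; rewrite inE => /(_ i); apply; rewrite /= finset.in_setT.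
    rewrite indicE (negbTE xA); apply/eqP; rewrite prodf_seq_eq0.
    apply/hasP; move: xA; rewrite notin_setE.
    move=> /existsNP[i /not_implyP[_ xAi]]; exists i; first exact: mem_index_enum.
    by rewrite /= indicE memNset.
  over.
have mcap : measurable (\bigcap_(i in [set` finset.setT]) A i (f i)).
  by apply: fin_bigcap_measurable => //; exact: finite_finset.
rewrite expectZ; last exact: bounded_measurable_indic.
rewrite expect_indic// big_split/=; congr (_ * _).
rewrite indep//.
transitivity (fine (\prod_i P (A i (f i)))%E).
  by congr fine; apply: eq_bigl => i; rewrite finset.in_setT.
rewrite (eq_bigr (fun i => (fine (P (A i (f i))))%:E)) ?prodEFin//.
by move=> i _; rewrite fineK//; exact: fin_num_measure.
Qed.

(** Each factor is the uniform limit of staircase functions, and dominated convergence transfers the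
    product formula. A bound [M] common to all factors gives all staircases the same number of
    levels, as [expect_prod_indic] requires. *)
Lemma expect_prod_indep (I : finType) (S : I -> set_system T)
    (f : I -> T -> R) :
  mutually_independent P S -> (forall i B, S i B -> measurable B) ->
  (forall i B, measurable B -> S i (f i @^-1` B)) ->
  (forall i, bounded_measurable (f i)) ->
  E (fun x => \prod_i f i x) = \prod_i E (f i).
Proof.
move=> indep mS Sf bf.
have [M fM] : exists M : R, forall i x, `|f i x| <= M.
  have [M fM] : exists M, forall i x, `|f i x| <= M i.
    by have /choice[M fM] := fun i => (bf i).2; exists M.
  exists (\sum_i `|M i|) => i x; rewrite (le_trans (fM i x))//.
  by rewrite (bigD1 i)//= (le_trans (ler_norm _))// lerDl sumr_ge0.
(* The range [-M, M] is cut into cells of length 1 / (m + 1), half-open on the right; the successor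
   provides the cell that contains the value M. *)
pose K m := (Num.truncn (2 * M * m.+1%:R)).+1.
pose u m k : R := k%:R / m.+1%:R - M.
pose B m k := `[u m k, u m k.+1[%classic.
pose A m i (k : 'I_(K m)) := f i @^-1` B m k.
pose g m i x : R := \sum_(k < K m) u m k * \1_(A m i k) x.
have gf m i x : `|g m i x - f i x| <= m.+1%:R^-1.
  have memA k : (x \in A m i k) = (f i x \in B m k).
    by apply/idP/idP; rewrite !inE.
  have [fge fle] : - M <= f i x /\ f i x <= M.
    by apply/andP; rewrite -ler_norml.
  have y0 : 0 <= (f i x + M) * m.+1%:R by apply: mulr_ge0 => //; lra.
  pose k0 := Num.truncn ((f i x + M) * m.+1%:R).
  have k0K : (k0 < K m)%N.
    rewrite ltnS le_truncn// ler_wpM2r//; lra.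
  have inB k : (f i x \in B m k) = (k == k0).
    rewrite eq_sym truncn_eq// /B /u; apply/idP/idP.
      rewrite inE/= in_itv/= lerBlDr ltrBrDr => /andP[a b].
      by rewrite -ler_pdivrMr// a -ltr_pdivlMr.
    move=> /andP[a b]; rewrite inE/= in_itv/= lerBlDr ltrBrDr.
    by rewrite ler_pdivrMr// a ltr_pdivlMr.
  rewrite /g (bigD1 (Ordinal k0K))//= big1 ?addr0; last first.
    by move=> k kk; rewrite indicE memA inB (negbTE (_ : (k : nat) != k0)) ?mulr0.
  rewrite indicE memA inB eqxx mulr1.
  have : f i x \in B m k0 by rewrite inB.
  rewrite inE /B/= in_itv/= /u -[k0.+1]addn1 natrD mulrDl mul1r => /andP[a b].
  move: a b; rewrite distrC /u; move: (m.+1%:R^-1) (k0%:R / _) => z y a b.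
  by rewrite ger0_norm; lra.
have mB m k : measurable (B m k) by exact: measurable_itv.
have mA m i k : measurable (A m i k) by apply: (mS i); exact: Sf.
have bg m i : bounded_measurable (g m i).
  apply: bounded_measurable_sum => k; apply: bounded_measurableZ.
  exact: bounded_measurable_indic.
have gM m i x : `|g m i x| <= M + 1.
  rewrite -(subrK (f i x) (g m i x)) (le_trans (ler_normD _ _))// addrC lerD//.
  by rewrite (le_trans (gf m i x))// invf_le1// ler1n.
have cg i x : g m i x @[m --> \oo] --> f i x.
  apply/cvgrPdist_le => e e0; near=> m.
  rewrite distrC (le_trans (gf m i x))//; near: m.
  exists (Num.truncn e^-1) => // k /= ek; rewrite invf_ple ?posrE//.
  by rewrite (le_trans (ltW (truncnS_gt _)))// ler_nat ltnS.
have E1 i : E (g m i) @[m --> \oo] --> E (f i).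
  have [|||] := @expect_cvg _ _ _ P (g ^~ i) (f i) (M + 1) => // m.
  by case: (bg m i).
have E2 : E (fun x => \prod_i g m i x) @[m --> \oo] --> E (fun x => \prod_i f i x).
  have [|||_] := @expect_cvg _ _ _ P (fun m x => \prod_i g m i x)
    (fun x => \prod_i f i x) ((M + 1) ^+ #|I|) => //.
  - by move=> m; case: (@bounded_measurable_prod _ _ _ _ (index_enum I) xpredT (g m) (bg m)).
  - move=> m x; rewrite normr_prod -prodr_const.
    by apply: ler_prod => i _; rewrite normr_ge0 gM.
  - by move=> x; apply: cvgr_prod => // i _; exact: cg.
have E3 : (fun m => E (fun x => \prod_i g m i x)) = (fun m => \prod_i E (g m i)).
  apply/funext => m; apply: (@expect_prod_indic I S (K m) (fun _ k => u m k) (A m)) => //.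
  by move=> i k; exact: Sf.
rewrite E3 in E2; apply: cvg_unique E2 _ => //.
by apply: cvgr_prod => i _; exact: E1.
Unshelve. all: by end_near. Qed.

(** Induction on [s]: the addition formula splits off the angle of one index, whose cosine or sine
    then becomes the factor of that index among the [g]. Hence the extra product in the statement.
    The sine of the remaining sum is the cosine at the phase lowered by pi / 2, so the same
    induction hypothesis covers both terms, and the second one vanishes. *)
Lemma expect_cos_sum_indep_seq (I : finType) (S : I -> set_system T)
    (th g : I -> T -> R) (r : I -> R) (phi : R) (s : seq I) :
  mutually_independent P S -> (forall i B, S i B -> measurable B) ->
  (forall i B, measurable B -> S i (th i @^-1` B)) ->
  (forall i, E (fun x => cos (th i x)) = r i) ->
  (forall i, E (fun x => sin (th i x)) = 0) ->
  (forall i B, measurable B -> S i (g i @^-1` B)) ->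
  (forall i, bounded_measurable (g i)) ->
  uniq s ->
  E (fun x => cos (\sum_(i <- s) th i x + phi) * \prod_(i | i \notin s) g i x) =
  cos phi * \prod_(i <- s) r i * \prod_(i | i \notin s) E (g i).
Proof.
move=> indep mS Sth Ec Es.
have mth i : measurable_fun setT (th i).
  by move=> _ B mB; rewrite setTI; apply: (mS i); exact: Sth.
elim: s phi g => [|i s ih] phi g Sg bg.
  move=> _; rewrite big_nil mulr1.
  under eq_Rintegral do rewrite big_nil add0r.
  rewrite expectZ; last exact: bounded_measurable_prod.
  by rewrite (expect_prod_indep indep mS Sg bg).
move=> /= /andP[iNs us].
pose upd (h : T -> R) j := if j == i then h else g j.
have updP (F : (T -> R) -> R) (h : T -> R) :
    \prod_(j | j \notin s) F (upd h j) =
    F h * \prod_(j | j \notin i :: s) F (g j).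
  rewrite (bigD1 i)//= /upd eqxx; congr (_ * _); apply: eq_big => [j|j].
    by rewrite inE negb_or andbC.
  by move=> /andP[_ /negbTE ->].
have upd_ok (f : R -> R) : measurable_fun setT f -> (forall y, `|f y| <= 1) ->
    (forall j B, measurable B -> S j (upd (f \o th i) j @^-1` B)) /\
    (forall j, bounded_measurable (upd (f \o th i) j)).
  move=> mf f1; rewrite /upd; split=> j.
    move=> B mB; case: eqP => [->|_]; last exact: Sg.
    rewrite (_ : _ @^-1` _ = th i @^-1` (f @^-1` B))//; apply: Sth.
    by rewrite -[X in measurable X]setTI; exact: mf.
  case: eqP => // _; split; first exact: measurableT_comp.
  by exists 1 => x; exact: f1.
have [c1 c2] := upd_ok cos measurable_cos (fun y =>
  etrans (ler_norml _ _) (introT andP (conj (cos_geN1 y) (cos_le1 y)))).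
have [s1 s2] := upd_ok sin measurable_sin (fun y =>
  etrans (ler_norml _ _) (introT andP (conj (sin_geN1 y) (sin_le1 y)))).
have H1 := ih phi _ c1 c2 us; have H2 := ih (phi - pi / 2) _ s1 s2 us.
rewrite (updP (fun h => E h)) [E (cos \o _)]Ec in H1.
rewrite (updP (fun h => E h)) [E (sin \o _)]Es mul0r mulr0 in H2.
transitivity (E (fun x => cos (\sum_(i <- s) th i x + phi) *
      \prod_(j | j \notin s) upd (cos \o th i) j x -
    cos (\sum_(i <- s) th i x + (phi - pi / 2)) *
      \prod_(j | j \notin s) upd (sin \o th i) j x)).
  apply: eq_Rintegral => x _; rewrite !(updP (@^~ x))/= big_cons.
  rewrite -addrA cosD [in X in _ = _ - X]addrA cosB.
  by rewrite cos_pihalf sin_pihalf; ring.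
rewrite expectB ?H1 ?H2 ?subr0; first by rewrite big_cons; ring.
- apply: bounded_measurableM; last exact: bounded_measurable_prod.
  apply: bounded_measurable_cos; apply: measurable_funD => //.
  exact: measurable_sum.
- apply: bounded_measurableM; last exact: bounded_measurable_prod.
  apply: bounded_measurable_cos; apply: measurable_funD => //.
  exact: measurable_sum.
Qed.

Lemma expect_cos_sum_indep (I : finType) (S : I -> set_system T)
    (th : I -> T -> R) (r : I -> R) (phi : R) :
  mutually_independent P S -> (forall i B, S i B -> measurable B) ->
  (forall i B, measurable B -> S i (th i @^-1` B)) ->
  (forall i, E (fun x => cos (th i x)) = r i) ->
  (forall i, E (fun x => sin (th i x)) = 0) ->
  E (fun x => cos (\sum_i th i x + phi)) = cos phi * \prod_i r i.
Proof.
move=> indep mS Sth Ec Es.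
have := @expect_cos_sum_indep_seq I S th (fun i x => cos (th i x)) r phi
  (index_enum I) indep mS Sth Ec Es.
rewrite [X in _ = _ * X]big_pred0 => [|i]; last by rewrite mem_index_enum.
rewrite mulr1 => <-.
- apply: eq_Rintegral => x _.
  by rewrite big_pred0 ?mulr1// => i; rewrite mem_index_enum.
- move=> i B mB; rewrite (_ : _ @^-1` _ = th i @^-1` (cos @^-1` B))//.
  by apply: Sth; rewrite -[X in measurable X]setTI; exact: measurable_cos.
- move=> i; apply: bounded_measurable_cos.
  by move=> _ B mB; rewrite setTI; apply: (mS i); exact: Sth.
- exact: index_enum_uniq.
Qed.

End IndependentProducts.

(** * Cylinder functionals *)

Section CylinderFunctionals.
Context {R : realType}.
Implicit Types A B : (R -> R) -> R.

Definition evaluation (s : seq (R * R)) (f : R -> R) : R :=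
  \sum_(p <- s) p.1 * f p.2.

Definition trigonometric (s : seq (R * R)) (phi : R) (f : R -> R) : R :=
  cos (evaluation s f + phi).

(** The uniformly closed span of the trigonometric functionals. With an inductive presentation,
    boundedness, measurability, continuity and convergence of expectations are each proved by one
    induction, while products and lattice operations are derived. Only nonnegative times may occur,
    the other values of a process being junk. *)
Inductive cylinder : ((R -> R) -> R) -> Prop :=
| cylinder_trig s phi : (forall p, p \in s -> 0 <= p.2) ->
    cylinder (trigonometric s phi)
| cylinderD A B : cylinder A -> cylinder B -> cylinder (fun f => A f + B f)
| cylinderZ c A : cylinder A -> cylinder (fun f => c * A f)
| cylinder_lim (A_ : nat -> (R -> R) -> R) A : (forall n, cylinder (A_ n)) ->
    (forall e, 0 < e -> exists n, forall f, `|A_ n f - A f| <= e) ->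
    cylinder A.

Lemma cylinder_cst c : cylinder (fun=> c).
Proof.
have h : cylinder (fun f => c * trigonometric [::] 0 f).
  by apply: cylinderZ; exact: cylinder_trig.
rewrite (_ : (fun=> c) = fun f => c * trigonometric [::] 0 f)//.
by apply/funext => f; rewrite /trigonometric /evaluation big_nil addr0 cos0 mulr1.
Qed.

Lemma cylinderB A B : cylinder A -> cylinder B -> cylinder (fun f => A f - B f).
Proof.
move=> cA cB; have := cylinderD cA (cylinderZ (-1) cB).
by congr cylinder; apply/funext => f; rewrite mulN1r.
Qed.

Lemma cylinder_bounded A : cylinder A -> exists M, forall f, `|A f| <= M.
Proof.
elim=> [s phi _|{}A B _ [M AM] _ [K BK]|c {}A _ [M AM]|A_ {}A _ ih AA].
- by exists 1 => f; rewrite ler_norml cos_geN1 cos_le1.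
- by exists (M + K) => f; rewrite (le_trans (ler_normD _ _))// lerD.
- by exists (`|c| * M) => f; rewrite normrM ler_wpM2l.
- have [n An] := AA 1 ltr01; have [M AM] := ih n; exists (1 + M) => f.
  rewrite -(subrK (A_ n f) (A f)) (le_trans (ler_normD _ _))// lerD//.
  by rewrite distrC.
Qed.

Lemma cylinderM_lim A (B_ : nat -> (R -> R) -> R) B : cylinder A ->
  (forall n, cylinder (fun f => A f * B_ n f)) ->
  (forall e, 0 < e -> exists n, forall f, `|B_ n f - B f| <= e) ->
  cylinder (fun f => A f * B f).
Proof.
move=> cA cAB BB; apply: (cylinder_lim cAB) => e e0.
have [M AM] := cylinder_bounded cA.
have M0 : 0 < M + 1 by have := AM (fun=> 0); have := normr_ge0 (A (fun=> 0)); lra.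
have [n Bn] := BB (e / (M + 1)) (divr_gt0 e0 M0); exists n => f.
rewrite -mulrBr normrM.
have -> : e = (M + 1) * (e / (M + 1)) by rewrite mulrCA divff ?mulr1// gt_eqF.
by rewrite ler_pM// (le_trans (AM f)); lra.
Qed.

(** Induction on both factors. Two cosines multiply by the product-to-sum formula, the difference of
    their arguments being obtained by negating the weights of the second list. *)
Lemma cylinderM A B : cylinder A -> cylinder B -> cylinder (fun f => A f * B f).
Proof.
move=> + cB; elim=> [s phi s0|{}A A' _ ihA _ ihA'|c {}A _ ih|A_ {}A cA ih AA].
- have cs : cylinder (trigonometric s phi) by exact: cylinder_trig.
  elim: cB => [t psi t0|{}B B' _ ihB _ ihB'|c {}B _ ih|B_ {}B _ ih BB].
  + have c1 : cylinder (trigonometric (s ++ t) (phi + psi)).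
      by apply: cylinder_trig => p; rewrite mem_cat => /orP[/s0|/t0].
    have c2 : cylinder
        (trigonometric (s ++ [seq (- p.1, p.2) | p <- t]) (phi - psi)).
      apply: cylinder_trig => p; rewrite mem_cat => /orP[/s0//|].
      by move=> /mapP[q /t0 q0 ->].
    have := cylinderZ 2^-1 (cylinderD c1 c2); congr cylinder; apply/funext => f.
    rewrite /trigonometric /evaluation !big_cat/= big_map/=.
    under [X in _ + cos (_ + X + _)]eq_bigr do rewrite mulNr.
    rewrite sumrN; move: (\sum_(p <- s) _) (\sum_(p <- t) _) => a b.
    rewrite (addrACA a b) (addrACA a (- b)) -opprD cosB (cosD (a + phi)).
    by field.
  + by under eq_fun do rewrite mulrDr; exact: cylinderD.
  + by under eq_fun do rewrite mulrCA; exact: cylinderZ.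
  + exact: cylinderM_lim ih BB.
- by under eq_fun do rewrite mulrDl; exact: cylinderD.
- by under eq_fun do rewrite -mulrA; exact: cylinderZ.
- under eq_fun do rewrite mulrC; apply: (cylinderM_lim cB _ AA) => n.
  by under eq_fun do rewrite mulrC; exact: ih.
Qed.

(* Newton-type iteration [p + (x^2 - p^2) / 2] increasing to [|x|] on [-1, 1]. *)
Fixpoint abs_approx (n : nat) (x : R) : R :=
  if n is m.+1 then abs_approx m x + 2^-1 * (x ^+ 2 - abs_approx m x ^+ 2) else 0.

(** The error r = |x| - p becomes r (1 - (|x| + p) / 2), at most r (1 - r / 2) because |x| + p >= r.
    This recursion forces a decay of order 2 / n, uniformly in x. *)
Lemma abs_approx_bounds n x : `|x| <= 1 ->
  0 <= abs_approx n x <= `|x| /\ `|x| - abs_approx n x <= 2 / n.+1%:R.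
Proof.
move=> x1; elim: n => [|n [/andP[p0 px] h]] /=.
  by rewrite lexx normr_ge0 subr0 divr1; split=> //; lra.
rewrite -real_normK ?num_real//.
move: (`|x|) (abs_approx n x) x1 p0 px h => y p y1 p0 py h.
split; first by apply/andP; split; nra.
pose r := y - p.
have e1 : y - (p + 2^-1 * (y ^+ 2 - p ^+ 2)) <= r * (1 - r / 2) by rewrite /r; nra.
apply: (le_trans e1).
have n0 : (0 : R) < n.+1%:R by [].
set u : R := n.+1%:R in n0 h *.
have -> : n.+2%:R = u + 1 by rewrite /u [in LHS]mulrSr.
rewrite ler_pdivlMr; last lra.
have r0 : 0 <= r by rewrite /r; lra.
have r1 : r <= 1 by rewrite /r; lra.
have hr : r * u <= 2 by rewrite -ler_pdivlMr.
have u1 : 1 <= u by rewrite /u ler1n.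
nra.
Qed.

Lemma cylinder_abs A : cylinder A -> cylinder (fun f => `|A f|).
Proof.
suff H B : cylinder B -> (forall f, `|B f| <= 1) -> cylinder (fun f => `|B f|).
  move=> cA; have [M AM] := cylinder_bounded cA.
  have M0 : 0 < M + 1 by have := AM (fun=> 0); have := normr_ge0 (A (fun=> 0)); lra.
  have := cylinderZ (M + 1) (H _ (cylinderZ (M + 1)^-1 cA) _).
  have -> : (fun f => (M + 1) * `|(M + 1)^-1 * A f|) = (fun f => `|A f|).
    by apply/funext => f; rewrite normrM gtr0_norm ?invr_gt0// mulVKf// gt_eqF.
  apply=> f; rewrite normrM gtr0_norm ?invr_gt0// mulrC ler_pdivrMr// mul1r.
  by rewrite (le_trans (AM f))//; lra.
move=> cB B1; apply: (@cylinder_lim (fun n f => abs_approx n (B f))) => [n|e e0].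
  elim: n => [|n ih] /=; first exact: cylinder_cst.
  apply: cylinderD => //; apply: cylinderZ; apply: cylinderB.
    by under eq_fun do rewrite expr2; exact: cylinderM.
  by under eq_fun do rewrite expr2; exact: cylinderM.
exists (Num.truncn (2 / e)) => f.
have [/andP[_ h1] h2] := abs_approx_bounds (Num.truncn (2 / e)) (B1 f).
rewrite distrC ger0_norm ?subr_ge0// (le_trans h2)//.
by rewrite ler_pdivrMr// mulrC -ler_pdivrMr// ltW// truncnS_gt.
Qed.

Lemma cylinder_max A B : cylinder A -> cylinder B ->
  cylinder (fun f => Num.max (A f) (B f)).
Proof.
move=> cA cB.
have := cylinderZ 2^-1 (cylinderD (cylinderD cA cB) (cylinder_abs (cylinderB cA cB))).
congr cylinder; apply/funext => f.
by case: (lerP (A f) (B f)) => h; field.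
Qed.

Lemma cylinder_min A B : cylinder A -> cylinder B ->
  cylinder (fun f => Num.min (A f) (B f)).
Proof.
move=> cA cB.
have := cylinderB (cylinderD cA cB) (cylinder_max cA cB).
by congr cylinder; apply/funext => f; case: (lerP (A f) (B f)) => h; ring.
Qed.

Lemma cylinder_continuous (X : topologicalType) (ev : X -> R -> R) A :
  (forall t, continuous (ev ^~ t)) -> cylinder A -> continuous (A \o ev).
Proof.
move=> cev; elim=> [s phi _|{}A B _ ihA _ ihB|c {}A _ ih|A_ {}A _ ih AA] f.
- apply: (cvg_comp _ cos); last exact: continuous_cos.
  apply: cvgD; last exact: cvg_cst.
  apply: cvg_big => [|p _]; first exact: add_continuous.
  by apply: cvgM; [exact: cvg_cst|exact: cev].
- by apply: cvgD; [exact: ihA|exact: ihB].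
- by apply: cvgM; [exact: cvg_cst|exact: ih].
- apply/cvgrPdist_le => e e0.
  have e3 : 0 < e / 3 by lra.
  have [n An] := AA _ e3.
  have /cvgrPdist_le/(_ _ e3) := ih n f; apply: filterS => g /= h.
  have := An (ev f); have := An (ev g); move: h.
  by rewrite !ler_norml => /andP[? ?] /andP[? ?] /andP[? ?]; apply/andP; split; lra.
Qed.

Section Expectation.
Context {d : measure_display} {T : measurableType d}.

Lemma measurable_evaluation (Y : R -> T -> R) (s : seq (R * R)) :
  (forall t, 0 <= t -> measurable_fun setT (Y t)) ->
  (forall p, p \in s -> 0 <= p.2) ->
  measurable_fun setT (fun w => evaluation s (Y ^~ w)).
Proof.
move=> mY; elim: s => [|p s ih] s0.
  rewrite (_ : (fun _ => _) = fun=> 0 : R)//; apply/funext => w.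
  by rewrite /evaluation big_nil.
rewrite (_ : (fun _ => _) = fun w => p.1 * Y p.2 w + evaluation s (Y ^~ w)); last first.
  by apply/funext => w; rewrite /evaluation big_cons.
apply: measurable_funD.
  by apply: measurable_funM => //; apply: mY; apply: s0; rewrite mem_head.
by apply: ih => q qs; apply: s0; rewrite inE qs orbT.
Qed.

Lemma cylinder_measurable (Y : R -> T -> R) A :
  (forall t, 0 <= t -> measurable_fun setT (Y t)) -> cylinder A ->
  bounded_measurable (fun w => A (Y ^~ w)).
Proof.
move=> mY cA; split; last first.
  by have [M AM] := cylinder_bounded cA; exists M.
elim: cA => [s phi s0|{}A B _ ihA _ ihB|c {}A _ ih|A_ {}A _ ih AA].
- apply: measurableT_comp; first exact: measurable_cos.
  by apply: measurable_funD => //; exact: measurable_evaluation.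
- exact: measurable_funD.
- exact: measurable_funM.
- have /choice[k Ak] : forall m : nat, exists n, forall f, `|A_ n f - A f| <= m.+1%:R^-1.
    by move=> m; apply: AA.
  apply: (measurable_fun_cvg (h := fun m w => A_ (k m) (Y ^~ w))) => // w _.
  apply/cvgrPdist_le => e e0; exists (Num.truncn e^-1) => // m /= em.
  rewrite distrC (le_trans (Ak _ _))// invf_ple ?posrE//.
  by rewrite (le_trans (ltW (truncnS_gt _)))// ler_nat ltnS.
Qed.

End Expectation.

(** In the case of a uniform limit the approximation error is the same under every [P j] and under
    [Q], so three errors of size e / 3 suffice. *)
Lemma cylinder_expect_cvg
    {d : nat -> measure_display} {T : forall j, measurableType (d j)}
    (P : forall j, probability (T j) R) (Y : forall j, R -> T j -> R)
    {d' : measure_display} {T' : measurableType d'}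
    (Q : probability T' R) (Z : R -> T' -> R) A :
  (forall j t, 0 <= t -> measurable_fun setT (Y j t)) ->
  (forall t, 0 <= t -> measurable_fun setT (Z t)) ->
  (forall s phi, (forall p, p \in s -> 0 <= p.2) ->
    \int[P j]_w trigonometric s phi (Y j ^~ w) @[j --> \oo] -->
    \int[Q]_w trigonometric s phi (Z ^~ w)) ->
  cylinder A ->
  \int[P j]_w A (Y j ^~ w) @[j --> \oo] --> \int[Q]_w A (Z ^~ w).
Proof.
move=> mY mZ fdd; elim=> [s phi s0|{}A B cA ihA cB ihB|c {}A cA ih|A_ {}A cA ih AA].
- exact: fdd.
- rewrite expectD; [|exact: cylinder_measurable..].
  rewrite (_ : (fun j => _) = fun j => \int[P j]_w A (Y j ^~ w) +
      \int[P j]_w B (Y j ^~ w)); first exact: cvgD.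
  by apply/funext => j; rewrite expectD//; exact: cylinder_measurable (mY j) _.
- rewrite expectZ; last exact: cylinder_measurable.
  rewrite (_ : (fun j => _) = fun j => c * \int[P j]_w A (Y j ^~ w)).
    by apply: cvgM => //; exact: cvg_cst.
  by apply/funext => j; rewrite expectZ//; exact: cylinder_measurable (mY j) _.
- apply/cvgrPdist_le => e e0; have e3 : 0 < e / 3 by lra.
  have [n An] := AA _ e3.
  have /cvgrPdist_le/(_ _ e3) := ih n; apply: filterS => j /= h.
  have cAl : cylinder A by exact: cylinder_lim AA.
  have b1 := @cylinder_measurable _ (T j) _ _ (mY j) (cA n).
  have b2 := @cylinder_measurable _ (T j) _ _ (mY j) cAl.
  have b3 := @cylinder_measurable _ T' _ _ mZ (cA n).
  have b4 := @cylinder_measurable _ T' _ _ mZ cAl.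
  have h1 := expect_dist_le (P j) b1 b2 (fun w => An (Y j ^~ w)).
  have h2 := expect_dist_le Q b3 b4 (fun w => An (Z ^~ w)).
  move: h h1 h2; rewrite !ler_norml.
  by move=> /andP[? ?] /andP[? ?] /andP[? ?]; apply/andP; split; lra.
Qed.

End CylinderFunctionals.

(** * The lattice form of the Stone-Weierstrass theorem *)

Section LatticeStoneWeierstrass.
Context {R : realType} {X : topologicalType}.
Variables (K : set X) (L : set (X -> R)) (F : X -> R).
Hypothesis compactK : compact K.
Hypothesis L_nonempty : L !=set0.
Hypothesis L_max : forall A B, L A -> L B -> L (fun f => Num.max (A f) (B f)).
Hypothesis L_min : forall A B, L A -> L B -> L (fun f => Num.min (A f) (B f)).
Hypothesis L_cont : forall A, L A -> continuous A.
Hypothesis F_cont : {within K, continuous F}.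
Hypothesis interpolation : forall f g e, K f -> K g -> 0 < e ->
  exists A, [/\ L A, `|A f - F f| <= e & `|A g - F g| <= e].

Lemma near_within_cont (A : X -> R) f e : L A -> K f -> 0 < e ->
  \forall g \near f, `|A g - A f| <= e /\ (K g -> `|F g - F f| <= e).
Proof.
move=> LA Kf e0; near=> g; split; near: g.
  by have /cvgrPdist_le/(_ _ e0) := L_cont LA (x := f); under eq_near do rewrite distrC.
have := F_cont; rewrite subspace_continuousP => /(_ f Kf).
by move=> /cvgrPdist_le/(_ _ e0); rewrite near_withinE; apply: filterS => g/= h Kg; rewrite distrC; exact: h.
Unshelve. all: by end_near. Qed.

(* Compactness is applied to the filter generated by an upward directed set. *)
Lemma lattice_lower_approx f e : K f -> 0 < e ->
  exists A, [/\ L A, A f <= F f + e & forall g, K g -> F g - 3 * e <= A g].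
Proof.
move=> Kf e0.
(* Functionals that stay below F + e at the one point f. Maxima do not leave this class, so it is
   directed upwards and generates the filter [G]. *)
pose U A := L A /\ A f <= F f + e.
pose G : set_system (X -> R) := fun S =>
  exists2 A0, U A0 & forall A, U A -> (forall g, A0 g <= A g) -> S A.
have FG : Filter G.
  split.
  - have [A [LA Af _]] := interpolation Kf Kf e0; exists A => //; split=> //.
    by move: Af; rewrite ler_norml; lra.
  - move=> S1 S2 [A1 [L1 f1] h1] [A2 [L2 f2] h2].
    exists (fun g => Num.max (A1 g) (A2 g)).
      by split; [exact: L_max|rewrite ge_max f1 f2].
    move=> A UA h; split; [apply: h1|apply: h2] => // g;
      by rewrite (le_trans _ (h g))// le_max lexx ?orbT.
  - by move=> S1 S2 S12 [A0 UA0 h]; exists A0 => // A UA hA; exact/S12/h.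
(* Near-covering form of compactness: if each point of K has a neighbourhood on which the bound
   holds for all sufficiently large A, then one A serves all of K. *)
have := compactK; rewrite compact_near_coveringP.
move=> /(_ _ G (fun A g => K g -> F g - 3 * e <= A g) FG) [g Kg|].
  have [A0 [LA0 A0f A0g]] := interpolation Kf Kg e0.
  have UA0 : U A0 by split=> //; move: A0f; rewrite ler_norml; lra.
  exists ([set g' | `|A0 g' - A0 g| <= e /\ (K g' -> `|F g' - F g| <= e)],
          [set A | forall g', A0 g' <= A g']).
    split=> /=; first exact: near_within_cont.
    by exists A0.
  (* Three errors of size e add up: interpolation at g, continuity of [A0] and continuity of F. *)
  move=> [g' A]/= [[h1 h2] h3] Kg'; have := h2 Kg'; have := h3 g'.
  by move: h1 A0g; rewrite !ler_norml; lra.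
move=> A0 [LA0 A0f] h; exists A0; split=> // g Kg.
by apply: (h A0 _ _ g) => //; split.
Qed.

(** The dual step: the lower approximants that nearly touch F at single points are directed
    downwards by minima, and compactness yields one that is also an upper approximant up to 3 e. *)
Lemma lattice_approx e : 0 < e ->
  exists A, L A /\ forall g, K g -> `|A g - F g| <= 3 * e.
Proof.
move=> e0.
have [K0|[f0 Kf0]] : K = set0 \/ K !=set0.
  by have [->|/set0P] := eqVneq K set0; [left|right].
  by have [A LA] := L_nonempty; exists A; split=> // g; rewrite K0.
pose U A := L A /\ forall g, K g -> F g - 3 * e <= A g.
pose G : set_system (X -> R) := fun S =>
  exists2 A0, U A0 & forall A, U A -> (forall g, A g <= A0 g) -> S A.
have FG : Filter G.
  split.
  - have [A [LA Af h]] := lattice_lower_approx Kf0 e0; exists A => //; split=> //.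
  - move=> S1 S2 [A1 [L1 f1] h1] [A2 [L2 f2] h2].
    exists (fun g => Num.min (A1 g) (A2 g)).
      by split; [exact: L_min|move=> g Kg; rewrite le_min f1 ?f2].
    move=> A UA h; split; [apply: h1|apply: h2] => // g;
      by rewrite (le_trans (h g))// ge_min lexx ?orbT.
  - by move=> S1 S2 S12 [A0 UA0 h]; exists A0 => // A UA hA; exact/S12/h.
have := compactK; rewrite compact_near_coveringP.
move=> /(_ _ G (fun A g => K g -> A g <= F g + 3 * e) FG) [f Kf|].
  have [A0 [LA0 A0f A0g]] := lattice_lower_approx Kf e0.
  have UA0 : U A0 by split.
  exists ([set g' | `|A0 g' - A0 f| <= e /\ (K g' -> `|F g' - F f| <= e)],
          [set A | forall g', A g' <= A0 g']).
    split=> /=; first exact: near_within_cont.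
    by exists A0.
  move=> [g' A]/= [[h1 h2] h3] Kg'; have := h2 Kg'; have := h3 g'.
  by move: h1 A0f; rewrite !ler_norml; lra.
move=> A0 [LA0 A0f] h; exists A0; split=> // g Kg.
rewrite ler_norml; have := A0f g Kg.
have : A0 g <= F g + 3 * e by apply: (h A0 _ _ g) => //; split.
lra.
Qed.

End LatticeStoneWeierstrass.

(** * Compact classes of paths and chaining *)

Section ModulusClass.
Context {R : realType}.
Implicit Types (x : R) (c : nat -> R) (f : R -> R).

(* Paths are frozen before time 0, since [path_space R] ignores negative times
   whereas [{family compact, R -> R}] does not. *)
Definition modulus_class x c : set {family compact, R -> R} :=
  [set f | (forall t, t <= 0 -> f t = x) /\
    forall n s t, 0 <= s <= n%:R -> 0 <= t <= n%:R -> `|s - t| <= 2 ^- n ->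
      `|f s - f t| <= c n].

Lemma eval_family_compact_continuous (t : R) :
  continuous (fun f : {family compact, R -> R} => f t).
Proof.
move=> f.
have /(@fam_cvgP _ _ compact) h : nbhs (f : {family compact, R -> R}) `=>` nbhs f by [].
by have := h [set t] (@compact_set1 _ t); rewrite uniform_set1.
Qed.

(** Segments are compact, so [path_space] has the coarser topology. This carries the continuity of a
    functional over to the space of compact convergence, in which the Ascoli theorem provides
    compactness. *)
Lemma family_compact_path_space_nbhs (f : R -> R) (U : set (R -> R)) :
  nbhs (f : path_space R) U -> nbhs (f : {family compact, R -> R}) U.
Proof.
have h : forall A : set R, compact A -> {uniform A, (nbhs (f : {family compact, R -> R})) --> f}.
  by apply/(@fam_cvgP R R compact (nbhs (f : {family compact, R -> R})) f).
apply: (@fam_cvgP R R [set `[0, b]%classic | b in [set: R]]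
   (nbhs (f : {family compact, R -> R})) f _).2 => A [b _ <-].
by apply: h; exact: segment_compact.
Qed.

(** The point is reached from time 0 in k steps of length 2^-n, each of which costs at most
    [c n]. *)
Lemma modulus_class_bound x c f n k : modulus_class x c f -> 0 <= c n ->
  k%:R * 2 ^- n <= n%:R :> R -> `|f (k%:R * 2 ^- n)| <= `|x| + k%:R * c n.
Proof.
move=> [f0 fc] c0; have h0 : 0 < 2 ^- n :> R by rewrite invr_gt0 exprn_gt0.
elim: k => [|k ih] kn; first by rewrite !mul0r addr0 f0.
have kn1 : k%:R * 2 ^- n <= n%:R :> R.
  by rewrite (le_trans _ kn)// ler_pM2r// ler_nat.
have e1 : k.+1%:R * 2 ^- n - k%:R * 2 ^- n = 2 ^- n :> R.
  by rewrite -mulrBl -natrB// subSnn mul1r.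
have k0 i : 0 <= i%:R * 2 ^- n :> R by rewrite mulr_ge0 ?(ltW h0).
have := fc n (k.+1%:R * 2 ^- n) (k%:R * 2 ^- n).
rewrite e1 kn kn1 !k0 (ger0_norm (ltW h0)) => /(_ isT isT (lexx _)) h.
have h2 := ih kn1.
have h3 : `|f (k.+1%:R * 2 ^- n)| <=
    `|f (k.+1%:R * 2 ^- n) - f (k%:R * 2 ^- n)| + `|f (k%:R * 2 ^- n)|.
  by rewrite (le_trans _ (ler_normD _ _))// subrK.
have e2 : k.+1%:R * c n = k%:R * c n + c n by rewrite -natr1 mulrDl mul1r.
by rewrite e2; lra.
Qed.

Lemma modulus_class_pointwise_bounded x c t :
  (forall n, 0 <= c n) -> exists M, forall f, modulus_class x c f -> `|f t| <= M.
Proof.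
move=> c0; have [t0|t0] := leP t 0.
  by exists `|x| => f [f0 _]; rewrite f0.
(* The modulus at level n only concerns times up to n, so the level has to exceed t. *)
pose n := (Num.truncn t).+1; pose k := Num.truncn (t * 2 ^+ n).
have tn : t <= n%:R by rewrite ltW// truncnS_gt.
have p0 : 0 < 2 ^+ n :> R by rewrite exprn_gt0.
have /andP[k1 k2] : k%:R <= t * 2 ^+ n < k.+1%:R.
  by apply: truncn_itv; rewrite mulr_ge0 ?ltW.
have kt : k%:R * 2 ^- n <= t by rewrite ler_pdivrMr.
exists (`|x| + k%:R * c n + c n) => f fW.
have := modulus_class_bound fW (c0 n) (le_trans kt tn).
have a1 : 0 <= (k%:R * 2 ^- n : R) <= n%:R.
  by rewrite (le_trans kt tn) mulr_ge0// invr_ge0 ltW.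
have a2 : `|t - k%:R * 2 ^- n| <= 2 ^- n.
  rewrite ger0_norm ?subr_ge0// lerBlDr -[X in X + _]mul1r -mulrDl.
  by rewrite ler_pdivlMr// addrC natr1 ltW.
have a0 : 0 <= t <= n%:R by rewrite tn ltW.
have := fW.2 n t _ a0 a1 a2 => h1 h2.
have h3 : `|f t| <= `|f t - f (k%:R * 2 ^- n)| + `|f (k%:R * 2 ^- n)|.
  by rewrite (le_trans _ (ler_normD _ _))// subrK.
by lra.
Qed.

Lemma modulus_class_truncate x c f t : modulus_class x c f -> f t = f (Num.max t 0).
Proof. by move=> [f0 _]; case: leP => // t0; rewrite !f0// ltW. Qed.

Lemma modulus_class_equicontinuous x c : c @ \oo --> 0 ->
  equicontinuous (modulus_class x c) (id : {family compact, R -> R} -> R -> R).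
Proof.
move=> c0 t E; rewrite -entourage_ballE => -[e /= e0 eE].
have [N _ hN] : \forall n \near \oo, `|c n| < e.
  by have /cvgrPdist_lt/(_ _ e0) := c0; under eq_near do rewrite sub0r normrN.
(* Level n must have [c n] below e, and its time window [0, n] must contain the nonnegative part of
   the unit neighbourhood of t. *)
pose n := maxn N (Num.truncn (`|t| + 1)).+1.
have tn : `|t| + 1 <= n%:R.
  by rewrite (le_trans (ltW (truncnS_gt _)))// ler_nat leq_maxr.
have p0 : 0 < 2 ^- n :> R by rewrite invr_gt0 exprn_gt0.
have p1 : 2 ^- n <= 1 :> R by rewrite invf_le1 ?exprn_gt0// exprn_ege1// ler1n.
near=> y => f Wf; apply: eE; rewrite /ball/=.
have yt : `|t - y| <= 2 ^- n by near: y; apply: cvgr_dist_le p0.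
rewrite (modulus_class_truncate t Wf) (modulus_class_truncate y Wf).
apply: le_lt_trans (hN n _); last by rewrite /= leq_maxl.
rewrite (le_trans _ (ler_norm _))//; apply: Wf.2.
- rewrite le_max lexx orbT ge_max ler0n andbT/=.
  by have := ler_norm t; lra.
- rewrite le_max lexx orbT ge_max ler0n andbT/=.
  by move: yt; rewrite ler_norml; have := ler_norm t; lra.
- apply: le_trans yt; rewrite ler_norml.
  have := ler_norm (t - y); have := ler_norm (- (t - y)); rewrite normrN => n1 n2.
  by case: (leP t 0) => ?; case: (leP y 0) => ?; apply/andP; split; lra.
Unshelve. all: by end_near. Qed.

Lemma closure_eval (W : set {family compact, R -> R}) f s t e : closure W f -> 0 < e ->
  exists g, [/\ W g, `|g s - f s| < e & `|g t - f t| < e].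
Proof.
move=> Wf e0.
have [|g [Wg [g1 g2]]] := Wf [set g | `|g s - f s| < e /\ `|g t - f t| < e].
  near=> g; split; near: g.
    have /cvgrPdist_lt/(_ _ e0) := @eval_family_compact_continuous s f.
    by under eq_near do rewrite distrC.
  have /cvgrPdist_lt/(_ _ e0) := @eval_family_compact_continuous t f.
  by under eq_near do rewrite distrC.
by exists g.
Unshelve. all: by end_near. Qed.

(** Each defining condition is a non-strict inequality or an equation that involves at most two
    times, hence survives pointwise approximation. *)
Lemma modulus_class_closed x c : closed (modulus_class x c).
Proof.
move=> f Wf; split=> [t t0|n s t sn tn st].
  apply/eqP; rewrite -subr_eq0 -normr_le0; apply/ler_addgt0Pl => e e0.
  have [g [[g0 _] gt _]] := closure_eval t t Wf e0.
  by rewrite addr0 distrC -(g0 t)// ltW.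
apply/ler_addgt0Pl => e e0; have e2 : 0 < e / 2 by lra.
have [g [[_ gc] gs gt]] := closure_eval s t Wf e2.
move: (gc n s t sn tn st) gs gt; rewrite !(ler_norml, ltr_norml).
by move=> /andP[? ?] /andP[? ?] /andP[? ?]; apply/andP; split; lra.
Qed.

Lemma modulus_class_compact x c : (forall n, 0 <= c n) -> c @ \oo --> 0 ->
  compact (modulus_class x c).
Proof.
move=> cge0 c0.
rewrite (closure_id (modulus_class x c)).1; last exact: modulus_class_closed.
rewrite -precompactE.
have := @Ascoli R R (@Rhausdorff R) (modulus_class x c) (@locally_compactR R).
move=> [h _]; apply: (h _).2; split; last exact: modulus_class_equicontinuous.
move=> t; have [M fM] := @modulus_class_pointwise_bounded x c t cge0.
rewrite precompactE; apply: (subclosed_compact _ (@segment_compact _ (- M) M)).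
  exact: closed_closure.
rewrite [X in _ `<=` X](closure_id _).1; last exact: itv_closed.
apply: closure_subset => _ [f Wf <-] /=.
by rewrite in_itv/= -ler_norml fM.
Qed.

End ModulusClass.

Section Chaining.
Context {R : realType}.
Variables (f : R -> R) (L : R).
Hypothesis L0 : 0 <= L.
Hypothesis cf : {within `[0, +oo[, continuous f}.
Hypothesis df : forall n i, (i < n * 2 ^ n)%N ->
  `|f (i.+1%:R * 2 ^- n) - f (i%:R * 2 ^- n)| <= L * (9 / 10) ^+ n.

Definition dyadic_floor (n : nat) (s : R) : nat := Num.truncn (s * 2 ^+ n).

Lemma dyadic_floor_itv n s : 0 <= s ->
  (dyadic_floor n s)%:R * 2 ^- n <= s < (dyadic_floor n s).+1%:R * 2 ^- n.
Proof.
move=> s0; have p0 : 0 < 2 ^+ n :> R by rewrite exprn_gt0.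
have /andP[k1 k2] : (dyadic_floor n s)%:R <= s * 2 ^+ n < (dyadic_floor n s).+1%:R.
  by apply: truncn_itv; rewrite mulr_ge0 // ltW.
by rewrite ler_pdivrMr// k1 ltr_pdivlMr.
Qed.

Lemma dyadic_floorS n s : 0 <= s ->
  dyadic_floor n.+1 s = (dyadic_floor n s).*2 \/
  dyadic_floor n.+1 s = (dyadic_floor n s).*2.+1.
Proof.
move=> s0.
have p0 : 0 < 2 ^+ n :> R by rewrite exprn_gt0.
have /andP[k1 k2] : (dyadic_floor n s)%:R <= s * 2 ^+ n < (dyadic_floor n s).+1%:R.
  by apply: truncn_itv; rewrite mulr_ge0 // ltW.
set k := dyadic_floor n s in k1 k2 *.
have y0 : 0 <= s * 2 ^+ n.+1 by rewrite mulr_ge0// exprn_ge0.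
have e1 : s * 2 ^+ n.+1 = (s * 2 ^+ n) *+ 2 by rewrite exprS mulrCA mulr_natl.
have : (k.*2 <= dyadic_floor n.+1 s)%N.
  by rewrite /dyadic_floor truncn_ge_nat// e1 -muln2 natrM mulr_natr lerMn2r.
have : (dyadic_floor n.+1 s < k.+1.*2)%N.
  by rewrite /dyadic_floor truncn_lt_nat// e1 -muln2 natrM mulr_natr ltrMn2r.
rewrite doubleS; lia.
Qed.

(** The bound is the closed form of the geometric sum of the (9/10)^l for n < l <= n + m. Each
    refinement of the dyadic floor either stays in place or moves by one dyadic step. *)
Lemma chaining_dyadic n m s : 0 <= s <= n%:R ->
  `|f ((dyadic_floor (n + m) s)%:R * 2 ^- (n + m)) -
    f ((dyadic_floor n s)%:R * 2 ^- n)| <=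
  L * (9 * (9 / 10) ^+ n - 9 * (9 / 10) ^+ (n + m)).
Proof.
move=> /andP[s0 sn]; elim: m => [|m ih]; first by rewrite addn0 !subrr normr0 mulr0.
set l := (n + m)%N in ih *; rewrite addnS -/l.
have hl : `|f ((dyadic_floor l.+1 s)%:R * 2 ^- l.+1) -
    f ((dyadic_floor l s)%:R * 2 ^- l)| <= L * (9 / 10) ^+ l.+1.
  have e2 : (dyadic_floor l s)%:R * 2 ^- l = (dyadic_floor l s).*2%:R * 2 ^- l.+1 :> R.
    rewrite -muln2 natrM exprS.
    have : 2 ^+ l != 0 :> R by rewrite expf_neq0// pnatr_eq0.
    by move: (2 ^+ l) => p p0; field.
  rewrite e2; have [->|->] := dyadic_floorS l s0.
    by rewrite subrr normr0 mulr_ge0// exprn_ge0//; lra.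
  apply: df.
  have : (dyadic_floor l s <= n * 2 ^ l)%N.
    rewrite -(@ler_nat R) natrM natrX; apply: (@le_trans _ _ (s * 2 ^+ l)).
      by rewrite truncn_le mulr_ge0// exprn_ge0.
    by rewrite ler_wpM2r// exprn_ge0.
  have : (n * 2 ^ l <= l * 2 ^ l)%N by rewrite leq_mul2r leq_addr orbT.
  have := expn_gt0 2 l; rewrite expnS/= mulSn mulnCA -muln2; nia.
rewrite -(subrK (f ((dyadic_floor l s)%:R * 2 ^- l)) (f (_ * 2 ^- l.+1))) -addrA.
rewrite (le_trans (ler_normD _ _))// (le_trans (lerD hl ih))// exprS.
by have : 0 <= L * (9 / 10) ^+ l; [rewrite mulr_ge0// exprn_ge0//; lra|lra].
Qed.

Lemma dyadic_floor_cvg s : 0 <= s ->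
  f ((dyadic_floor n s)%:R * 2 ^- n) @[n --> \oo] --> f s.
Proof.
move=> s0; have := cf; rewrite subspace_continuousP => /(_ s).
rewrite /= in_itv/= s0 => /(_ isT).
apply: (@cvg_comp _ _ _ (fun n => (dyadic_floor n s)%:R * 2 ^- n) f).
move=> U [e /= e0 h].
have /cvgrPdist_lt/(_ _ e0) : 2 ^- n @[n --> \oo] --> (0 : R).
  have -> : (fun n => 2 ^- n) = geometric 1 (2^-1 : R).
    by apply/funext => n; rewrite /geometric/= mul1r exprVn.
  by apply: cvg_geometric; rewrite ger0_norm; lra.
apply: filterS => n; rewrite sub0r normrN ger0_norm ?invr_ge0 ?exprn_ge0// => hn.
apply: h; last by rewrite /= in_itv/= mulr_ge0// invr_ge0 exprn_ge0.
have /andP[h1] := dyadic_floor_itv n s0; rewrite -natr1 mulrDl mul1r => h2.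
by rewrite /ball/= ger0_norm ?subr_ge0//; lra.
Qed.

(** The constant is 19 = 9 + 1 + 9: a geometric tail from s to its dyadic floor, at most one dyadic
    step between the floors of s and t, and a tail from the floor of t back to t. *)
Lemma chaining_modulus :
  modulus_class (f 0) (fun n => 19 * L * (9 / 10) ^+ n) (fun t => f (Num.max t 0)).
Proof.
have near_floor n s : 0 <= s <= n%:R ->
    `|f s - f ((dyadic_floor n s)%:R * 2 ^- n)| <= L * (9 * (9 / 10) ^+ n).
  move=> /andP[s0 sn].
  pose u m := `|f ((dyadic_floor (n + m) s)%:R * 2 ^- (n + m)) -
    f ((dyadic_floor n s)%:R * 2 ^- n)|.
  have cu : u m @[m --> \oo] --> `|f s - f ((dyadic_floor n s)%:R * 2 ^- n)|.
    apply: cvg_norm; apply: cvgB; last exact: cvg_cst.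
    have := dyadic_floor_cvg s0; rewrite -(cvg_shiftn n).
    by under eq_fun do rewrite addnC.
  rewrite -(cvg_lim _ cu)//; apply: limr_le; first by apply: cvgP cu.
  apply: nearW => m; rewrite (le_trans (chaining_dyadic m _)) ?s0//.
  by rewrite ler_wpM2l// gerBl mulr_ge0// exprn_ge0//; lra.
have adj n s t : 0 <= s <= n%:R -> 0 <= t <= n%:R -> s <= t -> t - s <= 2 ^- n ->
    `|f s - f t| <= 19 * L * (9 / 10) ^+ n.
  move=> sn tn st ts.
  have h1 := near_floor n s sn; have h2 := near_floor n t tn.
  have [s0 _] := andP sn; have [t0 tn'] := andP tn.
  have p0 : 0 < 2 ^+ n :> R by rewrite exprn_gt0.
  have k1 : (dyadic_floor n s <= dyadic_floor n t)%N.
    by rewrite /dyadic_floor le_truncn// ler_wpM2r// ltW.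
  have k2 : (dyadic_floor n t <= (dyadic_floor n s).+1)%N.
    rewrite -ltnS /dyadic_floor truncn_lt_nat; last by rewrite mulr_ge0// ltW.
    have /andP[_] := dyadic_floor_itv n s0; rewrite ltr_pdivlMr// => hs.
    rewrite -(natr1 (dyadic_floor n s).+1); apply: (@le_lt_trans _ _ (s * 2 ^+ n + 1)); last by rewrite ltrD2r.
    by rewrite -lerBlDl -mulrBl -ler_pdivlMr// mul1r.
  have h3 : `|f ((dyadic_floor n t)%:R * 2 ^- n) -
      f ((dyadic_floor n s)%:R * 2 ^- n)| <= L * (9 / 10) ^+ n.
    have [->|ks] := eqVneq (dyadic_floor n t) (dyadic_floor n s).
      by rewrite subrr normr0 mulr_ge0// exprn_ge0//; lra.
    have kt : dyadic_floor n t = (dyadic_floor n s).+1.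
      by apply/eqP; rewrite eqn_leq k2 ltn_neqAle eq_sym ks k1.
    rewrite kt; apply: df; rewrite -kt -(@ler_nat R) natrM natrX.
    apply: (@le_trans _ _ (t * 2 ^+ n)); last by rewrite ler_wpM2r// ltW.
    by rewrite truncn_le mulr_ge0// ltW.
  have e3 : f s - f t = (f s - f ((dyadic_floor n s)%:R * 2 ^- n)) -
    (f ((dyadic_floor n t)%:R * 2 ^- n) - f ((dyadic_floor n s)%:R * 2 ^- n)) -
    (f t - f ((dyadic_floor n t)%:R * 2 ^- n)) by ring.
  rewrite e3 (le_trans (ler_normB _ _))//.
  have := ler_normB (f s - f ((dyadic_floor n s)%:R * 2 ^- n))
    (f ((dyadic_floor n t)%:R * 2 ^- n) - f ((dyadic_floor n s)%:R * 2 ^- n)).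
  by move: h1 h2 h3; rewrite !mulrA (mulrC L 9); lra.
split=> [t t0|n s t sn tn st]; first by rewrite max_r.
rewrite !max_l; [|by case/andP: tn|by case/andP: sn].
have [le_st|/ltW le_ts] := leP s t.
  by apply: adj => //; rewrite (le_trans _ st)// distrC ler_norm.
by rewrite distrC; apply: adj => //; rewrite (le_trans _ st)// ler_norm.
Qed.

End Chaining.

Section ChainingProbability.
Context {R : realType} {d : measure_display} {T : measurableType d}.
Variable P : probability T R.

Lemma markov4 (Z : T -> R) (a : R) : measurable_fun setT Z -> 0 < a ->
  (P [set w | (a < `|Z w|)%R] <= (a ^- 4)%:E * \int[P]_w (Z w ^+ 4)%:E)%E.
Proof.
move=> mZ a0.
have mA : measurable [set w | a < `|Z w|].
  rewrite (_ : [set w | _] = (fun w => `|Z w|) @^-1` `]a, +oo[%classic); last first.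
    by apply/seteqP; split => w /=; rewrite in_itv/= andbT.
  rewrite -[X in measurable X]setTI; apply: measurableT_comp mZ _ _ _ => //.
rewrite -ge0_integralZl//=; last 3 first.
- by apply/measurable_EFinP; apply: measurable_funX.
- by move=> w _; rewrite lee_fin exprn_even_ge0.
- by rewrite lee_fin invr_ge0 exprn_ge0// ltW.
have <- : (\int[P]_w (\1_[set w | a < `|Z w|] w)%:E = P [set w | (a < `|Z w|)%R])%E.
  by rewrite integral_indic// setIT.
apply: ge0_le_integral => //.
- by apply/measurable_EFinP; exact: (bounded_measurable_indic mA).1.
- apply: emeasurable_funM => //.
  by apply/measurable_EFinP; apply: measurable_funX.
- move=> w _; rewrite -EFinM lee_fin indicE.
  have [|_] := boolP (w \in _).
    rewrite inE/= => aw; rewrite mulrC ler_pdivlMr ?exprn_gt0// mul1r.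
    rewrite -(@ger0_norm _ (Z w ^+ 4)) ?exprn_even_ge0// normrX.
    by apply: lerXn2r; rewrite ?nnegrE//; exact: ltW.
  by rewrite mulr_ge0 ?invr_ge0 ?exprn_even_ge0// exprn_ge0// ltW.
Qed.

(* The ratio 9/10 is chosen so that (9/10)^4 > 1/2: by [markov4] the n-th event has
   probability at most n 2^n (10/9)^(4n) 4^-n C / L^4, which is summable. *)
Definition rough_event (Y : R -> T -> R) (L : R) (n : nat) : set T :=
  \bigcup_(i in `I_(n * 2 ^ n)) [set w | L * (9 / 10) ^+ n <
    `|Y (i.+1%:R * 2 ^- n) w - Y (i%:R * 2 ^- n) w|].

(** The probability of level n is at most 4 (49/50)^n C / L^4, and the geometric series of ratio
    49/50 sums to 50; this is the origin of 200. *)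
Lemma rough_event_prob (Y : R -> T -> R) (L C : R) : 0 < L -> 0 <= C ->
  (forall t, 0 <= t -> measurable_fun setT (Y t)) ->
  (forall s t, 0 <= s -> s <= t ->
    (\int[P]_w ((Y t w - Y s w) ^+ 4)%:E <= (C * (t - s) ^+ 2)%:E)%E) ->
  measurable (\bigcup_n rough_event Y L n) /\
  (P (\bigcup_n rough_event Y L n) <= (200 * C / L ^+ 4)%:E)%E.
Proof.
move=> L0 C0 mY hY.
pose A n i := [set w | L * (9 / 10) ^+ n <
    `|Y (i.+1%:R * 2 ^- n) w - Y (i%:R * 2 ^- n) w|].
have k0 (i n : nat) : 0 <= i%:R * 2 ^- n :> R by rewrite mulr_ge0// invr_ge0 exprn_ge0.
have mZ n i : measurable_fun setT (fun w => Y (i.+1%:R * 2 ^- n) w - Y (i%:R * 2 ^- n) w).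
  by apply: measurable_funB; apply: mY.
have mA n i : measurable (A n i).
  rewrite (_ : A n i = (fun w => `|Y (i.+1%:R * 2 ^- n) w - Y (i%:R * 2 ^- n) w|) @^-1`
      `]L * (9 / 10) ^+ n, +oo[%classic); last first.
    by apply/seteqP; split => w /=; rewrite in_itv/= andbT.
  by rewrite -[X in measurable X]setTI; apply: measurableT_comp (mZ n i) _ _ _.
have mB n : measurable (rough_event Y L n).
  by apply: fin_bigcup_measurable => [|i _]; [exact: finite_II|exact: mA].
split; first exact: bigcup_measurable.
have t0 n : 0 < (9 / 10) ^+ n :> R by rewrite exprn_gt0//; lra.
(* A single increment: the fourth-moment bound gives the ratio (10/9)^4 / 4, which is below
   25/64. *)
have PA n i : (P (A n i) <= (C / L ^+ 4 * (25 / 64) ^+ n)%:E)%E.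
  rewrite (le_trans (markov4 (mZ n i) _))//; first by rewrite mulr_gt0.
  have le1 : i%:R * 2 ^- n <= i.+1%:R * 2 ^- n :> R.
    by rewrite ler_wpM2r ?ler_nat// invr_ge0 exprn_ge0.
  apply: (@le_trans _ _ (((L * (9 / 10) ^+ n) ^- 4)%:E *
      (C * (i.+1%:R * 2 ^- n - i%:R * 2 ^- n) ^+ 2)%:E)%E).
    by apply: lee_wpmul2l; [rewrite lee_fin invr_ge0 exprn_ge0// mulr_ge0// ltW|exact: hY].
  rewrite -EFinM lee_fin -mulrBl -natrB// subSnn mul1r.
  have -> : (2 ^- n) ^+ 2 = 4^-1 ^+ n :> R.
    by rewrite -exprVn -!exprM mulnC exprM expr2 -invfM -natrM.
  have le2 : ((9 / 10) ^+ n) ^- 4 * 4^-1 ^+ n <= (25 / 64) ^+ n :> R.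
    rewrite -exprM mulnC exprM -exprVn -exprMn lerXn2r ?nnegrE//.
    rewrite mulrC ler_pdivrMr; last by rewrite exprn_gt0//; lra.
    by rewrite !exprS expr0; lra.
  have -> : (L * (9 / 10) ^+ n) ^- 4 * (C * 4^-1 ^+ n) =
      C / L ^+ 4 * (((9 / 10) ^+ n) ^- 4 * 4^-1 ^+ n) by rewrite exprMn invfM; ring.
  by rewrite ler_wpM2l// divr_ge0// exprn_ge0// ltW.
have PB n : (P (rough_event Y L n) <= (4 * C / L ^+ 4 * (49 / 50) ^+ n)%:E)%E.
  rewrite /rough_event bigcup_mkord.
  apply: le_trans (@Boole_inequality _ R T P (A n) (n * 2 ^ n)%N (fun i _ => mA n i)) _.
  apply: (@le_trans _ _ (\sum_(i < n * 2 ^ n) (C / L ^+ 4 * (25 / 64) ^+ n)%:E)%E).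
    by apply: lee_sum => i _; exact: PA.
  rewrite sumEFin lee_fin sumr_const card_ord -[leLHS]mulr_natl natrM natrX.
  have K0 : 0 <= C / L ^+ 4 by rewrite divr_ge0// exprn_ge0// ltW.
  (* Level n has n 2^n increments. The power 2^n raises the ratio to 25/32, and the factor n is paid
     for by (5/4)^n, since (5/4) (25/32) = 125/128 < 49/50. *)
  have bern : n%:R <= 4 * (5 / 4) ^+ n :> R.
    elim: (n) => [|m ih]; first by rewrite mulr_ge0.
    rewrite -natr1 exprS; have : 1 <= (5 / 4) ^+ m :> R by rewrite exprn_ege1//; lra.
    by lra.
  have -> : n%:R * 2 ^+ n * (C / L ^+ 4 * (25 / 64) ^+ n) =
      C / L ^+ 4 * (n%:R * (25 / 32) ^+ n).
    have -> : 25 / 32 = 2 * (25 / 64) :> R by field.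
    by rewrite (exprMn_comm n (mulrC 2 (25 / 64))); ring.
  have -> : 4 * C / L ^+ 4 * (49 / 50) ^+ n = C / L ^+ 4 * (4 * (49 / 50) ^+ n) by ring.
  rewrite ler_wpM2l//.
  apply: (@le_trans _ _ (4 * (5 / 4) ^+ n * (25 / 32) ^+ n)).
    by rewrite ler_wpM2r// exprn_ge0//; lra.
  rewrite -mulrA -exprMn ler_wpM2l// lerXn2r ?nnegrE//; lra.
have K0 : 0 <= 4 * C / L ^+ 4.
  by apply: divr_ge0; [exact: mulr_ge0|rewrite exprn_ge0// ltW].
apply: le_trans (measure_sigma_subadditive P mB _ (@subset_refl _ _)) _.
  exact: bigcup_measurable.
apply: lime_le; first exact: is_cvg_nneseries.
apply: nearW => n; apply: (@le_trans _ _
    (\sum_(0 <= i < n) (4 * C / L ^+ 4 * (49 / 50) ^+ i)%:E)%E).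
  by apply: lee_sum => i _; exact: PB.
rewrite sumEFin lee_fin -mulr_sumr.
have -> : 200 * C / L ^+ 4 = 4 * C / L ^+ 4 * 50 by ring.
rewrite ler_wpM2l//.
suff : \sum_(0 <= i < n) (49 / 50) ^+ i <= 50 - 50 * (49 / 50) ^+ n :> R.
  by have : 0 <= (49 / 50) ^+ n :> R; [rewrite exprn_ge0//; lra|lra].
elim: (n) => [|m ih]; first by rewrite big_nil; lra.
by rewrite big_nat_recr//= exprS; lra.
Qed.

End ChainingProbability.

(** * Weak convergence from trigonometric functionals *)

Section NonmeasurableSandwich.
Context {R : realType} {d : measure_display} {T : measurableType d}.
Variable P : probability T R.
Local Notation E f := (\int[P]_x f x).

(* A continuous functional of a process is not known to be measurable.  The integral
   is a supremum over simple functions below the integrand, hence monotone anyway. *)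
Lemma ge0_le_integral_nonmeasurable (f g : T -> \bar R) :
  (forall x, 0 <= f x)%E -> (forall x, f x <= g x)%E ->
  (\int[P]_x f x <= \int[P]_x g x)%E.
Proof.
move=> f0 fg; rewrite ge0_integralTE// ge0_integralTE; last first.
  by move=> x; exact: le_trans (f0 x) (fg x).
apply: le_ereal_sup => _ [h /= hf <-]; exists h => //= x.
exact: le_trans (hf x) (fg x).
Qed.

(** The function h lies between g - (e + M 1) and g + (e + M 1), where 1 is the indicator of the
    complement of A. The lower bound is truncated at 0, so that monotonicity of the integral without
    measurability, valid for nonnegative functions, applies to it. *)
Lemma ge0_expect_sandwich (g h : T -> R) (A : set T) (M e : R) :
  bounded_measurable g -> measurable A -> 0 <= M -> 0 <= e ->
  (forall w, 0 <= g w <= M) -> (forall w, 0 <= h w <= M) ->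
  (P (~` A) <= e%:E)%E -> (forall w, A w -> `|h w - g w| <= e) ->
  exists2 I, (\int[P]_w (h w)%:E)%E = I%:E & `|I - E g| <= e + M * e.
Proof.
move=> bg mA M0 e0 gM hM PA hg.
have mCA : measurable (~` A) by exact: measurableC.
have bi : bounded_measurable (\1_(~` A) : T -> R) by exact: bounded_measurable_indic.
have bup : bounded_measurable (fun w => g w + (e + M * \1_(~` A) w)).
  apply: bounded_measurableD => //; apply: bounded_measurableD.
    exact: bounded_measurable_cst.
  exact: bounded_measurableZ.
have blo' : bounded_measurable (fun w => g w - (e + M * \1_(~` A) w)).
  apply: bounded_measurableB => //; apply: bounded_measurableD.
    exact: bounded_measurable_cst.
  exact: bounded_measurableZ.
have blo : bounded_measurable (fun w => Num.max 0 (g w - (e + M * \1_(~` A) w))).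
  have [m1 [K hK]] := blo'; split.
    by apply: measurable_maxr.
  by exists K => w; have := hK w; rewrite !ler_norml; case: (leP 0 (g w - _)) => ?; lra.
have Ei : E (\1_(~` A) : T -> R) <= e.
  by rewrite expect_indic// -lee_fin fineK//; exact: fin_num_measure.
have EfE (f : T -> R) : bounded_measurable f -> (\int[P]_w (f w)%:E = (E f)%:E)%E.
  by move=> bf; rewrite -(EFin_expect P bf) unlock.
have indA w : A w -> (\1_(~` A) w : R) = 0.
  by move=> Aw; rewrite indicE memNset// => /(_ Aw).
have indNA w : ~ A w -> (\1_(~` A) w : R) = 1 by move=> Aw; rewrite indicE mem_set.
have up : (\int[P]_w (h w)%:E <= (E g + (e + M * e))%:E)%E.
  apply: (@le_trans _ _ (\int[P]_w (g w + (e + M * \1_(~` A) w))%:E)%E).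
    apply: ge0_le_integral_nonmeasurable => w; rewrite lee_fin.
      by case/andP: (hM w).
    have [Aw|Aw] := pselect (A w).
      by rewrite indA// mulr0 addr0; have := hg w Aw; rewrite ler_norml; lra.
    by rewrite indNA//; have := hM w; have := gM w; lra.
  rewrite EfE// lee_fin expectD//; last first.
    by apply: bounded_measurableD; [exact: bounded_measurable_cst|exact: bounded_measurableZ].
  rewrite lerD2l expectD ?expect_cst ?expectZ ?lerD2l ?ler_wpM2l//.
    exact: bounded_measurable_cst.
  exact: bounded_measurableZ.
have lo : ((E g - (e + M * e))%:E <= \int[P]_w (h w)%:E)%E.
  apply: (@le_trans _ _ (\int[P]_w (Num.max 0 (g w - (e + M * \1_(~` A) w)))%:E)%E).
    rewrite EfE// lee_fin.
    apply: (@le_trans _ _ (E (fun w => g w - (e + M * \1_(~` A) w)))); last first.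
      by apply: expect_le => // w; rewrite le_max lexx orbT.
    rewrite expectB//; last first.
      by apply: bounded_measurableD; [exact: bounded_measurable_cst|exact: bounded_measurableZ].
    rewrite lerD2l lerN2 expectD ?expect_cst ?expectZ ?lerD2l ?ler_wpM2l//.
      exact: bounded_measurable_cst.
    exact: bounded_measurableZ.
  apply: ge0_le_integral_nonmeasurable => w; rewrite lee_fin ?le_max ?lexx//.
  rewrite ge_max; have [Aw|Aw] := pselect (A w).
    by rewrite indA// mulr0 addr0; have := hg w Aw; have := hM w; rewrite ler_norml; lra.
  by rewrite indNA//; have := hM w; have := gM w; lra.
have ifin : (\int[P]_w (h w)%:E)%E \is a fin_num.
  by rewrite fin_numE; apply/andP; split; apply/eqP => hh; move: up lo; rewrite hh.
exists (fine (\int[P]_w (h w)%:E)%E); first by rewrite fineK.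
move: up lo; rewrite -(fineK ifin) !lee_fin ler_norml; lra.
Qed.

(** The integral is by definition the difference of those of the positive and negative parts. The
    nonnegative case is applied to each, hence the factor 2. *)
Lemma expect_sandwich (g h : T -> R) (A : set T) (M e : R) :
  bounded_measurable g -> measurable A -> 0 <= M -> 0 <= e ->
  (forall w, `|g w| <= M) -> (forall w, `|h w| <= M) ->
  (P (~` A) <= e%:E)%E -> (forall w, A w -> `|h w - g w| <= e) ->
  exists2 I, ('E_P[h])%E = I%:E & `|I - E g| <= 2 * (e + M * e).
Proof.
move=> bg mA M0 e0 gM hM PA hg.
pose pos (f : T -> R) w := Num.max (f w) 0.
pose neg (f : T -> R) w := Num.max (- f w) 0.
have bpos : bounded_measurable (pos g).
  split; first by apply: measurable_maxr => //; case: bg.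
  by exists M => w; have := gM w; rewrite /pos !ler_norml; case: (leP (g w) 0) => ?; lra.
have bneg : bounded_measurable (neg g).
  split; first by apply: measurable_maxr => //; apply: measurable_funN; case: bg.
  by exists M => w; have := gM w; rewrite /neg !ler_norml; case: (leP (- g w) 0) => ?; lra.
have posM (f : T -> R) : (forall w, `|f w| <= M) -> forall w, 0 <= pos f w <= M.
  by move=> fM w; have := fM w; rewrite ler_norml /pos; case: (leP (f w) 0) => ?; lra.
have negM (f : T -> R) : (forall w, `|f w| <= M) -> forall w, 0 <= neg f w <= M.
  by move=> fM w; have := fM w; rewrite ler_norml /neg; case: (leP (- f w) 0) => ?; lra.
have [|I1 hI1 dI1] := @ge0_expect_sandwich (pos g) (pos h) A M e bpos mA M0 e0
    (posM _ gM) (posM _ hM) PA.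
- move=> w Aw; have := hg w Aw; rewrite /pos !ler_norml.
  by case: (leP (g w) 0) => ?; case: (leP (h w) 0) => ?; lra.
have [|I2 hI2 dI2] := @ge0_expect_sandwich (neg g) (neg h) A M e bneg mA M0 e0
    (negM _ gM) (negM _ hM) PA.
- move=> w Aw; have := hg w Aw; rewrite /neg !ler_norml.
  by case: (leP (- g w) 0) => ?; case: (leP (- h w) 0) => ?; lra.
exists (I1 - I2).
  rewrite unlock integralE EFinB -hI1 -hI2; congr (_ - _)%E;
  by apply: eq_integral => w _; rewrite ?funeposE ?funenegE /pos/neg ?EFin_max.
have -> : E g = E (pos g) - E (neg g).
  rewrite -expectB//; apply: eq_Rintegral => w _; rewrite /pos /neg.
  by case: (leP (g w) 0) => ?; case: (leP (- g w) 0) => ?; lra.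
by move: dI1 dI2; rewrite !ler_norml; lra.
Qed.

End NonmeasurableSandwich.

Section WeakConvergenceCriterion.
Context {R : realType}.

Lemma cylinder_ext (A : (R -> R) -> R) (f g : R -> R) : cylinder A ->
  (forall t, 0 <= t -> f t = g t) -> A f = A g.
Proof.
move=> + fg; elim=> [s phi s0|{}A B _ -> _ ->|c {}A _ ->|A_ {}A _ ih AA]//.
  congr (cos (_ + _)); apply: eq_big_seq => p ps.
  by rewrite fg// s0.
apply/eqP; rewrite -subr_eq0 -normr_le0; apply/ler_addgt0Pl => e e0.
have [n An] := AA (e / 2) (divr_gt0 e0 (ltr0n _ 2)).
have := An f; have := An g; rewrite ih addr0 !ler_norml; lra.
Qed.

(** The topology of [path_space] is not separated: paths that agree on nonnegative times have the
    same neighbourhoods, so continuity forces equal values. *)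
Lemma continuous_functional_ext (F : path_space R -> R) (f g : R -> R) :
  {within continuous_paths, continuous F} ->
  continuous_paths (f : path_space R) -> continuous_paths (g : path_space R) ->
  (forall t, 0 <= t -> f t = g t) -> F f = F g.
Proof.
move=> cF cf cg fg.
have fin U : nbhs (f : path_space R) U -> U g.
  have : {family [set `[0, b]%classic | b in [set: R]], (globally [set g]) --> f}.
    apply/fam_cvgP => A [b _ <-] V /uniform_nbhs[B [entB BV]].
    move=> _ ->; apply: BV => t /=; rewrite in_itv/= => /andP[t0 _].
    by rewrite fg//; exact: entourage_refl.
  by move=> /(_ U) h fU; exact: h.
apply/eqP; rewrite -subr_eq0 -normr_le0; apply/ler_addgt0Pl => e e0; rewrite addr0.
move: cF; rewrite subspace_continuousP => /(_ f cf)/cvgrPdist_le/(_ _ e0).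
by rewrite near_withinE => /fin; exact.
Qed.

(** The moment condition is Kolmogorov's, with exponents 4 and 2. Its integral is extended-valued,
    so the inequality contains the integrability of the increments. *)
Definition path_regular {d : measure_display} {T : measurableType d}
    (P : probability T R) (x C : R) (Y : R -> T -> R) :=
  [/\ forall t, 0 <= t -> measurable_fun setT (Y t),
      forall w, Y 0 w = x,
      forall w, {within `[0, +oo[, continuous (Y ^~ w)} &
      forall s t, 0 <= s -> s <= t ->
        (\int[P]_w ((Y t w - Y s w) ^+ 4)%:E <= (C * (t - s) ^+ 2)%:E)%E].

Lemma max0_continuous_paths (f : R -> R) : {within `[0, +oo[, continuous f} ->
  continuous_paths ((fun t => f (Num.max t 0)) : path_space R).
Proof.
move=> cf; apply: (@subspace_eq_continuous _ _ _ f) cf => t.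
by rewrite inE/= in_itv/= => /andP[t0 _]; rewrite /from_subspace max_l.
Qed.

Lemma functional_expect_approx {d : measure_display} {T : measurableType d}
    (P : probability T R) (x C L M e : R) (Y : R -> T -> R)
    (F : path_space R -> R) (A : (R -> R) -> R) :
  path_regular P x C Y -> 0 <= C -> 0 < L -> 200 * C / L ^+ 4 <= e ->
  {within continuous_paths, continuous F} ->
  (forall f, continuous_paths f -> `|F f| <= M) ->
  cylinder A -> (forall f, `|A f| <= M) ->
  (forall f, modulus_class x (fun n => 19 * L * (9 / 10) ^+ n) f ->
    continuous_paths (f : path_space R) -> `|A f - F f| <= e) ->
  exists2 I, ('E_P[fun w => F (Y ^~ w)])%E = I%:E &
    `|I - \int[P]_w A (Y ^~ w)| <= 2 * (e + M * e).
Proof.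
move=> [mY Y0 cY momY] C0 L0 Le cF FM cA AM AF.
have [mB PB] := rough_event_prob L0 C0 mY momY.
have e0 : 0 <= e.
  apply: le_trans Le; apply: divr_ge0; first exact: mulr_ge0 (ler0n _ _) C0.
  by rewrite exprn_ge0// ltW.
apply: (expect_sandwich (A := ~` \bigcup_n rough_event Y L n)) => //.
- exact: cylinder_measurable.
- exact: measurableC.
- by have := AM (fun=> 0); apply: le_trans.
- by move=> w; apply: FM; exact: cY.
- by rewrite setCK (le_trans PB)// lee_fin.
(* Off the rough event the path, once frozen before time 0, belongs to the compact class. Freezing
   changes neither F nor A, since both depend on nonnegative times only. *)
- move=> w wB; pose f := Y ^~ w; pose g t := f (Num.max t 0).
  have fg t : 0 <= t -> f t = g t by move=> t0; rewrite /g max_l.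
  have cg : continuous_paths (g : path_space R) by exact: max0_continuous_paths (cY w).
  rewrite (continuous_functional_ext cF (cY w) cg fg) (cylinder_ext cA fg) distrC.
  apply: AF => //; rewrite -(Y0 w).
  apply: chaining_modulus; [exact: ltW|exact: cY|] => n i ni.
  rewrite leNgt; apply/negP => h; apply: wB; exists n => //; exists i => //.
Qed.

Lemma weak_convergence_criterion
    {d : nat -> measure_display} {T : forall j, measurableType (d j)}
    (P : forall j, probability (T j) R) (Y : forall j, R -> T j -> R)
    {d' : measure_display} {T' : measurableType d'}
    (Q : probability T' R) (Z : R -> T' -> R) (x C : R) :
  0 <= C ->
  (forall j, path_regular (P j) x C (Y j)) -> path_regular Q x C Z ->
  (forall s phi, (forall p, p \in s -> 0 <= p.2) ->
    \int[P j]_w trigonometric s phi (Y j ^~ w) @[j --> \oo] -->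
    \int[Q]_w trigonometric s phi (Z ^~ w)) ->
  weak_convergence P Y Q Z.
Proof.
move=> C0 rY rZ fdd F cF [M FM].
have M0 : 0 <= M.
  apply: le_trans (FM (cst 0) _) => //.
  by apply: continuous_subspaceT => y; exact: cvg_cst.
have main e : 0 < e -> exists IQ (I : nat -> R),
    [/\ ('E_Q[fun w => F (Z ^~ w)])%E = IQ%:E,
        forall j, ('E_(P j)[fun w => F (Y j ^~ w)])%E = (I j)%:E &
        \forall j \near \oo, `|IQ - I j| <= 4 * (e + M * e) + e].
  move=> e0.
  (* With this choice e L >= 200 C, and L >= 1 gives L^4 >= L. *)
  pose L := 1 + 200 * C / e.
  have L1 : 1 <= L by rewrite lerDl; exact: divr_ge0 (mulr_ge0 (ler0n _ _) C0) (ltW e0).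
  have L0 : 0 < L by rewrite (lt_le_trans ltr01).
  have Le : 200 * C / L ^+ 4 <= e.
    rewrite ler_pdivrMr ?exprn_gt0// (@le_trans _ _ (e * L))//.
      by rewrite mulrDr mulrCA divff ?gt_eqF// !mulr1 lerDr ltW.
    by rewrite ler_pM2l// -[leLHS]expr1 ler_weXn2l.
  pose c n := 19 * L * (9 / 10) ^+ n.
  have c0 n : 0 <= c n by rewrite mulr_ge0 ?exprn_ge0 ?mulr_ge0 ?ltW//; lra.
  have cc : c @ \oo --> 0.
    by apply: (@cvg_geometric _ (19 * L)); rewrite ger0_norm; lra.
  pose K := modulus_class x c.
  have Kcont f : K f -> continuous_paths (f : path_space R).
    move=> Kf; apply: continuous_subspaceT.
    by apply: equicontinuous_continuous Kf; exact: modulus_class_equicontinuous.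
  have [A [cA AF]] : exists A : (R -> R) -> R, cylinder A /\
      forall f, K f -> `|A f - F f| <= 3 * (e / 3).
    apply: (@lattice_approx R {family compact, R -> R} K cylinder F) => //.
    - exact: modulus_class_compact.
    - by exists (fun=> 0); exact: cylinder_cst.
    - by move=> A B; exact: cylinder_max.
    - by move=> A B; exact: cylinder_min.
    - move=> A; apply: (@cylinder_continuous R {family compact, R -> R} id).
      exact: eval_family_compact_continuous.
    - apply/subspace_continuousP => f Kf; apply/cvgrPdist_le => a a0.
      rewrite near_withinE.
      have hf : nbhs (f : path_space R) (fun g => continuous_paths g -> `|F f - F g| <= a).
        move: cF; rewrite subspace_continuousP => /(_ f (Kcont f Kf)).
        by move=> /cvgrPdist_le/(_ _ a0); rewrite near_withinE.
      have hf' := family_compact_path_space_nbhs hf.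
      apply: filterS hf' => g h Kg.
      exact/h/Kcont.
    - move=> f g a Kf Kg a0.
      have [fg|/existsNP[t /not_implyP[t0 fgt]]] :=
          pselect (forall t, 0 <= t -> f t = g t).
        exists (fun=> F f); split; [exact: cylinder_cst|by rewrite subrr normr0 ltW|].
        rewrite (continuous_functional_ext cF (Kcont f Kf) (Kcont g Kg) fg).
        by rewrite subrr normr0 ltW.
      (* One cosine interpolates: its frequency b makes the phase run from - pi / 2 on f to 0 on g,
         so that the cosine is 0 on f and 1 on g. *)
      have vu : g t - f t != 0 by rewrite subr_eq0 eq_sym; apply/eqP.
      pose b := pi / 2 / (g t - f t).
      exists (fun h => F f + (F g - F f) *
        trigonometric [:: (b, t)] (- (b * f t) - pi / 2) h); split.
      + apply: cylinderD; first exact: cylinder_cst.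
        by apply/cylinderZ/cylinder_trig => p; rewrite inE => /eqP ->.
      + rewrite /trigonometric /evaluation big_seq1/= addrA subrr add0r cosN.
        by rewrite cos_pihalf mulr0 addr0 subrr normr0 ltW.
      + rewrite /trigonometric /evaluation big_seq1/= addrA -mulrBr /b divfK//.
        by rewrite subrr cos0 mulr1 (addrC (F f)) subrK subrr normr0 ltW.
    - lra.
  (* The functional A approximates F on the compact class only. Truncation bounds it by M on all
     paths and cannot increase its distance to F, which lies in [-M, M] on continuous paths. *)
  pose A' f := Num.max (- M) (Num.min (A f) M).
  have cA' : cylinder A'.
    by apply: cylinder_max; [|apply: cylinder_min => //]; exact: cylinder_cst.
  have A'M f : `|A' f| <= M.
    by rewrite ler_norml /A'; case: (leP (- M) (Num.min (A f) M)); case: (leP (A f) M) => ? ?; lra.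
  have A'F f : K f -> continuous_paths (f : path_space R) -> `|A' f - F f| <= e.
    move=> Kf cf; have := AF f Kf; have := FM f cf; rewrite !ler_norml /A'.
    by case: (leP (- M) (Num.min (A f) M)); case: (leP (A f) M) => ? ?; lra.
  have [IQ hQ dQ] := functional_expect_approx rZ C0 L0 Le cF FM cA' A'M A'F.
  have /choice[I hI] : forall j, exists I : R, ('E_(P j)[fun w => F (Y j ^~ w)])%E = I%:E /\
      `|I - \int[P j]_w A' (Y j ^~ w)| <= 2 * (e + M * e).
    move=> j.
    by have [I] := functional_expect_approx (rY j) C0 L0 Le cF FM cA' A'M A'F; exists I.
  exists IQ, I; split=> // [j|]; first by case: (hI j).
  have mY j t : 0 <= t -> measurable_fun setT (Y j t) by case: (rY j) => + _ _ _; exact.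
  have mZ t : 0 <= t -> measurable_fun setT (Z t) by case: rZ => + _ _ _; exact.
  have /cvgrPdist_le/(_ _ e0) := cylinder_expect_cvg mY mZ fdd cA'.
  apply: filterS => j hj; have [_ dj] := hI j.
  by move: hj dj dQ; rewrite !ler_norml; lra.
(* A first use of [main] shows that the expectations are finite and names their values. Later uses
   with smaller errors produce the same values. *)
have [IQ [I0 [hQ hI0 _]]] := main 1 ltr01.
rewrite hQ (_ : (fun j => _) = fun j => (I0 j)%:E); last by apply/funext => j; exact: hI0.
apply: cvg_EFin; first exact: nearW.
apply/cvgrPdist_le => e e0.
have M5 : 0 < 5 + 4 * M by lra.
have [IQ' [I [hQ' hI near_I]]] := main (e / (5 + 4 * M)) (divr_gt0 e0 M5).
move: near_I; apply: filterS => j.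
have -> : IQ' = IQ by apply/EFin_inj; rewrite -hQ' -hQ.
have -> : I j = I0 j by apply/EFin_inj; rewrite -hI -hI0.
move=> h; rewrite /= (le_trans h)//.
have -> : 4 * (e / (5 + 4 * M) + M * (e / (5 + 4 * M))) + e / (5 + 4 * M) =
  (5 + 4 * M) * (e / (5 + 4 * M)) by ring.
by rewrite mulrCA divff ?mulr1// gt_eqF.
Qed.

End WeakConvergenceCriterion.

(** * Products of independent signs *)

Section TaylorBounds.
Context {R : realType}.
Implicit Types x y c : R.

(** The intermediate point is controlled by |c| <= |x| for both signs of x, so that each of the
    following Taylor bounds is deduced from the preceding one applied to c. *)
Lemma mvt_origin (f df : R -> R) x : (forall y, is_derive y 1 f (df y)) ->
  exists2 c, `|c| <= `|x| & f x - f 0 = df c * x.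
Proof.
move=> fd.
have cf A : {within A, continuous f}.
  apply: continuous_subspaceT => y; apply: differentiable_continuous.
  by apply/derivable1_diffP; case: (fd y).
have [x0|x0] := leP 0 x.
  have [c] := @MVT_segment R f df 0 x x0 (fun y _ => fd y) (cf _).
  rewrite in_itv/= subr0 => /andP[c0 cx] e; exists c => //.
  by rewrite !ger0_norm.
have [c] := @MVT_segment R f df x 0 (ltW x0) (fun y _ => fd y) (cf _).
rewrite in_itv/= => /andP[xc c0] e; exists c; last first.
  by apply/oppr_inj; rewrite opprB e sub0r mulrN.
by rewrite !ler0_norm ?lerN2// ltW.
Qed.

Lemma norm_sin_le x : `|sin x| <= `|x|.
Proof.
have [c _] := mvt_origin x (fun y => is_derive_sin y).
rewrite sin0 subr0 => ->; rewrite normrM ler_piMl//.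
by rewrite ler_norml cos_geN1 cos_le1.
Qed.

Lemma norm_cosB1_le x : `|cos x - 1| <= x ^+ 2.
Proof.
have [c cx] := mvt_origin x (fun y => is_derive_cos y).
rewrite cos0 => ->; rewrite normrM normrN -real_normK ?num_real// expr2.
by rewrite ler_wpM2r// (le_trans (norm_sin_le _)).
Qed.

Lemma norm_sinB_le x : `|sin x - x| <= `|x| ^+ 3.
Proof.
have [c cx] := @mvt_origin (fun y => sin y - y) (fun y => cos y - 1) x
  (fun y => is_deriveB (is_derive_sin y) (is_derive_id y 1)).
rewrite sin0 !subr0 => ->; rewrite normrM exprSr ler_wpM2r//.
by rewrite (le_trans (norm_cosB1_le _))// -real_normK ?num_real// lerXn2r ?nnegrE.
Qed.

Lemma is_derive_half_sqr y : is_derive y 1 (fun z : R => z ^+ 2 / 2) y.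
Proof.
have := is_deriveZ 2^-1 (is_deriveX 2 (is_derive_id y (1 : R))).
rewrite (_ : _ \*: _ = fun z : R => z ^+ 2 / 2); last first.
  by apply/funext => z; rewrite mulrC.
by move=> h; apply: (is_derive_eq h); rewrite /GRing.scale/= mulr1 expr1 mulrA mulVf ?mul1r.
Qed.

(** The common source of two bounds: |c - sin c| is at most |c|^3, which gives order four, and at
    most 2 |c|^2, which gives order three. *)
Lemma norm_cos_taylor2 x : exists2 c, `|c| <= `|x| &
  cos x - 1 + x ^+ 2 / 2 = (c - sin c) * x.
Proof.
have [c cx] := @mvt_origin (fun y => cos y + y ^+ 2 / 2) (fun y => - sin y + y) x
  (fun y => is_deriveD (is_derive_cos y) (is_derive_half_sqr y)).
rewrite cos0 expr0n/= mul0r addr0 => h; exists c => //.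
by rewrite addrAC h addrC.
Qed.

Lemma norm_cos_taylor2_le4 x : `|cos x - 1 + x ^+ 2 / 2| <= x ^+ 4.
Proof.
have [c cx ->] := norm_cos_taylor2 x.
rewrite normrM distrC (_ : x ^+ 4 = `|x| ^+ 3 * `|x|); last first.
  by rewrite -exprSr -normrX ger0_norm// exprn_even_ge0.
by rewrite ler_wpM2r// (le_trans (norm_sinB_le _))// lerXn2r ?nnegrE.
Qed.

Lemma norm_cos_taylor2_le3 x : `|cos x - 1 + x ^+ 2 / 2| <= 2 * `|x| ^+ 3.
Proof.
have [c cx ->] := norm_cos_taylor2 x.
rewrite normrM exprSr mulrA ler_wpM2r//.
apply: (@le_trans _ _ (2 * `|c| ^+ 2)); last by rewrite ler_pM2l// lerXn2r ?nnegrE.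
have h1 := norm_sinB_le c; have h2 := norm_sin_le c.
have h3 := ler_normB c (sin c).
have c0 := normr_ge0 c; move: h1 h3; rewrite distrC.
by case: (leP `|c| 1) => ? ? ?; nra.
Qed.

Lemma cos_taylor x y :
  `|cos (x + y) - (cos x - y * sin x - y ^+ 2 / 2 * cos x)| <= 3 * `|y| ^+ 3.
Proof.
have h1 := norm_cos_taylor2_le3 y; have h2 := norm_sinB_le y.
have -> : cos (x + y) - (cos x - y * sin x - y ^+ 2 / 2 * cos x) =
  cos x * (cos y - 1 + y ^+ 2 / 2) - sin x * (sin y - y) by rewrite cosD; ring.
rewrite (le_trans (ler_normB _ _))// !normrM.
have h3 : `|cos x| * `|cos y - 1 + y ^+ 2 / 2| <= 1 * (2 * `|y| ^+ 3).
  by rewrite ler_pM// ler_norml cos_geN1 cos_le1.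
have h4 : `|sin x| * `|sin y - y| <= 1 * `|y| ^+ 3 by rewrite ler_pM// sin_max.
lra.
Qed.

Lemma norm_cosB_le x y : `|cos x - cos y| <= `|x - y|.
Proof.
have [c _] := @mvt_origin (fun z => cos y * cos z - sin y * sin z)
  (fun z => cos y * - sin z - sin y * cos z) (x - y)
  (fun z => is_deriveB (is_deriveZ (cos y) (is_derive_cos z))
                       (is_deriveZ (sin y) (is_derive_sin z))).
rewrite -!cosD subrKC addr0 => ->; rewrite normrM ler_piMl//.
by rewrite mulrN -opprD normrN addrC -sinD sin_max.
Qed.

Lemma expRN_taylor1 x : 0 <= x -> `|expR (- x) - (1 - x)| <= x ^+ 2.
Proof.
move=> x0; have h1 : 1 - x <= expR (- x) by apply: expR_ge1Dx.
have h2 : expR (- x) * (1 + x) <= 1.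
  by rewrite expRN ler_pdivrMl ?expR_gt0// mulr1 expR_ge1Dx.
have h3 := expR_gt0 (- x).
rewrite ger0_norm ?subr_ge0//; nra.
Qed.

Definition cosh x := (expR x + expR (- x)) / 2.

Definition sinh x := (expR x - expR (- x)) / 2.

Lemma cosh_ge1 x : 1 <= cosh x.
Proof.
have := expR_ge1Dx x; have := expR_ge1Dx (- x); rewrite /cosh; lra.
Qed.

Lemma cosh_norm x : cosh `|x| = cosh x.
Proof.
rewrite /cosh; have [x0|x0] := leP 0 x; first by rewrite ger0_norm.
by rewrite ltr0_norm// opprK [X in X / _]addrC.
Qed.

Lemma le_cosh x y : `|x| <= `|y| -> cosh x <= cosh y.
Proof.
rewrite -(cosh_norm x) -(cosh_norm y).
move: `|x| `|y| (normr_ge0 x) (normr_ge0 y) => a b a0 b0 ab.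
rewrite /cosh ler_pM2r// !expRN.
have := expR_ge1Dx a; have := expR_ge1Dx b; have : expR a <= expR b by rewrite ler_expR.
move: (expR a) (expR b) => u v uv v1 u1.
rewrite -subr_ge0 (_ : _ - _ = (v - u) * (1 - u^-1 * v^-1)); last first.
  by field; apply/andP; split; rewrite gt_eqF//; lra.
apply: mulr_ge0; first by rewrite subr_ge0.
by rewrite subr_ge0 -invfM invf_le1; nra.
Qed.

Lemma is_derive_expRN y : is_derive y 1 (fun z : R => expR (- z)) (- expR (- y)).
Proof.
have := is_derive1_comp (is_derive_expR (- y)) (is_deriveN (is_derive_id y (1 : R))).
by move=> h; apply: (is_derive_eq h); rewrite /GRing.scale/= mulrN1.
Qed.

Lemma is_derive_sinh y : is_derive y 1 sinh (cosh y).
Proof.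
have := is_deriveZ 2^-1 (is_deriveB (is_derive_expR y) (is_derive_expRN y)).
rewrite (_ : _ \*: _ = sinh); last by apply/funext => z; rewrite /sinh mulrC.
by move=> h; apply: (is_derive_eq h); rewrite /cosh opprK mulrC.
Qed.

Lemma is_derive_cosh y : is_derive y 1 cosh (sinh y).
Proof.
have := is_deriveZ 2^-1 (is_deriveD (is_derive_expR y) (is_derive_expRN y)).
rewrite (_ : _ \*: _ = cosh); last by apply/funext => z; rewrite /cosh mulrC.
by move=> h; apply: (is_derive_eq h); rewrite /sinh mulrC.
Qed.

Lemma sinh0 : sinh 0 = 0.
Proof. by rewrite /sinh oppr0 subrr mul0r. Qed.

Lemma norm_sinh_le x : `|sinh x| <= `|x| * cosh x.
Proof.
have [c cx] := mvt_origin x is_derive_sinh.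
rewrite sinh0 subr0 => ->; rewrite normrM mulrC ler_wpM2l//.
by rewrite ger0_norm ?le_cosh// (le_trans ler01)// cosh_ge1.
Qed.

Lemma cosh0 : cosh 0 = 1.
Proof. by rewrite /cosh oppr0 expR0; field. Qed.

Lemma norm_coshB1_le x : `|cosh x - 1| <= x ^+ 2 * cosh x.
Proof.
have [c cx] := mvt_origin x is_derive_cosh.
rewrite cosh0 => ->; rewrite normrM -real_normK ?num_real// expr2 -mulrA mulrC ler_wpM2l//.
rewrite (le_trans (norm_sinh_le _))// ler_pM//; last exact: le_cosh.
by rewrite (le_trans ler01)// cosh_ge1.
Qed.

Lemma norm_sinhB_le x : `|sinh x - x| <= `|x| ^+ 3 * cosh x.
Proof.
have [c cx] := @mvt_origin (fun y => sinh y - y) (fun y => cosh y - 1) x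
  (fun y => is_deriveB (is_derive_sinh y) (is_derive_id y 1)).
rewrite sinh0 !subr0 => ->; rewrite normrM exprSr mulrAC ler_wpM2r//.
rewrite (le_trans (norm_coshB1_le _))// -real_normK ?num_real// ler_pM ?exprn_ge0//.
- by rewrite (le_trans ler01)// cosh_ge1.
- by rewrite lerXn2r ?nnegrE.
- exact: le_cosh.
Qed.

Lemma cosh_taylor2 x : `|cosh x - 1 - x ^+ 2 / 2| <= x ^+ 4 * cosh x.
Proof.
have [c cx] := @mvt_origin (fun y => cosh y - y ^+ 2 / 2) (fun y => sinh y - y) x
  (fun y => is_deriveB (is_derive_cosh y) (is_derive_half_sqr y)).
rewrite cosh0 expr0n/= mul0r subr0 addrAC => ->; rewrite normrM.
rewrite (_ : x ^+ 4 = `|x| ^+ 3 * `|x|); last first.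
  by rewrite -exprSr -normrX ger0_norm// exprn_even_ge0.
rewrite mulrAC ler_wpM2r// (le_trans (norm_sinhB_le _))// ler_pM ?exprn_ge0//.
- by rewrite (le_trans ler01)// cosh_ge1.
- by rewrite lerXn2r ?nnegrE.
- exact: le_cosh.
Qed.

End TaylorBounds.

Section SignChain.
Context {R : realType} {d : measure_display} {T : measurableType d}.
Variable P : probability T R.
Local Notation E f := (\int[P]_x f x).
Variables (e : nat -> T -> R) (q : R).
Hypothesis measurable_e : forall l, measurable_fun setT (e l).
Hypothesis sign_e : forall l w, e l w = 1 \/ e l w = -1.
(* Every function on {1, -1} is affine, so this is independence of the signs. *)
Hypothesis indep_e : forall m (al be : nat -> R),
  E (fun w => \prod_(0 <= l < m) (al l + be l * e l w)) =
  \prod_(0 <= l < m) (al l + be l * q).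

Lemma sqr_sign l w : e l w ^+ 2 = 1.
Proof. by case: (sign_e l w) => ->; rewrite ?sqrrN expr1n. Qed.

Lemma bounded_measurable_sign l : bounded_measurable (e l).
Proof.
split=> //; exists 1 => w.
by case: (sign_e l w) => ->; rewrite ?normrN normr1.
Qed.

Definition history i w : seq R := [seq e l w | l <- iota 0 i].

Lemma historyS i w : history i.+1 w = rcons (history i w) (e i w).
Proof. by rewrite /history -addn1 iotaD map_cat/= add0n cats1. Qed.

(** Being a function of the list of past signs replaces measurability with respect to a filtration.
    There are finitely many histories, so an adapted function is automatically bounded and
    measurable, and no conditional expectation has to be formed. *)
Definition adapted i (g : T -> R) := exists G : seq R -> R, forall w, g w = G (history i w).

Lemma adapted_cst i a : adapted i (fun=> a).
Proof. by exists (fun=> a). Qed.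

Lemma adapted_comp i g (F : R -> R) : adapted i g -> adapted i (fun w => F (g w)).
Proof. by move=> [G gG]; exists (F \o G) => w /=; rewrite gG. Qed.

Lemma adapted_comp2 i g h (F : R -> R -> R) : adapted i g -> adapted i h ->
  adapted i (fun w => F (g w) (h w)).
Proof. by move=> [G gG] [H hH]; exists (fun s => F (G s) (H s)) => w /=; rewrite gG hH. Qed.

Lemma adaptedS i g : adapted i g -> adapted i.+1 g.
Proof.
move=> [G gG]; exists (fun s => G (take i s)) => w.
by rewrite historyS -cats1 take_cat size_map size_iota ltnn subnn take0 cats0.
Qed.

Lemma adapted_sign i : adapted i.+1 (e i).
Proof. by exists (last 0) => w; rewrite historyS last_rcons. Qed.

(* The affine factors are the indicators of [e i = 1] and [e i = -1]. *)
Lemma history_split i (G : seq R -> R) w : G (history i.+1 w) =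
  G (rcons (history i w) 1) * (2^-1 + 2^-1 * e i w) +
  G (rcons (history i w) (-1)) * (2^-1 + - 2^-1 * e i w).
Proof. by rewrite historyS; case: (sign_e i w) => ->; field. Qed.

Lemma bounded_measurable_adapted i g : adapted i g -> bounded_measurable g.
Proof.
move=> [G gG]; rewrite (_ : g = fun w => G (history i w)); last exact/funext.
elim: i G {g gG} => [|i ih] G; first exact: (bounded_measurable_cst (G [::])).
rewrite (_ : (fun _ => _) = fun w => G (rcons (history i w) 1) * (2^-1 + 2^-1 * e i w) +
  G (rcons (history i w) (-1)) * (2^-1 + - 2^-1 * e i w)); last first.
  by apply/funext => w; exact: history_split.
have be c : bounded_measurable (fun w => 2^-1 + c * e i w).
  apply: bounded_measurableD; first exact: bounded_measurable_cst.
  exact/bounded_measurableZ/bounded_measurable_sign.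
apply: bounded_measurableD; apply: bounded_measurableM => //.
  exact: (ih (fun s => G (rcons s 1))).
exact: (ih (fun s => G (rcons s (-1)))).
Qed.

Lemma bounded_measurable_affine_prod i m (al be : nat -> R) :
  bounded_measurable (fun w => \prod_(i <= l < m) (al l + be l * e l w)).
Proof.
apply: bounded_measurable_prod => l.
apply: bounded_measurableD; first exact: bounded_measurable_cst.
exact/bounded_measurableZ/bounded_measurable_sign.
Qed.

(** Induction on the length of the history: [history_split] turns its last sign into an affine
    factor, which joins the product of the later signs. The product is carried along in the
    statement for this purpose. *)
Lemma expect_history_prod i m (G : seq R -> R) (al be : nat -> R) : (i <= m)%N ->
  E (fun w => G (history i w) * \prod_(i <= l < m) (al l + be l * e l w)) =
  E (fun w => G (history i w)) * \prod_(i <= l < m) (al l + be l * q).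
Proof.
elim: i m G al be => [|i ih] m G al be im.
  rewrite /history/= expectZ ?indep_e ?expect_cst//.
  exact: bounded_measurable_affine_prod.
have bG (b : R) : bounded_measurable (fun w => G (rcons (history i w) b)).
  by apply: (bounded_measurable_adapted (i := i)); exists (fun s => G (rcons s b)).
have bp c : bounded_measurable (fun w => 2^-1 + c * e i w).
  apply: bounded_measurableD; first exact: bounded_measurable_cst.
  exact/bounded_measurableZ/bounded_measurable_sign.
(* These coefficients insert at index i the affine factor (1 + b e_i) / 2, the indicator of
   [e i = b] for b = 1 or b = -1. *)
pose al' (b : R) (l : nat) : R := if l == i then 2^-1 else al l.
pose be' (b : R) (l : nat) : R := if l == i then b / 2 else be l.
have key b m' : (i < m')%N -> E (fun w => G (rcons (history i w) b) *
      ((2^-1 + b / 2 * e i w) * \prod_(i.+1 <= l < m') (al l + be l * e l w))) =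
    E (fun w => G (rcons (history i w) b)) *
      ((2^-1 + b / 2 * q) * \prod_(i.+1 <= l < m') (al l + be l * q)).
  move=> im'; have := ih m' (fun s => G (rcons s b)) (al' b) (be' b) (ltnW im').
  rewrite [in RHS]big_ltn// /al' /be' !eqxx.
  rewrite [X in _ * (_ * X)](_ : _ = \prod_(i.+1 <= l < m') (al l + be l * q)); last first.
    by apply: eq_big_nat => l /andP[il _]; rewrite gtn_eqF.
  move=> <-; apply: eq_Rintegral => w _; congr (_ * _).
  rewrite [in RHS]big_ltn// eqxx; congr (_ * _).
  by apply: eq_big_nat => l /andP[il _]; rewrite gtn_eqF.
have bP m' := bounded_measurable_affine_prod i.+1 m' al be.
have split_m m' : (i < m')%N ->
    E (fun w => G (history i.+1 w) * \prod_(i.+1 <= l < m') (al l + be l * e l w)) =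
    (E (fun w => G (rcons (history i w) 1)) * (2^-1 + 1 / 2 * q) +
     E (fun w => G (rcons (history i w) (-1))) * (2^-1 + -1 / 2 * q)) *
    \prod_(i.+1 <= l < m') (al l + be l * q).
  move=> im'; have k1 := key 1 m' im'; have k2 := key (-1) m' im'.
  transitivity (E (fun w => G (rcons (history i w) 1)) *
      ((2^-1 + 1 / 2 * q) * \prod_(i.+1 <= l < m') (al l + be l * q)) +
    E (fun w => G (rcons (history i w) (-1))) *
      ((2^-1 + -1 / 2 * q) * \prod_(i.+1 <= l < m') (al l + be l * q))); last by ring.
  rewrite -k1 -k2 -expectD; last 2 first.
  - by apply: bounded_measurableM => //; apply: bounded_measurableM.
  - by apply: bounded_measurableM => //; apply: bounded_measurableM.
  by apply: eq_Rintegral => w _; rewrite history_split; field.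
rewrite split_m//; congr (_ * _).
have := split_m i.+1 (ltnSn i); rewrite big_geq// mulr1 => <-.
by apply: eq_Rintegral => w _; rewrite big_geq// mulr1.
Qed.

Lemma expect_adapted_sign i g : adapted i g -> E (fun w => g w * e i w) = q * E g.
Proof.
move=> [G gG].
have := expect_history_prod G (fun=> 0) (fun=> 1) (leqnSn i).
rewrite big_nat1 mul1r add0r mulrC => h.
transitivity (q * E (fun w => G (history i w))).
  by rewrite -h; apply: eq_Rintegral => w _; rewrite big_nat1 mul1r add0r gG.
by congr (_ * _); apply: eq_Rintegral => w _; rewrite gG.
Qed.

Definition velocity i w := \prod_(0 <= l < i) e l w.

Definition walk i w := \sum_(0 <= l < i) velocity l w.

Lemma velocityS i w : velocity i.+1 w = velocity i w * e i w.
Proof. by rewrite /velocity big_nat_recr. Qed.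

Lemma walkS i w : walk i.+1 w = walk i w + velocity i w.
Proof. by rewrite /walk big_nat_recr. Qed.

Lemma sqr_velocity i w : velocity i w ^+ 2 = 1.
Proof.
elim: i => [|i ih]; first by rewrite /velocity big_geq// expr1n.
by rewrite velocityS exprMn ih sqr_sign mulr1.
Qed.

Lemma adapted_velocity i : adapted i (velocity i).
Proof.
elim: i => [|i ih]; first by exists (fun=> 1) => w; rewrite /velocity big_geq.
have [G hG] := adapted_comp2 (fun x y => x * y) (adaptedS ih) (adapted_sign i).
by exists G => w; rewrite velocityS hG.
Qed.

Lemma adapted_walk i : adapted i (walk i).
Proof.
elim: i => [|i ih]; first by exists (fun=> 0) => w; rewrite /walk big_geq.
have [G hG] := adaptedS (adapted_comp2 (fun x y => x + y) ih (adapted_velocity i)).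
by exists G => w; rewrite walkS hG.
Qed.

Lemma bounded_measurable_chain i (F : R -> R -> R) :
  bounded_measurable (fun w => F (walk i w) (velocity i w)).
Proof.
apply: (bounded_measurable_adapted (i := i)).
exact: adapted_comp2 (adapted_walk i) (adapted_velocity i).
Qed.

Lemma expect_chain_sign i (F : R -> R -> R) :
  E (fun w => F (walk i w) (velocity i w) * e i w) =
  q * E (fun w => F (walk i w) (velocity i w)).
Proof.
apply: expect_adapted_sign.
exact: adapted_comp2 (adapted_walk i) (adapted_velocity i).
Qed.

Lemma walk0 w : walk 0 w = 0.
Proof. by rewrite /walk big_geq. Qed.

(** The expectation obeys a' = q (a + 1) and starts from 0, so it stays below the fixed point q / (1
    - q). *)
Lemma expect_walk_velocity m : 0 <= q -> q < 1 ->
  E (fun w => walk m w * velocity m w) <= (1 - q)^-1 - 1.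
Proof.
move=> q0 q1; have A0 : 0 < 1 - q by lra.
have A1 : (1 - q)^-1 * (1 - q) = 1 by rewrite mulVf// gt_eqF.
have A2 : 1 <= (1 - q)^-1 by rewrite invf_ge1//; lra.
elim: m => [|m ih].
  under eq_Rintegral do rewrite walk0 mul0r.
  by rewrite expect_cst; lra.
have := expect_chain_sign m (fun x y => (x + y) * y).
under [in X in X -> _]eq_Rintegral do rewrite -mulrA -velocityS -walkS.
move=> ->.
have -> : E (fun w => (walk m w + velocity m w) * velocity m w) =
    E (fun w => walk m w * velocity m w) + 1.
  rewrite -[X in _ = _ + X](expect_cst P) -expectD; [|exact: (bounded_measurable_chain m *%R)|exact: bounded_measurable_cst].
  by apply: eq_Rintegral => w _; rewrite mulrDl -expr2 sqr_velocity.
by move: ((1 - q)^-1) A1 A2 ih => A A1 A2 ih; nra.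
Qed.

Lemma expect_walk2 m : 0 <= q -> q < 1 ->
  E (fun w => walk m w ^+ 2) <= 2 * (1 - q)^-1 * m%:R.
Proof.
move=> q0 q1; elim: m => [|m ih].
  under eq_Rintegral do rewrite walk0 expr0n.
  by rewrite expect_cst mulr0.
have h := expect_walk_velocity m q0 q1.
have -> : E (fun w => walk m.+1 w ^+ 2) =
    E (fun w => walk m w ^+ 2) + (2 * E (fun w => walk m w * velocity m w) + 1).
  rewrite -[X in _ = _ + (_ + X)](expect_cst P) -expectZ; last first.
    exact: (bounded_measurable_chain m *%R).
  rewrite -!expectD.
  - apply: eq_Rintegral => w _; have v2 := sqr_velocity m w; rewrite walkS.
    move: (walk m w) (velocity m w) v2 => x v v2.
    have -> : (x + v) ^+ 2 = x ^+ 2 + 2 * x * v + v ^+ 2 by ring.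
    by rewrite v2; ring.
  - exact: (bounded_measurable_chain m (fun x _ => x ^+ 2)).
  - exact: (bounded_measurable_chain m (fun x y => 2 * (x * y) + 1)).
  - exact: (bounded_measurable_chain m (fun x y => 2 * (x * y))).
  - exact: bounded_measurable_cst.
rewrite -(natr1 m) mulrDr mulr1; lra.
Qed.

(** The recursion is b' = q (b + 3 s + 3 a + 1), with s and a the quantities bounded in
    [expect_walk2] and [expect_walk_velocity]. The factor A - 1 of the bound equals q A and so
    absorbs the q of the recursion. *)
Lemma expect_walk3_velocity m A : 0 <= q -> q < 1 -> A = (1 - q)^-1 ->
  E (fun w => walk m w ^+ 3 * velocity m w) <= (A - 1) * (6 * A * m%:R + 3 * A).
Proof.
move=> q0 q1 AE; have A0 : 0 < 1 - q by lra.
have A1 : A * (1 - q) = 1 by rewrite AE mulVf// gt_eqF.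
have A2 : 1 <= A by rewrite AE invf_ge1//; lra.
elim: m => [|m ih].
  under eq_Rintegral do rewrite walk0 expr0n mul0r.
  by rewrite expect_cst mulr0 add0r; nra.
have h1 := expect_walk_velocity m q0 q1; have h2 := expect_walk2 m q0 q1.
have := expect_chain_sign m (fun x y => (x + y) ^+ 3 * y).
under [in X in X -> _]eq_Rintegral do rewrite -mulrA -velocityS -walkS.
move=> ->.
have -> : E (fun w => (walk m w + velocity m w) ^+ 3 * velocity m w) =
    E (fun w => walk m w ^+ 3 * velocity m w) + (3 * E (fun w => walk m w ^+ 2) +
    (3 * E (fun w => walk m w * velocity m w) + 1)).
  rewrite -[X in _ = _ + (_ + (_ + X))](expect_cst P) -[3 * E (fun w => walk m w * velocity m w)]expectZ; last first.
    exact: (bounded_measurable_chain m *%R).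
  rewrite -[3 * E (fun w => walk m w ^+ 2)]expectZ; last exact: (bounded_measurable_chain m (fun x _ => x ^+ 2)).
  rewrite -!expectD.
  - apply: eq_Rintegral => w _; have v2 := sqr_velocity m w.
    move: (walk m w) (velocity m w) v2 => x v v2.
    have v3 : v ^+ 3 = v by rewrite exprS v2 mulr1.
    have v4 : v ^+ 4 = 1 by rewrite exprS v3 -expr2.
    have -> : (x + v) ^+ 3 * v = x ^+ 3 * v + 3 * x ^+ 2 * v ^+ 2 + 3 * x * v ^+ 3 + v ^+ 4.
      by ring.
    by rewrite v2 v3 v4; ring.
  - exact: (bounded_measurable_chain m (fun x y => x ^+ 3 * y)).
  - exact: (bounded_measurable_chain m (fun x y => 3 * x ^+ 2 + (3 * (x * y) + 1))).
  - exact: (bounded_measurable_chain m (fun x y => 3 * x ^+ 2)).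
  - exact: (bounded_measurable_chain m (fun x y => 3 * (x * y) + 1)).
  - exact: (bounded_measurable_chain m (fun x y => 3 * (x * y))).
  - exact: bounded_measurable_cst.
rewrite -AE in h1 h2; rewrite -(natr1 m); have m0 : 0 <= m%:R :> R by [].
set b := E (fun w => walk m w ^+ 3 * velocity m w) in ih *.
set s := E (fun w => walk m w ^+ 2) in h2 *.
set a := E (fun w => walk m w * velocity m w) in h1 *.
move: (m%:R) b s a m0 ih h1 h2 => M b s a M0 hb ha hs.
apply: (@le_trans _ _ (q * (A * (6 * A * M + 3 * A)))).
  apply: ler_wpM2l => //.
  have : 6 * A * M + 3 * A - 2 >= 3 * (2 * A * M) + 3 * (A - 1) + 1 by nra.
  nra.
have -> : q * (A * (6 * A * M + 3 * A)) = (A - 1) * (6 * A * M + 3 * A).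
  have -> : A - 1 = q * A by rewrite -A1; ring.
  by ring.
by rewrite ler_wpM2l//; nra.
Qed.

(** For mesh h both A and m are of order 1 / h. After multiplication by h^4 only the term A^2 m^2
    survives the mesh limit; the other two are of order h, so their constants are chosen
    generously. *)
Lemma expect_walk4 m A : 0 <= q -> q < 1 -> A = (1 - q)^-1 ->
  E (fun w => walk m w ^+ 4) <=
  24 * A ^+ 2 * m%:R ^+ 2 + 12 * A * m%:R ^+ 2 + 17 * A ^+ 2 * m%:R.
Proof.
move=> q0 q1 AE.
have A2 : 1 <= A by rewrite AE invf_ge1//; lra.
elim: m => [|m ih].
  under eq_Rintegral do rewrite walk0 expr0n.
  by rewrite expect_cst expr0n/= !mulr0 !addr0.
have h1 := expect_walk_velocity m q0 q1; have h2 := expect_walk2 m q0 q1.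
have h3 := expect_walk3_velocity m q0 q1 AE.
have -> : E (fun w => walk m.+1 w ^+ 4) =
    E (fun w => walk m w ^+ 4) + (4 * E (fun w => walk m w ^+ 3 * velocity m w) +
    (6 * E (fun w => walk m w ^+ 2) +
    (4 * E (fun w => walk m w * velocity m w) + 1))).
  rewrite -[X in _ = _ + (_ + (_ + (_ + X)))](expect_cst P) -[4 * E (fun w => walk m w * velocity m w)]expectZ; last first.
    exact: (bounded_measurable_chain m *%R).
  rewrite -[6 * E (fun w => walk m w ^+ 2)]expectZ; last exact: (bounded_measurable_chain m (fun x _ => x ^+ 2)).
  rewrite -[4 * E (fun w => walk m w ^+ 3 * velocity m w)]expectZ; last first.
    exact: (bounded_measurable_chain m (fun x y => x ^+ 3 * y)).
  rewrite -!expectD.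
  - apply: eq_Rintegral => w _; have v2 := sqr_velocity m w; rewrite walkS.
    move: (walk m w) (velocity m w) v2 => x v v2.
    have v3 : v ^+ 3 = v by rewrite exprS v2 mulr1.
    have v4 : v ^+ 4 = 1 by rewrite exprS v3 -expr2.
    have -> : (x + v) ^+ 4 = x ^+ 4 + 4 * x ^+ 3 * v + 6 * x ^+ 2 * v ^+ 2 +
      4 * x * v ^+ 3 + v ^+ 4 by ring.
    by rewrite v2 v3 v4; ring.
  - exact: (bounded_measurable_chain m (fun x _ => x ^+ 4)).
  - exact: (bounded_measurable_chain m (fun x y => 4 * (x ^+ 3 * y) + (6 * x ^+ 2 + (4 * (x * y) + 1)))).
  - exact: (bounded_measurable_chain m (fun x y => 4 * (x ^+ 3 * y))).
  - exact: (bounded_measurable_chain m (fun x y => 6 * x ^+ 2 + (4 * (x * y) + 1))).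
  - exact: (bounded_measurable_chain m (fun x y => 6 * x ^+ 2)).
  - exact: (bounded_measurable_chain m (fun x y => 4 * (x * y) + 1)).
  - exact: (bounded_measurable_chain m (fun x y => 4 * (x * y))).
  - exact: bounded_measurable_cst.
rewrite -AE in h1 h2; rewrite -(natr1 m); have m0 : 0 <= m%:R :> R by [].
set f := E (fun w => walk m w ^+ 4) in ih *.
set b := E (fun w => walk m w ^+ 3 * velocity m w) in h3 *.
set s := E (fun w => walk m w ^+ 2) in h2 *.
set a := E (fun w => walk m w * velocity m w) in h1 *.
move: (m%:R) f b s a m0 ih h1 h2 h3 => M f b s a M0 hf ha hs hb.
have h4 : b <= 6 * A ^+ 2 * M + 3 * A ^+ 2 by apply: le_trans hb _; nra.
have h5 : 0 <= A * M by nra.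
have h6 : A <= A ^+ 2 by nra.
nra.
Qed.

Section CharacteristicFunction.
Variables (kap B : R) (al : nat -> R).
Hypothesis kap0 : 0 <= kap.
Hypothesis q1 : -1 <= q <= 1.
Hypothesis alB : forall l, `|al l| <= B.
(** The conditional variance of a martingale step: a sign of mean q has variance 1 - q^2. *)
Let del := kap ^+ 2 * (1 - q ^+ 2).

Definition martingale_step l w := kap * velocity l w * (e l w - q).

Lemma adapted_martingale_step l : adapted l.+1 (martingale_step l).
Proof.
have [G hG] := adapted_comp2 (fun x y => kap * x * (y - q))
  (adaptedS (adapted_velocity l)) (adapted_sign l).
by exists G => w; rewrite -hG.
Qed.

Lemma expect_martingale_step i g : adapted i g ->
  E (fun w => g w * martingale_step i w) = 0.
Proof.
move=> ag; have agv := adapted_comp2 (fun x y => kap * (x * y)) ag (adapted_velocity i).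
have bgv := bounded_measurable_adapted agv.
transitivity (E (fun w => kap * (g w * velocity i w) * e i w) -
  q * E (fun w => kap * (g w * velocity i w))).
  rewrite -expectZ// -expectB; [|apply: bounded_measurableM => //; exact: bounded_measurable_sign|exact: bounded_measurableZ].
  by apply: eq_Rintegral => w _; rewrite /martingale_step; ring.
by rewrite (expect_adapted_sign agv) subrr.
Qed.

Lemma expect_sqr_martingale_step i g : adapted i g ->
  E (fun w => g w * martingale_step i w ^+ 2) = del * E g.
Proof.
move=> ag; have bg := bounded_measurable_adapted ag.
transitivity (kap ^+ 2 * ((1 + q ^+ 2) * E g - 2 * q * E (fun w => g w * e i w))).
  have bge : bounded_measurable (fun w => g w * e i w).
    by apply: bounded_measurableM => //; exact: bounded_measurable_sign.
  rewrite -!expectZ// -expectB; [|exact: bounded_measurableZ..].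
  rewrite -expectZ; last by apply: bounded_measurableB; exact: bounded_measurableZ.
  apply: eq_Rintegral => w _; rewrite /martingale_step.
  have v2 := sqr_velocity i w; have e2 := sqr_sign i w.
  move: (velocity i w) (e i w) v2 e2 => v z v2 z2.
  have -> : (kap * v * (z - q)) ^+ 2 = kap ^+ 2 * v ^+ 2 * (z ^+ 2 - 2 * q * z + q ^+ 2) by ring.
  by rewrite v2 z2; ring.
by rewrite (expect_adapted_sign ag) /del; ring.
Qed.

Definition phase phi i w := \sum_(0 <= l < i) al l * martingale_step l w + phi.

Lemma adapted_phase phi i : adapted i (phase phi i).
Proof.
elim: i => [|i ih]; first by exists (fun=> phi) => w; rewrite /phase big_geq// add0r.
have [G hG] := adapted_comp2 (fun x y => x + al i * y) (adaptedS ih) (adapted_martingale_step i).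
by exists G => w; rewrite -hG /phase big_nat_recr//= addrAC.
Qed.

Lemma del_ge0 : 0 <= del.
Proof. by have /andP[? ?] := q1; rewrite /del mulr_ge0 ?sqr_ge0//; nra. Qed.

(** Second-order expansion of the cosine. The linear term has expectation zero, the quadratic one
    gives the factor 1 - x with x = al^2 del / 2, and the cubic remainder costs 3 B^3 (2 kap) del.
    Replacing 1 - x by its exponential costs x^2 <= B^4 del^2. *)
Lemma expect_cos_phase_step phi i :
  `|E (fun w => cos (phase phi i.+1 w)) -
    expR (- (al i ^+ 2 * del / 2)) * E (fun w => cos (phase phi i w))| <=
  6 * B ^+ 3 * kap * del + B ^+ 4 * del ^+ 2.
Proof.
have ap := adapted_phase phi i.
have ac := adapted_comp (@cos R) ap; have asn := adapted_comp (@sin R) ap.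
have bc := bounded_measurable_adapted ac; have bs := bounded_measurable_adapted asn.
have bd := bounded_measurable_adapted (adapted_martingale_step i).
have B0 : 0 <= B by exact: le_trans (alB 0).
have d0 := del_ge0.
pose x := al i ^+ 2 * del / 2.
have x0 : 0 <= x by rewrite /x divr_ge0// mulr_ge0// sqr_ge0.
have al2 : al i ^+ 2 <= B ^+ 2.
  by rewrite -real_normK ?num_real// lerXn2r ?nnegrE.
have h1 : `|E (fun w => cos (phase phi i.+1 w)) -
    (1 - x) * E (fun w => cos (phase phi i w))| <= 6 * B ^+ 3 * kap * del.
  have -> : (1 - x) * E (fun w => cos (phase phi i w)) =
      E (fun w => cos (phase phi i w) - al i * (sin (phase phi i w) * martingale_step i w) -
        al i ^+ 2 / 2 * (cos (phase phi i w) * martingale_step i w ^+ 2)).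
    rewrite expectB; last 2 first.
    - apply: bounded_measurableB => //; apply: bounded_measurableZ.
      exact: bounded_measurableM.
    - by apply/bounded_measurableZ/bounded_measurableM => //; exact: bounded_measurableX.
    rewrite expectB//; last by apply: bounded_measurableZ; exact: bounded_measurableM.
    rewrite !expectZ; [|by apply: bounded_measurableM => //; exact: bounded_measurableX
                       |exact: bounded_measurableM].
    by rewrite expect_martingale_step// expect_sqr_martingale_step// /x; field.
  rewrite -expectB; last 2 first.
  - exact: bounded_measurable_adapted (adapted_comp (@cos R) (adapted_phase phi i.+1)).
  - apply: bounded_measurableB; last first.
      by apply/bounded_measurableZ/bounded_measurableM => //; exact: bounded_measurableX.
    by apply: bounded_measurableB => //; apply: bounded_measurableZ; exact: bounded_measurableM.
  apply: (@le_trans _ _ (E (fun w => 6 * B ^+ 3 * kap * martingale_step i w ^+ 2))).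
    apply: expect_norm_le.
    - apply: bounded_measurableB.
        exact: bounded_measurable_adapted (adapted_comp (@cos R) (adapted_phase phi i.+1)).
      apply: bounded_measurableB; last first.
        by apply/bounded_measurableZ/bounded_measurableM => //; exact: bounded_measurableX.
      by apply: bounded_measurableB => //; apply: bounded_measurableZ; exact: bounded_measurableM.
    - exact/bounded_measurableZ/bounded_measurableX.
    - move=> w; rewrite /phase big_nat_recr//= addrAC -/(phase phi i w).
      have := cos_taylor (phase phi i w) (al i * martingale_step i w).
      rewrite (exprMn _ (al i)) normrM (exprMn _ `|al i|) => h.
      apply: (@le_trans _ _ (3 * (`|al i| ^+ 3 * `|martingale_step i w| ^+ 3))).
        by apply: le_trans h; rewrite le_eqVlt; apply/orP; left; apply/eqP; congr `|_|; field.
      have m1 : `|martingale_step i w| <= 2 * kap.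
        rewrite /martingale_step !normrM (ger0_norm kap0).
        have -> : `|velocity i w| = 1.
          by apply/eqP; rewrite -sqrp_eq1// real_normK ?num_real// sqr_velocity.
        rewrite mulr1 mulrC ler_wpM2r//.
        have /andP[? ?] := q1.
        by case: (sign_e i w) => ->; rewrite ler_norml; apply/andP; split; lra.
      have a3 : `|al i| ^+ 3 <= B ^+ 3 by rewrite lerXn2r ?nnegrE.
      (* Only one factor of the cube is bounded by 2 kap; the square is kept, because its
         expectation is the small quantity [del]. *)
      have m3 : `|martingale_step i w| ^+ 3 <= 2 * kap * martingale_step i w ^+ 2.
        by rewrite exprS -(real_normK (num_real (martingale_step i w))) ler_wpM2r ?exprn_ge0.
      have : `|al i| ^+ 3 * `|martingale_step i w| ^+ 3 <=
        B ^+ 3 * (2 * kap * martingale_step i w ^+ 2) by rewrite ler_pM ?exprn_ge0.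
      lra.
  rewrite expectZ; last exact: bounded_measurableX.
  have := expect_sqr_martingale_step (adapted_cst i 1); rewrite expect_cst mulr1.
  by under eq_Rintegral do rewrite mul1r; move=> ->.
have h2 : `|(1 - x) * E (fun w => cos (phase phi i w)) -
    expR (- x) * E (fun w => cos (phase phi i w))| <= B ^+ 4 * del ^+ 2.
  rewrite -mulrBl normrM distrC.
  have c1 : `|E (fun w => cos (phase phi i w))| <= 1.
    by apply: expect_norm_le_cst => // w; rewrite ler_norml cos_geN1 cos_le1.
  apply: (@le_trans _ _ (x ^+ 2)).
    by rewrite -[leRHS]mulr1 ler_pM// expRN_taylor1.
  apply: (@le_trans _ _ ((B ^+ 2 * del) ^+ 2)); last by rewrite exprMn -exprM.
  rewrite lerXn2r ?nnegrE//; first by rewrite mulr_ge0// sqr_ge0.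
  have : al i ^+ 2 * del <= B ^+ 2 * del by rewrite ler_wpM2r.
  by move: x0; rewrite /x; lra.
have := ler_normD (E (fun w => cos (phase phi i.+1 w)) -
  (1 - x) * E (fun w => cos (phase phi i w)))
  ((1 - x) * E (fun w => cos (phase phi i w)) - expR (- x) * E (fun w => cos (phase phi i w))).
by rewrite addrA subrK -/x; lra.
Qed.

(** The one-step errors simply add, since each is afterwards multiplied by exponentials that do not
    exceed 1. *)
Lemma expect_cos_phase phi M :
  `|E (fun w => cos (phase phi M w)) -
    expR (- (del * (\sum_(0 <= l < M) al l ^+ 2) / 2)) * cos phi| <=
  M%:R * (6 * B ^+ 3 * kap * del + B ^+ 4 * del ^+ 2).
Proof.
elim: M => [|M ih].
  rewrite big_geq// mulr0 mul0r oppr0 expR0 mul1r mul0r.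
  under eq_Rintegral do rewrite /phase big_geq// add0r.
  by rewrite expect_cst subrr normr0.
have st := expect_cos_phase_step phi M.
set err := 6 * B ^+ 3 * kap * del + B ^+ 4 * del ^+ 2 in ih st *.
set EM := E (fun w => cos (phase phi M w)) in ih st.
set x := al M ^+ 2 * del / 2 in st.
rewrite big_nat_recr//=.
set S := \sum_(0 <= l < M) al l ^+ 2 in ih *.
have -> : - (del * (S + al M ^+ 2) / 2) = - x + - (del * S / 2) by rewrite /x; field.
rewrite expRD -mulrA.
have h : `|expR (- x) * (EM - expR (- (del * S / 2)) * cos phi)| <= M%:R * err.
  rewrite normrM -[leRHS]mul1r ler_pM// ger0_norm ?expR_ge0//.
  by rewrite -expR0 ler_expR oppr_le0 divr_ge0// mulr_ge0 ?sqr_ge0 ?del_ge0.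
have := ler_normD (E (fun w => cos (phase phi M.+1 w)) - expR (- x) * EM)
  (expR (- x) * (EM - expR (- (del * S / 2)) * cos phi)).
by rewrite mulrBr addrA subrK -(natr1 M) mulrDl mul1r -mulrBr; lra.
Qed.

End CharacteristicFunction.

End SignChain.

(** * Goldstein-Kac processes *)

Section TrigonometricParity.
Context {R : realType}.

Lemma sin_pi_nat (k : nat) : sin (pi * k%:R) = 0 :> R.
Proof.
elim: k => [|k ih]; first by rewrite mulr0 sin0.
by rewrite -natr1 mulrDr mulr1 sinDpi ih oppr0.
Qed.

Lemma cos_pi_nat (k : nat) : cos (pi * k%:R) = (-1) ^+ k :> R.
Proof.
elim: k => [|k ih]; first by rewrite mulr0 cos0.
by rewrite -natr1 mulrDr mulr1 cosDpi ih exprS mulN1r.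
Qed.

Lemma cos_pi_natB (k l : nat) : cos (pi * (k%:R - l%:R)) = (-1) ^+ k * (-1) ^+ l :> R.
Proof. by rewrite mulrBr cosB !sin_pi_nat !cos_pi_nat mulr0 addr0. Qed.

End TrigonometricParity.

Section AlternatingTime.
Context {R : realType}.
Variable n : R -> nat.
Hypothesis n_nd : forall s t, 0 <= s -> s <= t -> (n s <= n t)%N.
Local Notation mu := (@lebesgue_measure R).

Definition alternating_time (t : R) : R := \int[mu]_(u in `[0, t]) (-1) ^+ n u.

Lemma norm_sign_nat (k : nat) : `|(-1) ^+ k| = 1 :> R.
Proof. by rewrite normrX normrN1 expr1n. Qed.

Lemma alternating_integrable b :
  mu.-integrable `[0, b] (EFin \o (fun u => (-1) ^+ n u : R)).
Proof.
apply: measurable_bounded_integrable => //.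
- have := @lebesgue_measure_itv R `[0, b].
  by move=> /= ->; case: ifP => _; rewrite ltry.
(* The sign is cos (pi n), and n composed with the positive part is nondecreasing on the whole line,
   hence measurable. *)
- apply: (@eq_measurable_fun _ _ _ _ _ (fun u : R => cos (pi * (n (Num.max u 0))%:R) : R)).
    by move=> u; rewrite inE/= in_itv/= => /andP[u0 _]; rewrite max_l// cos_pi_nat.
  apply: measurable_funTS; apply: measurableT_comp; first exact: measurable_cos.
  apply: measurable_funM => //; apply: nondecreasing_measurable => // x y xy.
  rewrite ler_nat; apply: n_nd; first by rewrite le_max lexx orbT.
  by rewrite ge_max !le_max xy lexx !orbT.
- exists 1; split=> // K K1 u _.
  have e : `|(-1) ^+ n u| <= 1 :> R by rewrite norm_sign_nat.
  exact: le_trans e (ltW K1).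
Qed.

Lemma alternating_time_incr s t a K : 0 <= s -> s <= t ->
  (forall u, s <= u -> u <= t -> `|(-1) ^+ n u - a| <= K) ->
  `|alternating_time t - alternating_time s - (t - s) * a| <= (t - s) * K.
Proof.
move=> s0 st hK.
have mI : measurable `]s, t] by exact: measurable_itv.
have iI : mu.-integrable `]s, t] (EFin \o (fun u => (-1) ^+ n u : R)).
  apply: (integrableS _ _ _ (alternating_integrable t)) => //.
  by move=> u /=; rewrite !in_itv/= => /andP[/ltW su ->]; rewrite (le_trans s0 su).
have fI : (mu `]s, t] < +oo)%E.
  have := @lebesgue_measure_itv R `]s, t].
  by move=> /= ->; case: ifP => _; rewrite ltry.
have muI : fine (mu `]s, t]) = t - s.
  rewrite lebesgue_measure_itv/=; case: ifPn => //= h.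
  by apply/esym/eqP; rewrite subr_eq0 eq_le st andbT leNgt; move: h; rewrite lte_fin.
have cI k : mu.-integrable `]s, t] (EFin \o (fun=> k : R)).
  apply: measurable_bounded_integrable => //.
  by exists `|k|; split=> // M hM u _; rewrite ltW.
have -> : alternating_time t - alternating_time s = \int[mu]_(u in `]s, t]) (-1) ^+ n u.
  rewrite /alternating_time Rintegral_itvB//; first exact: alternating_integrable.
have -> : (t - s) * a = \int[mu]_(u in `]s, t]) a by rewrite Rintegral_cst// muI mulrC.
have -> : (t - s) * K = \int[mu]_(u in `]s, t]) K by rewrite Rintegral_cst// muI mulrC.
rewrite -RintegralB//.
have iB : mu.-integrable `]s, t] (EFin \o (fun u => (-1) ^+ n u - a : R)).
  exact: (@integrableB _ _ _ mu `]s, t]%classic mI (EFin \o (fun u => (-1) ^+ n u)) (EFin \o (fun=> a)) iI (cI a)).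
have h := @le_normr_Rintegral _ _ _ mu _ (fun u => (-1) ^+ n u - a) mI iB.
apply: (le_trans h); apply: le_Rintegral => //; first exact: integrable_norm iB.
by move=> u /=; rewrite in_itv/= => /andP[/ltW su ut]; exact: hK.
Qed.

Lemma alternating_time0 : alternating_time 0 = 0.
Proof. by rewrite /alternating_time set_itv1 Rintegral_set1. Qed.

Lemma alternating_time_lipschitz s t : 0 <= s -> s <= t ->
  `|alternating_time t - alternating_time s| <= t - s.
Proof.
move=> s0 st; have := @alternating_time_incr s t 0 1 s0 st.
rewrite mulr0 subr0 mulr1; apply=> u _ _.
by rewrite subr0 norm_sign_nat.
Qed.

(** Without a jump in the cell the integral is exact. Otherwise the integrand is off by at most 2,
    while the number of jumps is at least 1. *)
Lemma alternating_time_cell x h : 0 <= x -> 0 <= h ->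
  `|alternating_time (x + h) - alternating_time x - h * (-1) ^+ n x| <=
  h * (2 * ((n (x + h))%:R - (n x)%:R)).
Proof.
move=> x0 h0; have := @alternating_time_incr x (x + h) ((-1) ^+ n x)
  (2 * ((n (x + h))%:R - (n x)%:R)) x0.
have -> : x + h - x = h by rewrite addrAC subrr add0r.
rewrite lerDl => /(_ h0); apply=> u xu uh.
have n1 := n_nd x0 xu; have n2 := n_nd (le_trans x0 xu) uh.
have [e|ne] := eqVneq (n u) (n x).
  by rewrite e subrr normr0 mulr_ge0// subr_ge0 ler_nat (leq_trans n1).
have : (n x < n (x + h))%N by rewrite (leq_trans _ n2)// ltn_neqAle eq_sym ne.
rewrite -(@ler_nat R) -natr1 => h1.
rewrite (le_trans (ler_normB _ _))// !norm_sign_nat; lra.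
Qed.

(** The jump counts of the cells telescope, so for a fixed path the Riemann sum errs by at most a
    multiple of h. *)
Lemma alternating_time_riemann s h M : 0 <= s -> 0 <= h ->
  `|alternating_time (s + M%:R * h) - alternating_time s -
    h * \sum_(0 <= i < M) (-1) ^+ n (s + i%:R * h)| <=
  2 * h * ((n (s + M%:R * h))%:R - (n s)%:R).
Proof.
move=> s0 h0; elim: M => [|M ih].
  by rewrite mul0r addr0 big_geq// mulr0 !subrr normr0 mulr0.
have x0 : 0 <= s + M%:R * h by rewrite addr_ge0// mulr_ge0.
have := alternating_time_cell x0 h0.
have -> : s + M%:R * h + h = s + M.+1%:R * h by rewrite -(natr1 M) mulrDl mul1r addrA.
rewrite big_nat_recr//= mulrDr.
move: (\sum_(0 <= i < M) _) ih => S; rewrite !ler_norml; lra.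
Qed.

Lemma alternating_time_floor t h : 0 <= t -> 0 < h ->
  `|alternating_time t - h * \sum_(0 <= i < Num.truncn (t / h)) (-1) ^+ n (i%:R * h)| <=
  h * (2 * (n t)%:R + 1).
Proof.
move=> t0 h0; set M := Num.truncn (t / h).
have /andP[M1 M2] : M%:R <= t / h < M.+1%:R by apply: truncn_itv; rewrite divr_ge0// ltW.
have Mt : M%:R * h <= t by rewrite -ler_pdivlMr.
have tM : t - M%:R * h <= h.
  by move: M2; rewrite ltr_pdivrMr// -natr1 mulrDl mul1r; lra.
have M0 : 0 <= M%:R * h by rewrite mulr_ge0// ltW.
have h1 := alternating_time_riemann M (lexx 0) (ltW h0).
rewrite add0r alternating_time0 subr0 in h1.
have h2 := alternating_time_lipschitz M0 Mt.
have h3 : (n (M%:R * h))%:R <= (n t)%:R :> R by rewrite ler_nat; exact: n_nd.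
have h4 : 0 <= (n 0)%:R :> R by [].
have h5 : 2 * h * ((n (M%:R * h))%:R - (n 0)%:R) <= 2 * h * (n t)%:R.
  by rewrite ler_pM2l ?mulr_gt0//; lra.
under [X in h * X]eq_bigr do rewrite -[X in n X]add0r.
by move: h1 h2; rewrite !ler_norml; lra.
Qed.

End AlternatingTime.

Section PoissonParity.
Context {R : realType} {d : measure_display} {T : measurableType d}.
Variables (P : probability T R) (lam : R) (N : R -> T -> nat).
Hypothesis lam0 : 0 < lam.
Hypothesis hN : poisson_process P lam N.
Local Notation E f := (\int[P]_x f x).

Lemma measurable_poisson t (A : set nat) : 0 <= t -> measurable [set w | A (N t w)].
Proof.
move=> t0; rewrite -[X in measurable X]setTI.
exact: (poisson_measurable hN t0 measurableT (Y := A)).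
Qed.

Lemma measurable_poisson_incr s t (k : nat) : 0 <= s -> 0 <= t ->
  measurable [set w | N t w = (N s w + k)%N].
Proof.
move=> s0 t0.
rewrite (_ : [set w | _] =
    \bigcup_a ([set w | N s w = a] `&` [set w | N t w = (a + k)%N])); last first.
  apply/seteqP; split => w /=; first by move=> h; exists (N s w).
  by move=> [a _ [-> ->]].
apply: bigcup_measurable => a _; apply: measurableI.
  exact: (measurable_poisson (fun b => b = a)).
exact: (measurable_poisson (fun b => b = (a + k)%N)).
Qed.

(** The probability that a Poisson variable of parameter mu is odd; for mu > 0 it equals (1 - exp
    (-2 mu)) / 2. First-order bounds on it are all that the mesh limit asks for. *)
Definition poisson_odd (mu : R) : R :=
  fine (\sum_(0 <= k <oo) (poisson_pmf mu k.*2.+1)%:E)%E.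

Definition odd_event s t := [set w | odd (N t w - N s w)].

Lemma odd_eventE s t : 0 <= s -> s <= t -> odd_event s t =
  \bigcup_k [set w | N t w = (N s w + k.*2.+1)%N].
Proof.
move=> s0 st; apply/seteqP; split => w /=.
  have Nst := poisson_nondecreasing hN w s0 st => ow.
  exists ((N t w - N s w)./2) => //=.
  by rewrite -[LHS](subnKC Nst) -[in LHS](odd_double_half (N t w - N s w)) ow.
by move=> [k _ /= e]; rewrite /odd_event/= e addKn/= odd_double.
Qed.

Lemma measurable_odd_event s t : 0 <= s -> s <= t -> measurable (odd_event s t).
Proof.
move=> s0 st; rewrite odd_eventE//; apply: bigcup_measurable => k _.
exact: measurable_poisson_incr (le_trans s0 st).
Qed.

Lemma odd_event_prob s t : 0 <= s -> s < t ->
  fine (P (odd_event s t)) = poisson_odd (lam * (t - s)).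
Proof.
move=> s0 st; rewrite /poisson_odd odd_eventE ?(ltW st)//.
have t0 : 0 <= t by rewrite (le_trans s0)// ltW.
rewrite measure_semi_bigcup.
- congr fine; apply: eq_eseriesr => k _.
  by have /= -> := poisson_increments hN k.*2.+1 s0 st.
- by move=> k; exact: measurable_poisson_incr.
- move=> i j _ _ [w [/= -> /eqP]].
  by rewrite eqn_add2l eqSS => /eqP /double_inj.
- by apply: bigcup_measurable => k _; exact: measurable_poisson_incr.
Qed.

(** The bounds are read off from the process: exactly one event has probability mu exp (- mu) >= mu
    (1 - mu), and an odd number of events is a nonzero one, of probability 1 - exp (- mu) <= mu. *)
Lemma poisson_odd_bounds s t mu : 0 <= s -> s < t -> mu = lam * (t - s) ->
  mu * (1 - mu) <= poisson_odd mu <= mu.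
Proof.
move=> s0 st muE; have t0 : 0 <= t by rewrite (le_trans s0)// ltW.
have mu0 : 0 < mu by rewrite muE mulr_gt0// subr_gt0.
have hexp : 1 - mu <= expR (- mu) by exact: expR_ge1Dx.
have mO := measurable_odd_event s0 (ltW st).
have mI k := @measurable_poisson_incr s t k s0 t0.
have pI k : fine (P [set w | N t w = (N s w + k)%N]) = poisson_pmf mu k.
  by rewrite (poisson_increments hN _ s0 st) -muE.
rewrite muE -odd_event_prob// -muE; apply/andP; split.
  apply: (@le_trans _ _ (poisson_pmf mu 1)).
    by rewrite /poisson_pmf mu0 expr1 (_ : 1`! = 1%N)// divr1 ler_pM2l.
  rewrite -pI; apply: fine_le; [exact: fin_num_measure..|].
  apply: le_measure; rewrite ?inE// => w /= e.
  by rewrite /odd_event/= e addKn.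
apply: (@le_trans _ _ (1 - poisson_pmf mu 0)).
  have -> : 1 - poisson_pmf mu 0 = fine (P (~` [set w | N t w = (N s w + 0)%N])).
    by rewrite probability_setC// -pI -(fineK (fin_num_measure P _ (mI 0%N))).
  apply: fine_le; [exact: fin_num_measure|apply: fin_num_measure; exact: measurableC|].
  apply: le_measure; rewrite ?inE//; first exact: measurableC.
  by move=> w /= + e; rewrite /odd_event/= e addKn.
by rewrite /poisson_pmf mu0 expr0 fact0 divr1 mul1r; lra.
Qed.

(* The cosine makes this a measurable function of the increment of N. *)
Definition parity_sign s t w : R := cos (pi * ((N t w)%:R - (N s w)%:R)).

Lemma parity_signE s t w : parity_sign s t w = (-1) ^+ N t w * (-1) ^+ N s w.
Proof. exact: cos_pi_natB. Qed.

Lemma measurable_parity_sign s t : 0 <= s -> 0 <= t ->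
  measurable_fun setT (parity_sign s t).
Proof.
move=> s0 t0; apply: measurableT_comp; first exact: measurable_cos.
have mN u : 0 <= u -> measurable_fun setT (fun w => (N u w)%:R : R).
  by move=> u0; apply: measurableT_comp (poisson_measurable hN u0).
by apply: measurable_funM => //; apply: measurable_funB; exact: mN.
Qed.

Lemma parity_sign_odd s t w : 0 <= s -> s <= t ->
  parity_sign s t w = 1 - 2 * \1_(odd_event s t) w.
Proof.
move=> s0 st; have Nst := poisson_nondecreasing hN w s0 st.
rewrite parity_signE -exprD -[in LHS](subnK Nst) -addnA exprD.
rewrite (_ : (-1) ^+ (N s w + N s w) = 1 :> R); last first.
  by rewrite addnn -signr_odd odd_double.
rewrite mulr1 -signr_odd indicE.
have [ow|ow] := boolP (odd (N t w - N s w)).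
  by rewrite mem_set//= expr1; lra.
by rewrite memNset/= ?expr0 ?mulr0 ?subr0//; exact/negP.
Qed.

Lemma expect_parity_sign s t : 0 <= s -> s < t ->
  E (parity_sign s t) = 1 - 2 * poisson_odd (lam * (t - s)).
Proof.
move=> s0 st; have mO := measurable_odd_event s0 (ltW st).
have bi : bounded_measurable (\1_(odd_event s t) : T -> R).
  exact: bounded_measurable_indic.
under eq_Rintegral do rewrite (parity_sign_odd _ s0 (ltW st)).
rewrite expectB; [|exact: bounded_measurable_cst|exact: bounded_measurableZ].
by rewrite expect_cst expectZ// expect_indic// odd_event_prob.
Qed.

Section Grid.
Variables s h : R.
Hypothesis s0 : 0 <= s.
Hypothesis h0 : 0 < h.
Let x (i : nat) : R := s + i%:R * h.
Let q := 1 - 2 * poisson_odd (lam * h).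

Definition grid_sign (l : nat) : T -> R := parity_sign (x l) (x l.+1).

Let x_ge0 i : 0 <= x i.
Proof. by rewrite addr_ge0// mulr_ge0// ltW. Qed.

Let xS i : x i.+1 - x i = h.
Proof. by rewrite /x -(natr1 i); ring. Qed.

Let lt_xS i : x i < x i.+1.
Proof. by rewrite -subr_gt0 xS. Qed.

Lemma measurable_grid_sign l : measurable_fun setT (grid_sign l).
Proof. exact: measurable_parity_sign. Qed.

Lemma grid_sign_pm1 l w : grid_sign l w = 1 \/ grid_sign l w = -1.
Proof.
rewrite /grid_sign parity_sign_odd ?(ltW (lt_xS l))// indicE.
case: (_ \in _); rewrite ?mulr1n ?mulr0n; [right|left]; lra.
Qed.

Lemma grid_sign_indep m (al be : nat -> R) :
  E (fun w => \prod_(0 <= l < m) (al l + be l * grid_sign l w)) =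
  \prod_(0 <= l < m) (al l + be l * q).
Proof.
have bg l : bounded_measurable (grid_sign l).
  split; first exact: measurable_grid_sign.
  by exists 1 => w; rewrite ler_norml cos_geN1 cos_le1.
have ba l : bounded_measurable (fun w => al l + be l * grid_sign l w).
  by apply: bounded_measurableD; [exact: bounded_measurable_cst|exact: bounded_measurableZ].
have Ea l : E (fun w => al l + be l * grid_sign l w) = al l + be l * q.
  rewrite expectD ?expect_cst ?expectZ//.
  - by rewrite /grid_sign (expect_parity_sign (x_ge0 l) (lt_xS l)) xS.
  - exact: bounded_measurable_cst.
  - exact: bounded_measurableZ.
under eq_Rintegral do rewrite big_mkord.
have x_nd : nondecreasing_seq x.
  by apply/nondecreasing_seqP => i; exact: ltW.
have ind := @poisson_independent_increments _ _ _ _ _ _ hN m x (x_ge0 0) x_nd.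
rewrite (@expect_prod_indep _ _ _ P _ _ (fun (i : 'I_m) w => al i + be i * grid_sign i w) ind)//.
- by rewrite big_mkord; apply: eq_bigr => i _; exact: Ea.
- move=> i B [C mC <-]; rewrite setTI.
  pose D := (fun w => (N (x i.+1) w)%:R - (N (x i) w)%:R : R).
  have mD : measurable_fun setT D.
    by apply: measurable_funB; apply: measurableT_comp (poisson_measurable hN _).
  by rewrite -[X in measurable X]setTI; exact: mD.
- move=> i B mB; exists ((fun y => al i + be i * cos (pi * y)) @^-1` B).
    rewrite -[X in measurable X]setTI.
    have mf : measurable_fun setT (fun y : R => al i + be i * cos (pi * y)).
      apply: measurable_funD => //; apply: measurable_funM => //.
      apply: measurableT_comp; first exact: measurable_cos.
      exact: measurable_funM.
    exact: mf.
  by rewrite setTI.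
Qed.

(** The product of the parity signs telescopes, so the abstract velocity is the direction relative
    to the one at time s. *)
Lemma grid_velocity i w :
  velocity grid_sign i w = (-1) ^+ N (x i) w * (-1) ^+ N s w.
Proof.
elim: i => [|i ih].
  rewrite /velocity big_geq// /x mul0r addr0 -expr2 -exprM mulnC exprM sqrrN !expr1n//.
rewrite velocityS ih /grid_sign parity_signE.
have e2 k : (-1) ^+ k * (-1) ^+ k = 1 :> R by rewrite -expr2 sqrr_sign.
by rewrite mulrACA -[_ * _ * _]mulrA [(-1) ^+ N s w * _]mulrC mulrA mulrA [X in X * _]mulrC; 
   rewrite mulrA e2 mul1r.
Qed.

Lemma grid_walk M w : \sum_(0 <= i < M) (-1) ^+ N (x i) w =
  (-1) ^+ N s w * walk grid_sign M w.
Proof.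
rewrite /walk mulr_sumr; apply: eq_bigr => i _.
by rewrite grid_velocity mulrCA -expr2 sqrr_sign mulr1.
Qed.

End Grid.

End PoissonParity.

(** * Grids of vanishing mesh and the limit covariance *)

Section MeshLimits.
Context {R : realType}.

Definition mesh (m : nat) : R := m.+1%:R^-1.

Lemma mesh_gt0 m : 0 < mesh m.
Proof. by rewrite invr_gt0. Qed.

Lemma cvg_mesh : mesh m @[m --> \oo] --> (0 : R).
Proof. exact: cvg_harmonic. Qed.

Lemma cvg_mesh_truncn (t : R) : 0 <= t ->
  (Num.truncn (t / mesh m))%:R * mesh m @[m --> \oo] --> t.
Proof.
move=> t0.
apply: (@squeeze_cvgr _ _ _ _ (fun m => t - mesh m) (fun=> t)).
- apply: nearW => m; have h0 := mesh_gt0 m.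
  have /andP[M1 M2] : (Num.truncn (t / mesh m))%:R <= t / mesh m < (Num.truncn (t / mesh m)).+1%:R.
    by apply: truncn_itv; rewrite divr_ge0// ltW.
  rewrite -ler_pdivlMr// M1 andbT.
  by move: M2; rewrite ltr_pdivrMr// -natr1 mulrDl mul1r; lra.
- by rewrite -[X in _ --> X]subr0; apply: cvgB; [exact: cvg_cst|exact: cvg_mesh].
- exact: cvg_cst.
Qed.

Lemma cvg_norm_le_mesh (u : nat -> R) (l K : R) :
  (forall m, `|l - u m| <= mesh m * K) -> u m @[m --> \oo] --> l.
Proof.
move=> h; apply: (@squeeze_cvgr _ _ _ _ (fun m => l - mesh m * K) (fun m => l + mesh m * K)).
- by apply: nearW => m; have := h m; rewrite ler_norml; lra.
- rewrite -[X in _ --> X]subr0 -[X in _ - X](mul0r K).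
  by apply: cvgB; [exact: cvg_cst|apply: cvgMl; exact: cvg_mesh].
- rewrite -[X in _ --> X]addr0 -[X in _ + X](mul0r K).
  by apply: cvgD; [exact: cvg_cst|apply: cvgMl; exact: cvg_mesh].
Qed.

End MeshLimits.

Section Grid.
Context {R : realType}.

Lemma sum_nat_lt (k M : nat) (F : nat -> R) : (k <= M)%N ->
  \sum_(0 <= l < M) (l < k)%:R * F l = \sum_(0 <= l < k) F l.
Proof.
move=> kM; rewrite (big_cat_nat (leq0n k) kM)/=.
have -> : \sum_(k <= l < M) (l < k)%:R * F l = 0.
  rewrite big_nat_cond big1// => l /andP[/andP[kl _] _].
  by rewrite ltnNge kl mul0r.
rewrite addr0 big_nat_cond [RHS]big_nat_cond; apply: eq_bigr => l /andP[/andP[_ ->] _].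
by rewrite mul1r.
Qed.

Variable s : seq (R * R).
Hypothesis s_ge0 : forall p, p \in s -> 0 <= p.2.
Let B : R := \sum_(p <- s) `|p.1|.
(** The times are nonnegative, so their sum bounds each of them and serves as a common horizon. *)
Let b : R := \sum_(p <- s) p.2.

Let le_b p : p \in s -> p.2 <= b.
Proof.
move=> ps; rewrite /b (big_rem p)//= lerDl big_seq sumr_ge0// => p' p's.
by apply: s_ge0; exact: mem_rem p's.
Qed.

Definition grid_steps (m : nat) (p : R * R) := Num.truncn (p.2 / mesh m).

(** Summation by parts: the value at time p.2 is the sum of the first [grid_steps m p] increments,
    so this is the total coefficient of the l-th increment in the evaluation. *)
Definition grid_weight m l : R := \sum_(p <- s) p.1 * (l < grid_steps m p)%:R.

Definition grid_horizon (m : nat) := Num.truncn (b / mesh m).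

Lemma grid_steps_le m p : p \in s -> (grid_steps m p <= grid_horizon m)%N.
Proof.
by move=> ps; rewrite /grid_steps /grid_horizon le_truncn// ler_pM2r ?le_b// invr_gt0 mesh_gt0.
Qed.

Lemma grid_weight_le m l : `|grid_weight m l| <= B.
Proof.
rewrite (le_trans (ler_norm_sum _ _ _))// ler_sum// => p _.
by rewrite normrM ler_piMr//; case: (l < _)%N; rewrite ?normr1 ?normr0.
Qed.

(** The indicators of l < i and l < j multiply to that of l < min (i, j): this is where the
    covariance min (s, t) comes from. *)
Lemma sum_sqr_grid_weight m : \sum_(0 <= l < grid_horizon m) grid_weight m l ^+ 2 =
  \sum_(p <- s) \sum_(p' <- s) p.1 * p'.1 * (minn (grid_steps m p) (grid_steps m p'))%:R.
Proof.
under eq_bigr => l _.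
  rewrite expr2 /grid_weight mulr_suml.
  under eq_bigr do rewrite mulr_sumr.
  over.
rewrite exchange_big/= big_seq [RHS]big_seq; apply: eq_bigr => p ps.
rewrite exchange_big/= big_seq [RHS]big_seq; apply: eq_bigr => p' ps'.
transitivity (p.1 * p'.1 * \sum_(0 <= l < grid_horizon m) (l < minn (grid_steps m p) (grid_steps m p'))%:R * 1).
  rewrite mulr_sumr; apply: eq_bigr => l _; rewrite leq_min mulr1.
  by case: (l < grid_steps m p)%N; case: (l < grid_steps m p')%N => /=; ring.
rewrite sum_nat_lt; last by rewrite geq_min grid_steps_le.
by rewrite sumr_const_nat subn0.
Qed.

(* The variance of [sum_p p.1 * B(p.2)] for a standard Brownian motion B. *)
Definition covariance_form : R :=
  \sum_(p <- s) \sum_(p' <- s) p.1 * p'.1 * Num.min p.2 p'.2.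

(** The hypothesis says that the step variance [e m] behaves like K times the mesh. It covers the
    telegraph process, with [del] and K = c^2 / lam, and Brownian motion, with the mesh itself and K
    = 1. *)
Lemma cvg_grid_covariance (e : nat -> R) (K : R) :
  (forall (k : nat -> nat) L, (k m)%:R * mesh m @[m --> \oo] --> L ->
    (k m)%:R * e m @[m --> \oo] --> K * L) ->
  e m * (\sum_(p <- s) \sum_(p' <- s)
    p.1 * p'.1 * (minn (grid_steps m p) (grid_steps m p'))%:R) @[m --> \oo] -->
    K * covariance_form.
Proof.
move=> cd.
rewrite /covariance_form mulr_sumr big_seq; under eq_fun do rewrite mulr_sumr big_seq.
apply: cvg_big => [|p ps]; first exact: add_continuous.
rewrite mulr_sumr big_seq; under eq_fun do rewrite mulr_sumr big_seq.
apply: cvg_big => [|p' ps']; first exact: add_continuous.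
rewrite mulrCA; under eq_fun do rewrite mulrCA (mulrC (e _)).
apply: cvgMr; apply: (cd (fun m => minn (grid_steps m p) (grid_steps m p'))).
wlog pp : p p' ps ps' / p.2 <= p'.2.
  move=> H; have [pp|/ltW pp] := leP p.2 p'.2; first by have := H p p' ps ps' pp; rewrite min_l.
  have := H p' p ps' ps pp; rewrite min_l//.
  by under eq_fun do rewrite minnC.
rewrite min_l//.
rewrite (_ : (fun m => _) = fun m => (Num.truncn (p.2 / mesh m))%:R * mesh m).
  by apply: cvg_mesh_truncn; exact: s_ge0.
apply/funext => m; rewrite (minn_idPl _)//.
by rewrite /grid_steps le_truncn// ler_pM2r// invr_gt0 mesh_gt0.
Qed.

End Grid.

Section PoissonAlternatingTime.
Context {R : realType} {d : measure_display} {T : measurableType d}.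
Variables (P : probability T R) (lam : R) (N : R -> T -> nat).
Hypothesis lam0 : 0 < lam.
Hypothesis hN : poisson_process P lam N.
Local Notation E f := (\int[P]_x f x).

Definition signed_time (t : R) (w : T) : R := alternating_time (N ^~ w) t.

Let N_nd w s t : 0 <= s -> s <= t -> (N s w <= N t w)%N.
Proof. exact: poisson_nondecreasing hN w s t. Qed.

Let m_sign t : 0 <= t -> measurable_fun setT (fun w => (-1) ^+ N t w : R).
Proof.
by move=> t0; apply: measurableT_comp (poisson_measurable hN t0).
Qed.

Definition signed_time_approx (m : nat) (t : R) (w : T) : R :=
  mesh m * \sum_(0 <= i < Num.truncn (t / mesh m)) (-1) ^+ N (i%:R * mesh m) w.

Lemma signed_time_approx_cvg t w : 0 <= t ->
  signed_time_approx m t w @[m --> \oo] --> signed_time t w.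
Proof.
move=> t0; apply: (@cvg_norm_le_mesh _ _ _ (2 * (N t w)%:R + 1)) => m.
exact: (alternating_time_floor (N_nd w) t0 (mesh_gt0 m)).
Qed.

Lemma measurable_signed_time_approx m t :
  measurable_fun setT (signed_time_approx m t).
Proof.
apply: measurable_funM => //; apply: measurable_sum => i.
by apply: m_sign; rewrite mulr_ge0// ltW// mesh_gt0.
Qed.

Let odd_bounds h : 0 < h ->
  lam * h * (1 - lam * h) <= poisson_odd (lam * h) <= lam * h.
Proof.
by move=> h0; apply: (poisson_odd_bounds lam0 hN (lexx 0) h0); rewrite subr0.
Qed.

(** For lam h <= 1/2 the lower bound on [poisson_odd] gives 2 p >= lam h, hence h A <= 1 / lam with
    A = 1 / (2 p). The second summand of the bound vanishes with h. *)
Lemma walk4_mesh (D h : R) (M : nat) : 0 < h -> lam * h <= 2^-1 -> M%:R * h = D ->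
  h ^+ 4 * (24 * ((2 * poisson_odd (lam * h))^-1) ^+ 2 * M%:R ^+ 2 +
    12 * (2 * poisson_odd (lam * h))^-1 * M%:R ^+ 2 +
    17 * ((2 * poisson_odd (lam * h))^-1) ^+ 2 * M%:R) <=
  24 * D ^+ 2 / lam ^+ 2 + h * (12 * D ^+ 2 / lam + 17 * D / lam ^+ 2).
Proof.
move=> h0 lh MD; have := odd_bounds h0; set p := poisson_odd _ => /andP[p1 p2].
have m0 : 0 < lam * h by rewrite mulr_gt0.
have pm : lam * h <= 2 * p by nra.
have p0 : 0 < 2 * p by lra.
have Ah : h * (2 * p)^-1 <= lam^-1.
  rewrite ler_pdivrMr// mulrC ler_pdivlMr// mulrC; lra.
set A := (2 * p)^-1 in Ah *.
have A0 : 0 <= h * A by rewrite mulr_ge0 ?ltW// invr_gt0.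
have Ah2 : (h * A) ^+ 2 <= (lam ^+ 2)^-1.
  by rewrite -exprVn lerXn2r ?nnegrE ?invr_ge0// ltW.
have D0 : 0 <= D by rewrite -MD mulr_ge0// ltW.
have -> : h ^+ 4 * (24 * A ^+ 2 * M%:R ^+ 2 + 12 * A * M%:R ^+ 2 + 17 * A ^+ 2 * M%:R) =
   24 * (M%:R * h) ^+ 2 * (h * A) ^+ 2 +
   h * (12 * (M%:R * h) ^+ 2 * (h * A) + 17 * (M%:R * h) * (h * A) ^+ 2) by ring.
rewrite MD; apply: lerD.
  by apply: ler_wpM2l Ah2; rewrite mulr_ge0// sqr_ge0.
rewrite ler_pM2l//; apply: lerD.
  by apply: ler_wpM2l Ah; rewrite mulr_ge0// sqr_ge0.
by apply: ler_wpM2l Ah2; rewrite mulr_ge0.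
Qed.

Lemma signed_time_moment4 s t : 0 <= s -> s <= t ->
  E (fun w => (signed_time t w - signed_time s w) ^+ 4) <= 24 * (t - s) ^+ 2 / lam ^+ 2.
Proof.
move=> s0; rewrite le_eqVlt => /orP[/eqP ->|st].
  under eq_Rintegral do rewrite subrr expr0n.
  by rewrite expect_cst subrr expr0n/= mulr0 mul0r.
set D := t - s; have D0 : 0 < D by rewrite subr_gt0.
(* The mesh is adapted to the interval: m + 1 cells tile it exactly, and no incomplete cell is
   left. *)
pose h m := D * mesh m.
have h0 m : 0 < h m by rewrite mulr_gt0// mesh_gt0.
have hM m : m.+1%:R * h m = D by rewrite /h mulrCA mulfV ?mulr1// pnatr_eq0.
pose r m w := h m * \sum_(0 <= i < m.+1) (-1) ^+ N (s + i%:R * h m) w : R.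
have rE m w : r m w = (-1) ^+ N s w * (h m * walk (grid_sign N s (h m)) m.+1 w).
  by rewrite /r grid_walk mulrCA.
have mr m : measurable_fun setT (r m).
  apply: measurable_funM => //; apply: measurable_sum => i.
  by apply: m_sign; rewrite addr_ge0// mulr_ge0// ltW.
have rD m w : `|r m w| <= D.
  rewrite /r normrM (gtr0_norm (h0 m)) -[leRHS](hM m) mulrC ler_pM2r//.
  rewrite (le_trans (ler_norm_sum _ _ _))// big_mkord.
  by under eq_bigr do rewrite norm_sign_nat; rewrite sumr_const card_ord.
have cr w : r m w @[m --> \oo] --> signed_time t w - signed_time s w.
  apply: (@cvg_norm_le_mesh _ _ _ (2 * D * ((N t w)%:R - (N s w)%:R))) => m.
  have := alternating_time_riemann (N_nd w) m.+1 s0 (ltW (h0 m)).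
  have sD : s + D = t by rewrite /D addrC subrK.
  rewrite hM sD /h => H; apply: le_trans H _.
  by rewrite le_eqVlt; apply/orP; left; apply/eqP; ring.
have [|||_ cE] := @expect_cvg _ _ _ P (fun m w => r m w ^+ 4)
    (fun w => (signed_time t w - signed_time s w) ^+ 4) (D ^+ 4).
- by move=> m; exact: measurable_funX.
- by move=> m w; rewrite normrX lerXn2r ?nnegrE// ltW.
- move=> w; apply: (cvg_comp _ (fun y => y ^+ 4)); first exact: cr.
  exact: exprn_continuous.
have cB : 24 * D ^+ 2 / lam ^+ 2 + h m * (12 * D ^+ 2 / lam + 17 * D / lam ^+ 2)
    @[m --> \oo] --> 24 * D ^+ 2 / lam ^+ 2.
  move: (24 * D ^+ 2 / _) (12 * D ^+ 2 / lam + _) => K1 K2.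
  rewrite -[X in _ --> X](_ : K1 + D * 0 * K2 = K1); last by rewrite mulr0 mul0r addr0.
  apply: cvgD; first exact: cvg_cst.
  by apply: cvgMl; apply: cvgMr; exact: cvg_mesh.
apply: (ler_cvg_to cE cB).
have lD0 : 0 < 2 * lam * D by rewrite !mulr_gt0.
exists (Num.truncn (2 * lam * D)) => // m /= hm.
have lh : lam * h m <= 2^-1.
  rewrite /h /mesh mulrA ler_pdivrMr// ler_pdivlMl// mulrA.
  by rewrite (le_trans (ltW (truncnS_gt _)))// ler_nat ltnS.
have /andP[p1 p2] := odd_bounds (h0 m).
have m0 : 0 < lam * h m by rewrite mulr_gt0.
have mg := measurable_grid_sign hN s0 (h0 m).
have sg := grid_sign_pm1 hN s0 (h0 m).
have ig := grid_sign_indep hN s0 (h0 m).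
have bw : bounded_measurable (walk (grid_sign N s (h m)) m.+1).
  exact: (bounded_measurable_adapted mg sg (adapted_walk _ _)).
have -> : E (fun w => r m w ^+ 4) = h m ^+ 4 * E (fun w => walk (grid_sign N s (h m)) m.+1 w ^+ 4).
  rewrite -expectZ; last exact: bounded_measurableX.
  apply: eq_Rintegral => w _.
  have e4 : ((-1) ^+ N s w) ^+ 4 = 1 :> R.
    by rewrite -exprM mulnC exprM -(signr_odd _ 4) expr0 expr1n.
  by rewrite rE exprMn e4 mul1r exprMn.
apply: le_trans (walk4_mesh (h0 m) lh (hM m)).
rewrite ler_pM2l ?exprn_gt0//.
apply: (expect_walk4 mg sg ig).
- lra.
- nra.
- by congr (_^-1); ring.
Qed.

Section Cosine.
Variables (c : R) (s : seq (R * R)).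
Hypothesis c0 : 0 <= c.
Hypothesis s_ge0 : forall p, p \in s -> 0 <= p.2.
Let B : R := \sum_(p <- s) `|p.1|.
Let b : R := \sum_(p <- s) p.2.

Local Notation steps := (@grid_steps R).
Local Notation weight := (grid_weight s).
Local Notation horizon := (grid_horizon s).

(** Chosen so that [kap m * (1 - qm m)] is the length c h of one grid displacement; it tends to c /
    (2 lam). *)
Let kap m : R := c * mesh m / (2 * poisson_odd (lam * mesh m)).

Let qm m : R := 1 - 2 * poisson_odd (lam * mesh m).

Let del m : R := kap m ^+ 2 * (1 - qm m ^+ 2).

Local Notation grid m := (grid_sign N 0 (mesh m)).

(* Solution of the Poisson equation of the sign chain: the displacement is a
   martingale up to a boundary term of size [kap m]. *)
Lemma grid_walk_martingale m k w : 0 < poisson_odd (lam * mesh m) ->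
  c * (mesh m * walk (grid m) k w) =
  \sum_(0 <= l < k) martingale_step (grid m) (qm m) (kap m) l w -
    kap m * (velocity (grid m) k w - 1).
Proof.
move=> p0; have p1 : poisson_odd (lam * mesh m) != 0 by rewrite gt_eqF.
elim: k => [|k ih].
  by rewrite walk0 big_geq// /velocity big_geq// !mulr0 subrr mulr0 subrr.
rewrite walkS big_nat_recr//= velocityS mulrDr mulrDr ih /martingale_step.
suff -> : c * (mesh m * velocity (grid m) k w) =
  kap m * (1 - qm m) * velocity (grid m) k w by ring.
by rewrite /kap /qm; field.
Qed.

(** The boundary terms move the argument of the cosine by at most 2 kap B, because a velocity
    differs from 1 by at most 2. The remaining martingale part is covered by [expect_cos_phase]. *)
Lemma expect_cos_signed_time_approx m phi : lam * mesh m <= 2^-1 ->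
  `|E (fun w => cos (c * evaluation s (fun t => signed_time_approx m t w) + phi)) -
    expR (- (del m * (\sum_(p <- s) \sum_(p' <- s)
      p.1 * p'.1 * (minn (steps m p) (steps m p'))%:R) / 2)) * cos phi| <=
  2 * kap m * B +
  (horizon m)%:R * (6 * B ^+ 3 * kap m * del m + B ^+ 4 * del m ^+ 2).
Proof.
move=> lh; have h0 := mesh_gt0 m (R := R).
have /andP[p1 p2] := odd_bounds h0.
have m0 : 0 < lam * mesh m by rewrite mulr_gt0.
have p0 : 0 < poisson_odd (lam * mesh m) by nra.
have k0 : 0 <= kap m by rewrite /kap divr_ge0 ?mulr_ge0// ltW.
have q1 : -1 <= qm m <= 1 by rewrite /qm; apply/andP; split; lra.
have mg := measurable_grid_sign hN (lexx 0) h0.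
have sg := grid_sign_pm1 hN (lexx 0) h0.
have ig := grid_sign_indep hN (lexx 0) h0.
have wB l : `|weight m l| <= B by exact: grid_weight_le.
have H := expect_cos_phase mg sg ig k0 q1 wB phi (horizon m).
rewrite -/(del m) (sum_sqr_grid_weight s_ge0) in H.
set EP := E (fun w => cos (phase _ _ _ _ _ _ w)) in H.
set G := expR _ * _ in H *.
set EA := E (fun w => cos (c * evaluation s (fun t => signed_time_approx m t w) + phi)).
suff H2 : `|EA - EP| <= 2 * kap m * B.
  have := ler_normD (EA - EP) (EP - G); rewrite addrA subrK; lra.
apply: expect_dist_le.
- apply: bounded_measurable_cos; apply: measurable_funD => //; apply: measurable_funM => //.
  apply: measurable_sum => p; apply: measurable_funM => //.
  exact: measurable_signed_time_approx.
- have ap := adapted_phase (grid m) (qm m) (kap m) (weight m) phi (horizon m).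
  exact: (bounded_measurable_adapted mg sg (adapted_comp (@cos R) ap)).
move=> w; rewrite (le_trans (norm_cosB_le _ _))//.
have -> : c * evaluation s (fun t => signed_time_approx m t w) =
    \sum_(0 <= l < horizon m) weight m l * martingale_step (grid m) (qm m) (kap m) l w -
    kap m * \sum_(p <- s) p.1 * (velocity (grid m) (steps m p) w - 1).
  under eq_bigr => l _.
    rewrite /grid_weight mulr_suml; under eq_bigr do rewrite -mulrA.
    over.
  rewrite exchange_big/= !mulr_sumr -sumrB big_seq [RHS]big_seq.
  apply: eq_bigr => p ps.
  rewrite -mulr_sumr sum_nat_lt ?grid_steps_le// [in RHS]mulrCA -mulrBr -grid_walk_martingale//.
  rewrite mulrCA; congr (_ * (_ * _)); rewrite /signed_time_approx; congr (_ * _).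
  have := grid_walk N 0 (mesh m) (steps m p) w.
  rewrite (poisson_start hN) expr0 mul1r => <-.
  by apply: eq_bigr => i _; rewrite add0r.
rewrite /phase addrAC [X in `|X|]addrAC opprD addrACA subrr addr0 addrAC subrr add0r normrN.
rewrite normrM (ger0_norm k0).
have -> : 2 * kap m * B = kap m * (2 * B) by ring.
apply: ler_wpM2l => //; rewrite /B mulr_sumr.
rewrite (le_trans (ler_norm_sum _ _ _))// ler_sum// => p _.
rewrite normrM mulrC ler_wpM2r//.
have v2 := sqr_velocity sg (steps m p) w.
have : velocity (grid m) (steps m p) w = 1 \/ velocity (grid m) (steps m p) w = -1.
  by move/eqP: v2; rewrite sqrf_eq1 => /orP[/eqP|/eqP]; [left|right].
by case=> ->; rewrite ler_norml; apply/andP; split; lra.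
Qed.

(** The mesh limit at fixed c and lam. The number of steps times [del] converges to b c^2 / lam, so
    the error term with [del] squared disappears and the one with [kap] leaves a bound of order c /
    lam. *)
Lemma expect_cos_signed_time phi :
  `|E (fun w => cos (c * evaluation s (fun t => signed_time t w) + phi)) -
    expR (- (c ^+ 2 / lam * covariance_form s / 2)) * cos phi| <=
  2 * (c / (2 * lam)) * B + b * (c ^+ 2 / lam) * (6 * B ^+ 3 * (c / (2 * lam))).
Proof.
pose po m := poisson_odd (lam * mesh m).
pose u m : R := mesh m / po m.
have cr : po m / mesh m @[m --> \oo] --> lam.
  apply: (@squeeze_cvgr _ _ _ _ (fun m => lam * (1 - lam * mesh m)) (fun=> lam)).
  - apply: nearW => m; have h0 := mesh_gt0 m (R := R).
    have /andP[p1 p2] := odd_bounds h0.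
    by rewrite ler_pdivrMr// ler_pdivlMr// p2 andbT; apply: le_trans p1; lra.
  - rewrite -[X in _ --> X](_ : lam * (1 - lam * 0) = lam); last by rewrite mulr0 subr0 mulr1.
    apply: cvgMr; apply: cvgB; first exact: cvg_cst.
    by apply: cvgMr; exact: cvg_mesh.
  - exact: cvg_cst.
have cu : u m @[m --> \oo] --> lam^-1.
  rewrite (_ : u = fun m => (po m / mesh m)^-1); last by apply/funext => m; rewrite invf_div.
  by apply: cvgV => //; rewrite gt_eqF.
have cp : po m @[m --> \oo] --> 0.
  rewrite (_ : po = fun m => po m / mesh m * mesh m); last first.
    by apply/funext => m; rewrite divfK// gt_eqF// mesh_gt0.
  by rewrite -[X in _ --> X](mulr0 lam); apply: cvgM; [exact: cr|exact: cvg_mesh].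
have ck : kap m @[m --> \oo] --> c / (2 * lam).
  rewrite (_ : kap = fun m => c / 2 * u m); last first.
    by apply/funext => m; rewrite /kap /u invfM; ring.
  by rewrite invfM mulrA; apply: cvgMr.
(* From 1 - q^2 = 4 p (1 - p). Inverses of zero being zero, the identity also holds when [po m]
   vanishes. *)
have delE m : del m = c ^+ 2 * u m * (1 - po m) * mesh m.
  rewrite /del /qm /kap /u -/(po m); have [->|p0] := eqVneq (po m) 0.
    by rewrite !(mulr0, invr0, subr0, expr1n, subrr, mul0r).
  by field.
have cd (k : nat -> nat) L : (k m)%:R * mesh m @[m --> \oo] --> L ->
    (k m)%:R * del m @[m --> \oo] --> c ^+ 2 / lam * L.
  move=> ckL.
  rewrite (_ : (fun m => _) = fun m => c ^+ 2 * u m * (1 - po m) * ((k m)%:R * mesh m)); last first.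
    by apply/funext => m; rewrite delE; ring.
  rewrite -[X in _ --> X](_ : c ^+ 2 / lam * (1 - 0) * L = _); last by rewrite subr0 mulr1.
  apply: cvgM => //; apply: cvgM; first by apply: cvgMr.
  by apply: cvgB => //; exact: cvg_cst.
have cdel : del m @[m --> \oo] --> 0.
  have h1 : 1%:R * mesh m @[m --> \oo] --> (0 : R).
    by rewrite -[X in _ --> X](mulr0 1); apply: cvgMr; exact: cvg_mesh.
  have := cd (fun=> 1%N) 0 h1; rewrite mulr0.
  by rewrite (_ : (fun m => _) = del)//; apply/funext => m; rewrite mul1r.
have cL : E (fun w => cos (c * evaluation s (fun t => signed_time_approx m t w) + phi))
    @[m --> \oo] --> E (fun w => cos (c * evaluation s (fun t => signed_time t w) + phi)).
  apply: (@expect_cvg _ _ _ P (fun m w => cos (c * evaluation s (fun t => signed_time_approx m t w) + phi))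
    _ 1 _ _ _).2.
  - move=> m; apply: (bounded_measurable_cos _).1.
    apply: measurable_funD => //; apply: measurable_funM => //.
    apply: measurable_sum => p; apply: measurable_funM => //.
    exact: measurable_signed_time_approx.
  - by move=> m w; rewrite ler_norml cos_geN1 cos_le1.
  - move=> w; apply: (cvg_comp _ cos); last exact: continuous_cos.
    apply: cvgD; last exact: cvg_cst.
    apply: cvgMr; rewrite /evaluation big_seq; under eq_fun do rewrite big_seq.
    apply: cvg_big => [|p ps]; first exact: add_continuous.
    by apply: cvgMr; apply: signed_time_approx_cvg; exact: s_ge0.
have cS : del m * (\sum_(p <- s) \sum_(p' <- s)
    p.1 * p'.1 * (minn (steps m p) (steps m p'))%:R) @[m --> \oo] -->
    c ^+ 2 / lam * covariance_form s.
  exact: (cvg_grid_covariance s_ge0 cd).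
have cG : expR (- (del m * (\sum_(p <- s) \sum_(p' <- s)
      p.1 * p'.1 * (minn (steps m p) (steps m p'))%:R) / 2)) * cos phi @[m --> \oo] -->
    expR (- (c ^+ 2 / lam * covariance_form s / 2)) * cos phi.
  apply: cvgMl; apply: (cvg_comp _ (@expR R)); last exact: continuous_expR.
  by apply: cvgN; apply: cvgMl.
apply: (@ler_cvg_to _ \oo _ _ (fun m => `|E (fun w => cos (c * evaluation s (fun t => signed_time_approx m t w) + phi)) -
    expR (- (del m * (\sum_(p <- s) \sum_(p' <- s)
      p.1 * p'.1 * (minn (steps m p) (steps m p'))%:R) / 2)) * cos phi|)
   (fun m => 2 * kap m * B + (horizon m)%:R * (6 * B ^+ 3 * kap m * del m + B ^+ 4 * del m ^+ 2))).
- exact: (cvg_norm (cvgB cL cG)).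
- rewrite (_ : (fun m => _) = fun m => 2 * kap m * B +
      (horizon m)%:R * del m * (6 * B ^+ 3 * kap m + B ^+ 4 * del m)); last first.
    by apply/funext => m; ring.
  apply: cvgD; first by apply: cvgMl; apply: cvgMr.
  rewrite -[X in _ --> X](_ : c ^+ 2 / lam * b * (6 * B ^+ 3 * (c / (2 * lam)) + B ^+ 4 * 0) = _); last first.
    by rewrite mulr0 addr0; ring.
  apply: cvgM; first by apply: cd; apply: cvg_mesh_truncn; rewrite big_seq sumr_ge0.
  by apply: cvgD; apply: cvgMr.
- exists (Num.truncn (2 * lam)) => // m /= hm.
  apply: expect_cos_signed_time_approx.
  rewrite /mesh ler_pdivrMr// ler_pdivlMl//.
  by rewrite (le_trans (ltW (truncnS_gt _)))// ler_nat ltnS.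
Qed.

End Cosine.

End PoissonAlternatingTime.

(** Stated for an arbitrary measurable space, without a probability, so as to apply also to the
    sigma-algebra generated by N itself. *)
Lemma measurable_alternating_time {R : realType} {d : measure_display}
    {T : measurableType d} (N : R -> T -> nat) (t : R) :
  (forall t, 0 <= t -> measurable_fun setT (N t)) ->
  (forall w s t, 0 <= s -> s <= t -> (N s w <= N t w)%N) ->
  0 <= t -> measurable_fun setT (fun w => alternating_time (N ^~ w) t).
Proof.
move=> mN N_nd t0.
apply: (measurable_fun_cvg (h := fun m => signed_time_approx N m t)) => [m|w _].
  apply: measurable_funM => //; apply: measurable_sum => i.
  by apply: measurableT_comp (mN _ _); rewrite // mulr_ge0// ltW// mesh_gt0.
apply: (@cvg_norm_le_mesh _ _ _ (2 * (N t w)%:R + 1)) => m.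
exact: (alternating_time_floor (N_nd w) t0 (mesh_gt0 m)).
Qed.

Section ProcessSigmaAlgebra.
Context {R : realType} {d : measure_display} {T : measurableType d}.

(** A copy of T that carries the generated sigma-algebra. Membership of an event in
    [process_sigma_algebra X] thereby becomes ordinary measurability of a function on this copy. *)
Definition process_type {d'} {U : measurableType d'} (X : R -> T -> U) :=
  g_sigma_algebraType (\bigcup_(t in [set t | 0 <= t]) g_sigma_algebra_preimage (X t)).

Lemma process_measurable_eval {d'} {U : measurableType d'} (X : R -> T -> U) t :
  0 <= t -> measurable_fun setT (X t : process_type X -> U).
Proof.
move=> t0 _ B mB; apply: sub_sigma_algebra; exists t => //.
by exists B.
Qed.

Lemma process_sigma_algebra_sub {d'} {U : measurableType d'} (X : R -> T -> U) :
  (forall t, 0 <= t -> measurable_fun setT (X t)) ->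
  forall A, process_sigma_algebra X A -> measurable A.
Proof.
move=> mX; apply: smallest_sub; first exact: sigma_algebra_measurable.
by move=> A [t t0 [B mB <-]]; exact: mX.
Qed.

Lemma process_sigma_algebra_preimage {d'} {U : measurableType d'}
    (X : R -> T -> U) (f : T -> R) :
  measurable_fun setT (f : process_type X -> R) ->
  forall B, measurable B -> process_sigma_algebra X (f @^-1` B).
Proof. by move=> mf B mB; rewrite -[X in process_sigma_algebra _ X]setTI; exact: mf. Qed.

End ProcessSigmaAlgebra.

Section Telegraph.
Context {R : realType} {d : measure_display} {T : measurableType d}.
Variables (P : probability T R) (c lam x0 : R) (N : R -> T -> nat) (X : R -> T -> R).
Hypothesis c0 : 0 < c.
Hypothesis lam0 : 0 < lam.
Hypothesis hX : telegraph_process P c lam x0 N X.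
Local Notation E f := (\int[P]_x f x).

Lemma telegraphE : exists D : T -> R,
  [/\ forall w, D w = 1 \/ D w = -1, measurable_fun setT D, E D = 0,
      poisson_process P lam N &
      mutually_independent P (fun b : bool =>
          if b then g_sigma_algebra_preimage D else process_sigma_algebra N)] /\
  forall t w, 0 <= t -> X t w = x0 + c * D w * signed_time N t w.
Proof.
have [D [[mD D1 [PD _] hN ind] XE]] := hX.
exists D; split; last first.
  move=> t w t0; rewrite XE// /signed_time; congr (_ + _).
  rewrite RintegralZl//; apply: alternating_integrable => s' t' s0 st.
  exact: (poisson_nondecreasing hN).
split=> //.
have mA : measurable [set w | D w = 1].
  by rewrite -[X in measurable X]setTI; exact: (mD measurableT [set 1]).
have -> : D = fun w => 2 * \1_[set w | D w = 1] w - 1.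
  apply/funext => w; rewrite indicE; case: (D1 w) => e.
    by rewrite mem_set// e mulr1n; lra.
  rewrite memNset ?e ?mulr0n; first by lra.
  by move=> /= h; move: e; rewrite h => /eqP; rewrite eq_sym eqNr oner_eq0.
have bi := @bounded_measurable_indic R _ _ _ mA.
rewrite expectB; [|exact: bounded_measurableZ|exact: bounded_measurable_cst].
rewrite expectZ// expect_indic// expect_cst PD/=.
by rewrite mulfV ?subrr// pnatr_eq0.
Qed.

Lemma telegraph_measurable t : 0 <= t -> measurable_fun setT (X t).
Proof.
move=> t0; have [D [[_ mD _ hN _] XE]] := telegraphE.
rewrite (_ : X t = fun w => x0 + c * D w * signed_time N t w); last first.
  by apply/funext => w; exact: XE.
apply: measurable_funD => //; apply: measurable_funM; first exact: measurable_funM.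
apply: measurable_alternating_time => //; first exact: poisson_measurable hN.
by move=> w s' t' s0 st; exact: (poisson_nondecreasing hN).
Qed.

Lemma telegraph_start w : X 0 w = x0.
Proof.
have [D [_ XE]] := telegraphE.
by rewrite XE// /signed_time alternating_time0 mulr0 addr0.
Qed.

Lemma telegraph_lipschitz w s t : 0 <= s -> s <= t -> `|X t w - X s w| <= c * (t - s).
Proof.
move=> s0 st; have [D [[D1 _ _ hN _] XE]] := telegraphE.
have t0 := le_trans s0 st; rewrite !XE//.
have -> : x0 + c * D w * signed_time N t w - (x0 + c * D w * signed_time N s w) =
  c * (D w * (signed_time N t w - signed_time N s w)) by ring.
rewrite normrM (gtr0_norm c0) ler_pM2l// normrM.
have -> : `|D w| = 1 by case: (D1 w) => ->; rewrite ?normrN normr1.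
rewrite mul1r; apply: alternating_time_lipschitz => // s' t' s0' st'.
exact: (poisson_nondecreasing hN).
Qed.

Lemma telegraph_continuous w : {within `[0, +oo[, continuous (X ^~ w)}.
Proof.
apply/subspace_continuousP => t; rewrite /= in_itv/= andbT => t0.
apply/cvgrPdist_le => e e0; rewrite near_withinE.
have ec : 0 < e / c by rewrite divr_gt0.
near=> s; rewrite /= in_itv/= andbT => s0.
have ts : `|t - s| <= e / c by near: s; exact: cvgr_dist_le.
have [st|/ltW st] := leP s t.
  rewrite (le_trans (telegraph_lipschitz w s0 st))//.
  by rewrite mulrC -ler_pdivlMr// (le_trans (ler_norm _)).
rewrite distrC (le_trans (telegraph_lipschitz w t0 st))//.
by rewrite mulrC -ler_pdivlMr// (le_trans (ler_norm _))// distrC.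
Unshelve. all: by end_near. Qed.

Lemma telegraph_moment4 s t : 0 <= s -> s <= t ->
  bounded_measurable (fun w => (X t w - X s w) ^+ 4) /\
  E (fun w => (X t w - X s w) ^+ 4) <= 24 * (c ^+ 2 / lam) ^+ 2 * (t - s) ^+ 2.
Proof.
move=> s0 st; have [D [[D1 _ _ hN _] XE]] := telegraphE.
have t0 := le_trans s0 st.
have mX : measurable_fun setT (fun w => X t w - X s w).
  by apply: measurable_funB; exact: telegraph_measurable.
have bX : bounded_measurable (fun w => X t w - X s w).
  by split=> //; exists (c * (t - s)) => w; exact: telegraph_lipschitz.
split; first exact: bounded_measurableX.
have bJ : bounded_measurable (fun w => signed_time N t w - signed_time N s w).
  split.
    apply: measurable_funB; apply: measurable_alternating_time => //; try exact: poisson_measurable hN;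
    by move=> w s' t' s0' st'; exact: (poisson_nondecreasing hN).
  exists (t - s) => w; apply: alternating_time_lipschitz => // s' t' s0' st'.
  exact: (poisson_nondecreasing hN).
have -> : E (fun w => (X t w - X s w) ^+ 4) =
    c ^+ 4 * E (fun w => (signed_time N t w - signed_time N s w) ^+ 4).
  rewrite -expectZ; last exact: bounded_measurableX.
  apply: eq_Rintegral => w _; rewrite !XE//.
  have D4 : D w ^+ 4 = 1.
    by rewrite (_ : 4 = 2 * 2)%N// exprM; case: (D1 w) => ->; rewrite ?sqrrN !expr1n.
  have -> : x0 + c * D w * signed_time N t w - (x0 + c * D w * signed_time N s w) =
    c * D w * (signed_time N t w - signed_time N s w) by ring.
  by rewrite !exprMn D4 mulr1.
have -> : 24 * (c ^+ 2 / lam) ^+ 2 * (t - s) ^+ 2 = c ^+ 4 * (24 * (t - s) ^+ 2 / lam ^+ 2).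
  by rewrite exprMn exprVn; ring.
rewrite ler_pM2l ?exprn_gt0//.
exact: signed_time_moment4.
Qed.

(** The centred evaluation is D times that of the signed time, and the cosine, being even, does not
    see D. *)
Lemma telegraph_cos (s : seq (R * R)) : (forall p, p \in s -> 0 <= p.2) ->
  `|E (fun w => cos (evaluation s (fun t => X t w - x0))) -
    expR (- (c ^+ 2 / lam * covariance_form s / 2))| <=
  2 * (c / (2 * lam)) * (\sum_(p <- s) `|p.1|) +
  (\sum_(p <- s) p.2) * (c ^+ 2 / lam) *
    (6 * (\sum_(p <- s) `|p.1|) ^+ 3 * (c / (2 * lam))).
Proof.
move=> s0; have [D [[D1 mD ED hN ind] XE]] := telegraphE.
have := expect_cos_signed_time lam0 hN (ltW c0) s0 0.
rewrite cos0 mulr1; under eq_Rintegral do rewrite addr0.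
have thE w : evaluation s (fun t => X t w - x0) =
    D w * (c * evaluation s (fun t => signed_time N t w)).
  rewrite /evaluation mulrA mulr_sumr; apply: eq_big_seq => p ps.
  by rewrite XE ?s0//; ring.
rewrite (_ : E (fun w => cos (evaluation s (fun t => X t w - x0))) =
  E (fun w => cos (c * evaluation s (fun t => signed_time N t w))))//.
apply: eq_Rintegral => w _; rewrite thE; case: (D1 w) => ->.
  by rewrite mul1r.
by rewrite mulN1r cosN.
Qed.

(** The sine is odd, so D factors out of it; D is independent of N and has mean zero. *)
Lemma telegraph_sin (s : seq (R * R)) : (forall p, p \in s -> 0 <= p.2) ->
  E (fun w => sin (evaluation s (fun t => X t w - x0))) = 0.
Proof.
move=> s0; have [D [[D1 mD ED hN ind] XE]] := telegraphE.
pose th w : R := c * evaluation s (fun t => signed_time N t w).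
pose f (b : bool) : T -> R := if b then D else fun w => sin (th w).
transitivity (E (fun w => \prod_b f b w)).
  apply: eq_Rintegral => w _; rewrite big_bool/= /th.
  have -> : evaluation s (fun t => X t w - x0) =
      D w * (c * evaluation s (fun t => signed_time N t w)).
    rewrite /evaluation mulrA mulr_sumr; apply: eq_big_seq => p ps.
    by rewrite XE ?s0//; ring.
  by case: (D1 w) => ->; rewrite ?mul1r// mulN1r sinN mulN1r.
(* Quantified over the measurable space because it is used twice: on the sample space, and on
   [process_type N] to obtain membership in the sigma-algebra of N. *)
have mth (d2 : measure_display) (T2 : measurableType d2) (N' : R -> T2 -> nat) :
    (forall t, 0 <= t -> measurable_fun setT (N' t)) ->
    (forall w s t, 0 <= s -> s <= t -> (N' s w <= N' t w)%N) ->
    measurable_fun setT (fun w => sin (c * evaluation s (fun t => signed_time N' t w)) : R).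
  move=> mN' N'_nd; apply: measurableT_comp; first exact: measurable_sin.
  apply: measurable_funM => //; apply: measurable_evaluation => // t t0.
  exact: measurable_alternating_time.
have N_nd w s' t' : 0 <= s' -> s' <= t' -> (N s' w <= N t' w)%N.
  by move=> s0' st'; exact: (poisson_nondecreasing hN).
rewrite (expect_prod_indep ind).
- by rewrite big_bool/= ED mul0r.
- case=> B /=; last exact: (process_sigma_algebra_sub (poisson_measurable hN)).
  by move=> [C mC <-]; exact: mD.
- case=> B mB /=; first by exists B => //; rewrite setTI.
  apply: process_sigma_algebra_preimage => //.
  apply: (mth _ (process_type N) N) => //.
  exact: process_measurable_eval.
- case=> /=.
    by split=> //; exists 1 => w; case: (D1 w) => ->; rewrite ?normrN normr1.
  split; first exact: mth _ _ _ (poisson_measurable hN) N_nd.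
  by exists 1 => w; exact: sin_max.
Qed.

End Telegraph.

(** * Brownian motion *)

Section Density.
Context {R : realType} {d : measure_display} {T : measurableType d}.
Variables (P : {measure set T -> \bar R}) (Z : T -> R) (g : R -> R).
Hypotheses (mZ : measurable_fun setT Z) (mg : measurable_fun setT g).
Hypothesis g0 : forall x, 0 <= g x.
Hypothesis PZ : forall A, measurable A ->
  P (Z @^-1` A) = (\int[lebesgue_measure]_(x in A) (g x)%:E)%E.
Import HBNNSimple.

Let integral_indic A : measurable A ->
  (\int[P]_w (\1_A (Z w))%:E = \int[lebesgue_measure]_x ((\1_A x)%:E * (g x)%:E))%E.
Proof.
move=> mA; have mZA : measurable (Z @^-1` A) by rewrite -[X in measurable X]setTI; exact: mZ.
transitivity (P (Z @^-1` A)).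
  by rewrite -(setIT (Z @^-1` A)) -integral_indic// setIT.
rewrite PZ// integral_mkcond; apply: eq_integral => x _.
by rewrite patchE indicE; case: ifP => /= _; rewrite ?mul1e ?mul0e.
Qed.

Let integral_nnsfun (f : {nnsfun R >-> R}) :
  (\int[P]_w (f (Z w))%:E = \int[lebesgue_measure]_x ((f x)%:E * (g x)%:E))%E.
Proof.
have mI r : measurable_fun setT (\1_(f @^-1` [set r]) : R -> R).
  by apply: measurable_indic.
have mIZ r : measurable_fun setT (fun w => \1_(f @^-1` [set r]) (Z w) : R).
  exact: measurableT_comp (mI r) mZ.
under [LHS]eq_integral do rewrite fimfunE -fsumEFin//.
rewrite [LHS]ge0_integral_fsum//; last 2 first.
  - move=> r; apply/measurable_EFinP; exact: measurable_funM.
  - by move=> n x _; rewrite EFinM nnfun_muleindic_ge0.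
under [RHS]eq_integral.
  move=> x xD; rewrite fimfunE -fsumEFin// ge0_mule_fsuml; last first.
    by move=> r; rewrite EFinM nnfun_muleindic_ge0.
  over.
rewrite [RHS]ge0_integral_fsum//; last 2 first.
  - move=> r; apply: emeasurable_funM; apply/measurable_EFinP => //.
    by apply: measurable_funM => //; exact: mI.
  - by move=> n x _; rewrite mule_ge0 ?lee_fin//; have := nnfun_muleindic_ge0 f n x; rewrite -EFinM lee_fin.
apply: eq_fsbigr => r rf.
have r0 : (0 <= r%:E :> \bar R)%E by move: rf; rewrite inE => -[x _ <-]; rewrite lee_fin.
under eq_integral do rewrite EFinM.
rewrite ge0_integralZl//; last by apply/measurable_EFinP; exact: mIZ.
rewrite integral_indic//.
rewrite -ge0_integralZl//; last 2 first.
- by apply: emeasurable_funM; apply/measurable_EFinP; [exact: mI|exact: mg].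
- by move=> w _; rewrite mule_ge0 ?lee_fin.
by apply: eq_integral => x _; rewrite EFinM muleA.
Qed.

Lemma integral_density (f : R -> R) : measurable_fun setT f -> (forall x, 0 <= f x) ->
  (\int[P]_w (f (Z w))%:E = \int[lebesgue_measure]_x (f x * g x)%:E)%E.
Proof.
move=> mf f0.
have mEf : measurable_fun setT (EFin \o f) by exact/measurable_EFinP.
pose f_ := nnsfun_approx measurableT mEf.
have mf_ n : measurable_fun setT (f_ n : R -> R) by [].
have f_cvg x : (f_ n x)%:E @[n --> \oo] --> (f x)%:E.
  by apply: cvg_nnsfun_approx => // y _; rewrite lee_fin.
have f_nd m n x : (m <= n)%N -> f_ m x <= f_ n x.
  by move=> mn; exact/lefP/nd_nnsfun_approx.
transitivity (lim (\int[P]_w (f_ n (Z w))%:E @[n --> \oo])%E).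
  rewrite -monotone_convergence//=.
  - by apply: eq_integral => w _; apply/esym/cvg_lim => //; exact: f_cvg.
  - by move=> n; apply/measurable_EFinP; apply: measurableT_comp.
  - by move=> n ? _; rewrite lee_fin.
  - by move=> w _ m n mn; rewrite lee_fin; exact: f_nd.
transitivity (lim (\int[lebesgue_measure]_x ((f_ n x)%:E * (g x)%:E) @[n --> \oo])%E).
  by apply: congr_lim; apply/funext => n; exact: integral_nnsfun.
rewrite -monotone_convergence//=.
- apply: eq_integral => x _; apply/cvg_lim => //; rewrite EFinM.
  by apply: cvgeZr => //; exact: f_cvg.
- by move=> n; apply: emeasurable_funM; apply/measurable_EFinP; [exact: mf_|exact: mg].
- by move=> n x _; rewrite mule_ge0// lee_fin.
- by move=> x _ m n mn; rewrite -!EFinM lee_fin ler_wpM2r// f_nd.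
Qed.

End Density.

(** Both integrals are folded onto the half-line by the substitution x -> - x; the two pieces are
    then the same in reverse order. *)
Lemma ge0_integralT_oppr {R : realType} (G : R -> R) : continuous G ->
  (forall x, 0 <= G x) ->
  (\int[lebesgue_measure]_x (G x)%:E = \int[lebesgue_measure]_x (G (- x))%:E)%E.
Proof.
have fold (F : R -> R) : continuous F -> (forall x, 0 <= F x) ->
  (\int[lebesgue_measure]_x (F x)%:E =
   \int[lebesgue_measure]_(x in `[0%R, +oo[) (F (- x))%:E +
   \int[lebesgue_measure]_(x in `[0%R, +oo[) (F x)%:E)%E.
  move=> cF F0.
  have mF : measurable_fun [set: R] F by exact: continuous_measurable_fun.
  rewrite -(setUv [set` `[0%R, +oo[]) ge0_integral_setU//=; last 4 first.
  - exact: measurableC.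
  - by apply/measurable_EFinP; rewrite setUv.
  - by move=> x _; rewrite lee_fin.
  - by apply/disj_setPCl.
  rewrite addeC; congr (_ + _)%E.
  rewrite setCitvr integral_itv_bndo_bndc; last exact/measurable_EFinP/measurable_funTS.
  rewrite -{1}oppr0 ge0_integration_by_substitutionNy//.
  exact: continuous_subspaceT.
move=> cG G0; rewrite fold// [RHS]fold//.
- by rewrite addeC; congr (_ + _)%E; apply: eq_integral => x _; rewrite opprK.
- by move=> x; apply: continuous_comp; [exact: opp_continuous|exact: cG].
Qed.

(** Fourth power of |z| / 4 <= exp (|z| / 4), followed by exp |z| <= 2 cosh z. *)
Lemma pow4_le_cosh {R : realType} (z : R) : z ^+ 4 <= 2 * 4 ^+ 4 * cosh z.
Proof.
have h : `|z| / 4 <= expR (`|z| / 4).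
  by rewrite (le_trans _ (expR_ge1Dx _))// lerDr.
have : (`|z| / 4) ^+ 4 <= expR `|z|.
  have -> : expR `|z| = expR (`|z| / 4) ^+ 4.
    by rewrite -expRM_natl; congr expR; field.
  by rewrite lerXn2r// nnegrE ?divr_ge0// expR_ge0.
have -> : (`|z| / 4) ^+ 4 = z ^+ 4 / 4 ^+ 4.
  rewrite exprMn exprVn (_ : `|z| ^+ 4 = z ^+ 4)//.
  by rewrite (_ : 4 = 2 * 2)%N// !exprM real_normK ?num_real.
rewrite ler_pdivrMr ?exprn_gt0// => /le_trans; apply.
rewrite -(cosh_norm z) /cosh mulrC -mulrA mulrCA ler_pM2l ?exprn_gt0//.
by rewrite mulrC divfK// lerDl expR_ge0.
Qed.

Lemma cosh_sqr_le {R : realType} (z : R) : cosh z * cosh z <= cosh (2 * z).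
Proof.
have := cosh_ge1 (2 * z); rewrite /cosh (_ : - (2 * z) = - z + - z); last by ring.
rewrite (_ : 2 * z = z + z); last by ring.
rewrite !expRD => h; have := expRxMexpNx_1 z; nra.
Qed.

(** * Moments and characteristic function of centred normal laws *)

Section NormalLaw.
Context {R : realType} {d : measure_display} {T : measurableType d}.
Variables (P : probability T R) (Z : T -> R) (sigma : R).
Hypotheses (mZ : measurable_fun setT Z) (sigma0 : 0 < sigma).
Hypothesis lawZ : forall A, measurable A ->
  P [set w | A (Z w)] = normal_prob 0 sigma A.
Local Notation E f := (\int[P]_x f x).

Lemma integral_normal (f : R -> R) : measurable_fun setT f -> (forall x, 0 <= f x) ->
  (\int[P]_w (f (Z w))%:E = \int[lebesgue_measure]_x (f x * normal_pdf 0 sigma x)%:E)%E.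
Proof.
move=> mf f0; apply: integral_density => //; first exact: measurable_normal_pdf.
exact: normal_pdf_ge0.
Qed.

(** Completing the square: exp (b x) times the centred density is a multiple of the normal density
    of mean b sigma^2. *)
Lemma normal_mgf (b : R) :
  (\int[P]_w (expR (b * Z w))%:E = (expR (b ^+ 2 * sigma ^+ 2 / 2))%:E)%E.
Proof.
rewrite (integral_normal (f := fun x => expR (b * x))); last 2 first.
- by apply: measurableT_comp => //; exact: measurable_funM.
- by move=> x; exact: expR_ge0.
have s0 : sigma != 0 by rewrite gt_eqF.
transitivity (\int[lebesgue_measure]_x
    ((expR (b ^+ 2 * sigma ^+ 2 / 2))%:E * (normal_pdf (b * sigma ^+ 2) sigma x)%:E))%E.
  apply: eq_integral => x _; rewrite -EFinM; congr (_%:E).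
  rewrite /normal_pdf (negbTE s0) /normal_fun mulrCA [RHS]mulrCA; congr (_ * _).
  rewrite -!expRD; congr expR; field; exact: s0.
rewrite ge0_integralZl//; last 2 first.
- by apply: measurableT_comp => //; exact: measurable_normal_pdf.
- by move=> x _; rewrite lee_fin normal_pdf_ge0.
by rewrite integral_normal_pdf mule1.
Qed.

Lemma normal_integrable_expR (b : R) : P.-integrable setT (fun w => (expR (b * Z w))%:E).
Proof.
apply/integrableP; split.
  apply/measurable_EFinP; apply: measurableT_comp => //; exact: measurable_funM.
under eq_integral do rewrite gee0_abs ?lee_fin ?expR_ge0//.
by rewrite normal_mgf ltry.
Qed.

Lemma normal_integrable_cosh (b : R) : P.-integrable setT (fun w => (cosh (b * Z w))%:E).
Proof.
rewrite (_ : (fun _ => _) = fun w => ((2^-1)%:E * ((expR (b * Z w))%:E + (expR (- b * Z w))%:E))%E).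
  apply: integrableZl => //; apply: integrableD => //; exact: normal_integrable_expR.
by apply/funext => w; rewrite -EFinD -EFinM /cosh mulNr mulrC.
Qed.

Lemma normal_expect_cosh (b : R) : E (fun w => cosh (b * Z w)) = expR (b ^+ 2 * sigma ^+ 2 / 2).
Proof.
have i1 := normal_integrable_expR b; have i2 := normal_integrable_expR (- b).
transitivity (E (fun w => 2^-1 * (expR (b * Z w) + expR (- b * Z w)))).
  by apply: eq_Rintegral => w _; rewrite /cosh mulNr [RHS]mulrC.
rewrite RintegralZl//; last exact: (integrableD measurableT i1 i2).
rewrite RintegralD// /Rintegral !normal_mgf/= sqrrN; by field.
Qed.

(** Symmetry of the density. Adding 1 to the sine makes the integrand nonnegative, as the density
    formula and the reflection both require. *)
Lemma normal_expect_sin (b : R) : E (fun w => sin (b * Z w)) = 0.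
Proof.
have bs c : bounded_measurable (fun w => sin (c * Z w)).
  by apply: bounded_measurable_sin; exact: measurable_funM.
have h c : (\int[P]_w (1 + sin (c * Z w))%:E = (1 + E (fun w => sin (c * Z w)))%:E)%E.
  rewrite -[X in (X + _)%:E](expect_cst P) -expectD//; last exact: bounded_measurable_cst.
  rewrite /Rintegral fineK//; apply: integrable_fin_num => //.
  apply: bounded_measurable_integrable.
  exact: bounded_measurableD (bounded_measurable_cst _) (bs c).
have sin1 (x : R) : 0 <= 1 + sin x by have := sin_geN1 x; lra.
have csin c : continuous (fun x : R => 1 + sin (c * x)).
  move=> x; apply: cvgD; first exact: cvg_cst.
  apply: (cvg_comp (fun x => c * x) sin); last exact: continuous_sin.
  by apply: cvgM; [exact: cvg_cst|exact: cvg_id].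
have : (\int[P]_w (1 + sin (b * Z w))%:E = \int[P]_w (1 + sin (- b * Z w))%:E)%E.
  have ms c := continuous_measurable_fun (csin c).
  rewrite (integral_normal (f := fun x => 1 + sin (b * x)))//.
  rewrite (integral_normal (f := fun x => 1 + sin (- b * x)))//.
  rewrite ge0_integralT_oppr; last 2 first.
  - move=> x; apply: cvgM; first exact: csin.
    by apply: continuous_normal_pdf; rewrite gt_eqF.
  - by move=> x; rewrite mulr_ge0// normal_pdf_ge0.
  apply: eq_integral => x _; rewrite mulrN mulNr; congr ((_ * _)%:E).
  by rewrite /normal_pdf gt_eqF// /normal_fun !subr0 sqrrN.
rewrite !h => -[]; rewrite (_ : E (fun w => sin (- b * Z w)) = - E (fun w => sin (b * Z w))).
  by lra.
rewrite -[RHS]mulN1r -expectZ//; apply: eq_Rintegral => w _.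
by rewrite mulNr sinN mulN1r.
Qed.

(** The fourth power is dominated by a hyperbolic cosine, and E cosh (Z / sigma) = exp (1/2) <= exp
    1. The constant is crude, but any multiple of sigma^4 serves the chaining. *)
Lemma normal_moment4 : (\int[P]_w (Z w ^+ 4)%:E <= (2 * 4 ^+ 4 * expR 1 * sigma ^+ 4)%:E)%E.
Proof.
apply: (@le_trans _ _ (\int[P]_w ((2 * 4 ^+ 4 * sigma ^+ 4) * cosh (sigma^-1 * Z w))%:E)%E).
  apply: ge0_le_integral => //.
  - by move=> w _; rewrite lee_fin exprn_even_ge0.
  - by apply/measurable_EFinP; exact: measurable_funX.
  - have := normal_integrable_cosh sigma^-1.
    move=> /measurable_int /measurable_EFinP ?; apply/measurable_EFinP; exact: measurable_funM.
  - move=> w _; rewrite lee_fin.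
    have := pow4_le_cosh (sigma^-1 * Z w).
    rewrite exprMn exprVn mulrC ler_pdivrMr ?exprn_gt0//.
    by move=> h; apply: (le_trans h); rewrite mulrAC.
under eq_integral do rewrite EFinM.
rewrite integralZl//; last exact: normal_integrable_cosh.
have ic := integrable_fin_num measurableT (normal_integrable_cosh sigma^-1).
rewrite -[X in (_ * X)%E](fineK ic) [fine _](normal_expect_cosh sigma^-1).
rewrite -EFinM lee_fin exprVn mulVf ?expf_neq0 ?gt_eqF//.
rewrite mulrAC ler_pM2r ?exprn_gt0// ler_pM2l ?mulr_gt0 ?exprn_gt0// ler_expR; lra.
Qed.

(* Adding cosh cancels the quadratic term of cos, and the expectation of cosh is
   known from the moment generating function. *)
Lemma normal_expect_cos (b : R) : `|b| * sigma <= 1 ->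
  `|E (fun w => cos (b * Z w)) - expR (- (b ^+ 2 * sigma ^+ 2 / 2))| <=
  (4 ^+ 5 * expR 2 + expR 1) * (b * sigma) ^+ 4.
Proof.
move=> b1; set u := b * sigma.
have s0 : sigma != 0 by rewrite gt_eqF.
have ic := normal_integrable_cosh b.
have bc : bounded_measurable (fun w => cos (b * Z w)).
  by apply: bounded_measurable_cos; exact: measurable_funM.
have icos := bounded_measurable_integrable P bc.
have i1 := bounded_measurable_integrable P (bounded_measurable_cst (T := T) (2 : R)).
have h1 : `|E (fun w => cos (b * Z w) + cosh (b * Z w) - 2)| <=
    4 ^+ 5 * u ^+ 4 * expR 2.
  have i2 : P.-integrable setT (EFin \o (fun w => cos (b * Z w) + cosh (b * Z w) - 2)).
    rewrite (_ : _ \o _ = fun w => (((cos (b * Z w))%:E + (cosh (b * Z w))%:E) - 2%:E)%E)//.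
    by apply: integrableB => //; exact: (integrableD measurableT icos ic).
  have i3 : P.-integrable setT (EFin \o (fun w => 4 ^+ 5 * u ^+ 4 * cosh (2 / sigma * Z w))).
    rewrite (_ : _ \o _ = fun w => ((4 ^+ 5 * u ^+ 4)%:E * (cosh (2 / sigma * Z w))%:E)%E)//.
    by apply: integrableZl => //; exact: normal_integrable_cosh.
  rewrite (le_trans (le_normr_Rintegral _ _))//.
  have -> : 4 ^+ 5 * u ^+ 4 * expR 2 = E (fun w => 4 ^+ 5 * u ^+ 4 * cosh (2 / sigma * Z w)).
    rewrite RintegralZl//; last exact: normal_integrable_cosh.
    by rewrite normal_expect_cosh; congr (_ * expR _); field.
  apply: le_Rintegral => //; first exact: integrable_norm i2.
  move=> w _; set y := b * Z w; set z := sigma^-1 * Z w.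
  have yz : y = u * z by rewrite /y /u /z; field.
  have := norm_cos_taylor2_le4 y; have := cosh_taylor2 y; have := cosh_ge1 y.
  (* As |u| <= 1, y^4 cosh y is at most u^4 z^4 cosh z, then at most 2 4^4 u^4 (cosh z)^2, and (cosh
     z)^2 <= cosh (2 z). The errors of cos and cosh together double this, hence 4^5 = 2 (2 4^4); the
     mean of cosh (2 z) is exp 2. *)
  have c4 : y ^+ 4 * cosh y <= 2 * 4 ^+ 4 * u ^+ 4 * cosh (2 / sigma * Z w).
    have -> : 2 / sigma * Z w = 2 * z by rewrite /z mulrA.
    rewrite {1}yz exprMn.
    rewrite [leRHS](_ : _ = u ^+ 4 * (2 * 4 ^+ 4 * cosh (2 * z))); last by ring.
rewrite -[leLHS]mulrA ler_wpM2l ?exprn_even_ge0//.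
    rewrite (le_trans (y := (2 * 4 ^+ 4) * (cosh z * cosh z)))//; last first.
      by rewrite ler_wpM2l ?cosh_sqr_le ?mulr_ge0 ?exprn_ge0.
    rewrite mulrA; apply: ler_pM; first exact: exprn_even_ge0.
    - exact: le_trans (cosh_ge1 y).
    - exact: pow4_le_cosh.
    - apply: le_cosh; rewrite yz normrM ler_piMl//.
      by rewrite /u normrM (gtr0_norm sigma0).
  have y40 : 0 <= y ^+ 4 by exact: exprn_even_ge0.
  move: c4 y40; move: (cosh y) (cos y) (y ^+ 4) (y ^+ 2) => C c Y4 Y2.
  have -> : 4 ^+ 5 * u ^+ 4 * cosh (2 / sigma * Z w) =
    2 * (2 * 4 ^+ 4 * u ^+ 4 * cosh (2 / sigma * Z w)) by rewrite exprSr; ring.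
  move: (2 * 4 ^+ 4 * u ^+ 4 * cosh (2 / sigma * Z w)) => K YK Y40.
  rewrite !ler_norml => C1 /andP[h1 h2] /andP[h3 h4].
  apply/andP; nra.
have u2 : b ^+ 2 * sigma ^+ 2 = u ^+ 2 by rewrite /u exprMn.
move: h1; rewrite RintegralB//; last exact: (integrableD measurableT icos ic).
rewrite RintegralD// expect_cst normal_expect_cosh u2.
set r := \int[P]_x cos (b * Z x) => h1.
(* It remains to compare exp (u^2 / 2) + exp (- u^2 / 2) with 2; the difference is 2 (cosh (u^2 / 2)
   - 1), again of order u^4. *)
have := norm_coshB1_le (u ^+ 2 / 2); rewrite {1}/cosh.
have u1 : u ^+ 2 <= 1.
  by rewrite -real_normK ?num_real// expr_le1// /u normrM (gtr0_norm sigma0)//.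
have u20 : 0 <= u ^+ 2 by exact: sqr_ge0.
have u4 : (u ^+ 2) ^+ 2 = u ^+ 4 by rewrite -exprM.
have : cosh (u ^+ 2 / 2) <= expR 1.
  rewrite /cosh; have : expR (- (u ^+ 2 / 2)) <= expR 1 by rewrite ler_expR; lra.
  have : expR (u ^+ 2 / 2) <= expR 1 by rewrite ler_expR; lra.
  lra.
rewrite [(u ^+ 2 / 2) ^+ 2]exprMn u4.
move: (cosh _) h1 => C; have : 0 <= u ^+ 4 by exact: exprn_even_ge0.
move: (u ^+ 4) => U.
have -> : 4 ^+ 5 * U * expR 2 = U * (4 ^+ 5 * expR 2) by ring.
move: (4 ^+ 5 * expR 2) (expR 1) (expR (u ^+ 2 / 2)) (expR (- (u ^+ 2 / 2))) => K e p q.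
rewrite !ler_norml => U0 /andP[h1 h2] Ce /andP[h3 h4].
have : U * (2^-1) ^+ 2 * C <= U * e / 4.
  have := ler_wpM2l U0 Ce; lra.
have : 0 <= U * e.
  have : 0 <= U * C by lra.
  have := ler_wpM2l U0 Ce; lra.
move=> h5 h6; apply/andP; split; lra.
Qed.

End NormalLaw.

(** The factors are exchanged one at a time; those left unchanged have modulus at most 1. *)
Lemma norm_prodB_le {R : realType} (M : nat) (a b : nat -> R) :
  (forall i, `|a i| <= 1) -> (forall i, `|b i| <= 1) ->
  `|\prod_(0 <= i < M) a i - \prod_(0 <= i < M) b i| <= \sum_(0 <= i < M) `|a i - b i|.
Proof.
move=> a1 b1; elim: M => [|M ih]; first by rewrite !big_geq// subrr normr0.
rewrite !big_nat_recr//=.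
set p := \prod_(0 <= i < M) a i; set q := \prod_(0 <= i < M) b i.
have -> : p * a M - q * b M = (p - q) * a M + q * (a M - b M) by ring.
have q1 : `|q| <= 1 by rewrite /q normr_prod prodr_ile1// => i _; rewrite normr_ge0/=.
rewrite (le_trans (ler_normD _ _))// lerD// normrM.
- by rewrite (le_trans _ ih)// ler_piMr.
- by rewrite ler_piMl.
Qed.

Section BrownianMotion.
Context {R : realType} {d : measure_display} {T : measurableType d}.
Variables (Q : probability T R) (B : R -> T -> R).
Hypothesis hB : standard_brownian_motion Q B.
Local Notation E f := (\int[Q]_x f x).

Let mB s t : 0 <= s -> 0 <= t -> measurable_fun setT (fun w => B t w - B s w).
Proof. by move=> s0 t0; apply: measurable_funB; exact: (brownian_measurable hB). Qed.

Lemma brownian_moment4 s t : 0 <= s -> s <= t ->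
  (\int[Q]_w ((B t w - B s w) ^+ 4)%:E <= (2 * 4 ^+ 4 * expR 1 * (t - s) ^+ 2)%:E)%E.
Proof.
move=> s0; rewrite le_eqVlt => /orP[/eqP <-|st].
  under eq_integral do rewrite subrr expr0n/=.
  by rewrite integral0 subrr expr0n/= mulr0.
have t0 : 0 <= t by rewrite (le_trans s0)// ltW.
have ts : 0 < t - s by rewrite subr_gt0.
have sg : 0 < Num.sqrt (t - s) by rewrite sqrtr_gt0.
have := normal_moment4 (mB s0 t0) sg (fun A => brownian_increments hB s0 st).
by rewrite (exprM (Num.sqrt (t - s)) 2 2) sqr_sqrtr// ltW.
Qed.

Definition brownian_step (m l : nat) (w : T) : R :=
  B (l.+1%:R * mesh m) w - B (l%:R * mesh m) w.

Let tau m (l : nat) : R := l%:R * mesh m.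

Let tau_ge0 m l : 0 <= tau m l.
Proof. by rewrite mulr_ge0// ltW// mesh_gt0. Qed.

Let tauS m l : tau m l.+1 - tau m l = mesh m.
Proof. by rewrite /tau -mulrBl -natrB// subSnn mul1r. Qed.

Let lt_tauS m l : tau m l < tau m l.+1.
Proof. by rewrite -subr_gt0 tauS mesh_gt0. Qed.

Let step_law m l A : measurable A ->
  Q [set w | A (brownian_step m l w)] = normal_prob 0 (Num.sqrt (mesh m)) A.
Proof. by move=> mA; rewrite -(tauS m l); exact: (brownian_increments hB). Qed.

Let sqrt_mesh m : 0 < Num.sqrt (mesh m : R).
Proof. by rewrite sqrtr_gt0 mesh_gt0. Qed.

Let m_step m l : measurable_fun setT (brownian_step m l).
Proof. exact: mB (tau_ge0 m l) (tau_ge0 m l.+1). Qed.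

Let sqr_sqrt_mesh m : Num.sqrt (mesh m) ^+ 2 = mesh m :> R.
Proof. by rewrite sqr_sqrtr// ltW// mesh_gt0. Qed.

Definition normal_cos_cst : R := 4 ^+ 5 * expR 2 + expR 1.

Lemma normal_cos_cst_ge0 : 0 <= normal_cos_cst.
Proof. by rewrite addr_ge0 ?mulr_ge0 ?exprn_ge0 ?expR_ge0. Qed.

Lemma expect_cos_brownian_step m l (b : R) : b ^+ 2 * mesh m <= 1 ->
  `|E (fun w => cos (b * brownian_step m l w)) - expR (- (b ^+ 2 * mesh m / 2))| <=
  normal_cos_cst * (b ^+ 4 * mesh m ^+ 2).
Proof.
move=> b1.
have := normal_expect_cos (m_step m l) (sqrt_mesh m) (@step_law m l) (b := b).
rewrite sqr_sqrt_mesh exprMn (exprM (Num.sqrt (mesh m)) 2 2) sqr_sqrt_mesh; apply.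
rewrite -(@expr_le1 _ 2)// ?mulr_ge0 ?sqrtr_ge0//.
by rewrite exprMn sqr_sqrt_mesh real_normK ?num_real.
Qed.

Lemma expect_cos_brownian_grid m M (al : nat -> R) phi :
  E (fun w => cos (\sum_(0 <= l < M) al l * brownian_step m l w + phi)) =
  cos phi * \prod_(0 <= l < M) E (fun w => cos (al l * brownian_step m l w)).
Proof.
have tau_nd : nondecreasing_seq (tau m).
  by apply/nondecreasing_seqP => l; exact: ltW.
have ind := brownian_independent_increments hB (tau_ge0 m 0) tau_nd (m := M).
under eq_Rintegral do rewrite big_mkord.
rewrite big_mkord.
apply: (expect_cos_sum_indep (th := fun (i : 'I_M) w => al i * brownian_step m i w) phi ind).
- by move=> i A [C mC <-]; exact: mB (tau_ge0 m i) (tau_ge0 m i.+1) measurableT C mC.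
- move=> i A mA; exists ((fun x => al i * x) @^-1` A).
    rewrite -[X in measurable X]setTI.
    have : measurable_fun setT (fun x : R => al i * x) by exact: measurable_funM.
    by apply.
  by rewrite setTI.
- by [].
- move=> i; exact: (normal_expect_sin (m_step m i) (sqrt_mesh m) (@step_law m i)).
Qed.

Section Cosine.
Variable s : seq (R * R).
Hypothesis s_ge0 : forall p, p \in s -> 0 <= p.2.
Let A : R := \sum_(p <- s) `|p.1|.

(** Each of the roughly b / mesh steps, b being the sum of the times, contributes an error of order
    mesh^2, so the total vanishes with the mesh. *)
Lemma expect_cos_brownian_approx m phi : A ^+ 2 * mesh m <= 1 ->
  `|E (fun w => cos (\sum_(p <- s) p.1 * B ((grid_steps m p)%:R * mesh m) w + phi)) -
    cos phi * expR (- (mesh m * (\sum_(p <- s) \sum_(p' <- s)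
      p.1 * p'.1 * (minn (grid_steps m p) (grid_steps m p'))%:R) / 2))| <=
  (grid_horizon s m)%:R * (normal_cos_cst * (A ^+ 4 * mesh m ^+ 2)).
Proof.
move=> A1; set M := grid_horizon s m; set al := grid_weight s m.
have alA l : al l ^+ 2 <= A ^+ 2.
  by rewrite -(real_normK (num_real (al l))) lerXn2r ?nnegrE ?sumr_ge0 ?grid_weight_le.
have -> : E (fun w => cos (\sum_(p <- s) p.1 * B ((grid_steps m p)%:R * mesh m) w + phi)) =
    E (fun w => cos (\sum_(0 <= l < M) al l * brownian_step m l w + phi)).
  apply: eq_Rintegral => w _; congr (cos (_ + _)); apply/esym.
  under eq_bigr => l _.
    rewrite /al /grid_weight mulr_suml; under eq_bigr do rewrite -mulrA.
    over.
  rewrite exchange_big/= big_seq [RHS]big_seq; apply: eq_bigr => p ps.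
  rewrite -mulr_sumr sum_nat_lt ?grid_steps_le// /brownian_step.
  rewrite (telescope_sumr (fun l => B (l%:R * mesh m) w))//.
  by rewrite mul0r (brownian_start hB) subr0.
rewrite expect_cos_brownian_grid -mulrBr normrM.
rewrite -sum_sqr_grid_weight// -/M -/al.
have -> : expR (- (mesh m * (\sum_(0 <= l < M) al l ^+ 2) / 2)) =
    \prod_(0 <= l < M) expR (- (al l ^+ 2 * mesh m / 2)).
  rewrite -expR_sum sumrN; congr (expR (- _)).
  by rewrite mulr_sumr mulr_suml; apply: eq_bigr => l _; rewrite [mesh m * _]mulrC.
have h0 := mesh_gt0 m (R := R).
rewrite (le_trans (ler_piMl _ _))// ?cos_max//.
rewrite (le_trans (norm_prodB_le _ _ _))//.
- move=> l; apply: expect_norm_le_cst => [|w]; last exact: cos_max.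
  by apply: bounded_measurable_cos; apply: measurable_funM => //; exact: m_step.
- move=> l; rewrite ger0_norm ?expR_ge0// -[leRHS]expR0 ler_expR oppr_le0.
  by rewrite divr_ge0// mulr_ge0 ?sqr_ge0// ltW.
rewrite (le_trans (y := \sum_(0 <= l < M) normal_cos_cst * (A ^+ 4 * mesh m ^+ 2)))//; last first.
  by rewrite big_const_nat subn0 iter_addr_0 mulr_natl.
apply: ler_sum => l _; rewrite (le_trans (expect_cos_brownian_step _ _))//.
  by rewrite (le_trans _ A1)// ler_pM2r.
rewrite ler_wpM2l ?normal_cos_cst_ge0// ler_pM2r ?exprn_gt0//.
by rewrite (exprM (al l) 2 2) (exprM A 2 2) lerXn2r ?nnegrE ?sqr_ge0.
Qed.

(** Moving the times to a grid allows consecutive independent increments to be used without sorting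
    the times in [s]; continuity of the paths restores the true times in the limit. *)
Lemma brownian_cos phi :
  E (fun w => cos (evaluation s (B ^~ w) + phi)) =
  cos phi * expR (- (covariance_form s / 2)).
Proof.
set F := fun m w => cos (\sum_(p <- s) p.1 * B ((grid_steps m p)%:R * mesh m) w + phi).
have cL : E (F m) @[m --> \oo] --> E (fun w => cos (evaluation s (B ^~ w) + phi)).
  apply: (@expect_cvg _ _ _ Q F _ 1 _ _ _).2.
  - move=> m; apply: (bounded_measurable_cos _).1.
    apply: measurable_funD => //.
    apply: measurable_sum => p; apply: measurable_funM => //.
    by apply: (brownian_measurable hB); exact: tau_ge0.
  - by move=> m w; exact: cos_max.
  - move=> w; apply: (cvg_comp _ cos); last exact: continuous_cos.
    apply: cvgD; last exact: cvg_cst.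
    rewrite /evaluation big_seq; under eq_fun do rewrite big_seq.
    apply: cvg_big => [|p ps]; first exact: add_continuous.
    apply: cvgMr.
    have p0 := s_ge0 ps.
    have /subspace_continuousP/(_ p.2) := @brownian_continuous _ _ _ _ _ hB w.
    rewrite /= in_itv/= andbT => /(_ p0) cB.
    apply: cvg_trans cB; move=> U /=; rewrite /within/= => BU.
    have := cvg_mesh_truncn p0 => /(_ _ BU).
    rewrite /nbhs/=; apply: filterS => m /=; apply.
    by rewrite in_itv/= andbT; exact: tau_ge0.
set G : nat -> R := fun m => cos phi * expR (- (mesh m * (\sum_(p <- s) \sum_(p' <- s)
      p.1 * p'.1 * (minn (grid_steps m p) (grid_steps m p'))%:R) / 2)).
have cG : G m @[m --> \oo] --> cos phi * expR (- (covariance_form s / 2)).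
  apply: cvgMr; apply: (cvg_comp _ (@expR R)); last exact: continuous_expR.
  apply: cvgN; apply: cvgMl; rewrite -[covariance_form s]mul1r.
  by apply: cvg_grid_covariance => // k L; rewrite mul1r.
have cE : (grid_horizon s m)%:R * (normal_cos_cst * (A ^+ 4 * mesh m ^+ 2))
    @[m --> \oo] --> (0 : R).
  rewrite (_ : (fun m => _) = fun m => (grid_horizon s m)%:R * mesh m *
      (mesh m * (normal_cos_cst * A ^+ 4))); last by apply/funext => m; ring.
  rewrite -[X in _ --> X](_ : (\sum_(p <- s) p.2) * (0 * (normal_cos_cst * A ^+ 4)) = 0); last first.
    by rewrite mul0r mulr0.
  apply: cvgM; last by apply: cvgMl; exact: cvg_mesh.
  by apply: cvg_mesh_truncn; rewrite big_seq sumr_ge0.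
apply/eqP; rewrite -subr_eq0 -normr_le0.
apply: (@ler_cvg_to _ \oo _ _ (fun m => `|E (F m) - G m|)
  (fun m => (grid_horizon s m)%:R * (normal_cos_cst * (A ^+ 4 * mesh m ^+ 2)))).
- exact: (cvg_norm (cvgB cL cG)).
- exact: cE.
- exists (Num.truncn (A ^+ 2)) => // m /= hm.
  apply: expect_cos_brownian_approx.
  rewrite /mesh ler_pdivrMr// mul1r.
  by rewrite (le_trans (ltW (truncnS_gt _)))// ler_nat ltnS.
Qed.

End Cosine.

End BrownianMotion.

(** * Linear combinations of telegraph processes *)

Section Scaling.
Context {R : realType}.
Implicit Types (s : seq (R * R)) (c m : R) (f : R -> R).

Definition scale_weights c s := [seq (c * p.1, p.2) | p <- s].

Lemma scale_weights_ge0 c s : (forall p, p \in s -> 0 <= p.2) ->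
  forall p, p \in scale_weights c s -> 0 <= p.2.
Proof. by move=> s0 p /mapP[p' p's ->]; exact: (s0 p' p's). Qed.

Lemma evaluation_scale c s f : evaluation (scale_weights c s) f = c * evaluation s f.
Proof.
by rewrite /evaluation big_map mulr_sumr; apply: eq_bigr => p _; rewrite mulrA.
Qed.

Lemma covariance_form_scale c s :
  covariance_form (scale_weights c s) = c ^+ 2 * covariance_form s.
Proof.
rewrite /covariance_form big_map mulr_sumr; apply: eq_bigr => p _.
by rewrite big_map mulr_sumr; apply: eq_bigr => p' _ /=; ring.
Qed.

Lemma evaluation_affine s m c f g : (forall p, p \in s -> 0 <= p.2) ->
  (forall t, 0 <= t -> f t = m + c * g t) ->
  evaluation s f = evaluation (scale_weights c s) g + m * \sum_(p <- s) p.1.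
Proof.
move=> s0 fg; rewrite evaluation_scale /evaluation !mulr_sumr -big_split/=.
by apply: eq_big_seq => p ps; rewrite fg ?s0//; ring.
Qed.

End Scaling.

(** Iteration of (a + b)^4 <= 8 (a^4 + b^4), which is the inequality (a + b)^2 <= 2 (a^2 + b^2) used
    twice. *)
Lemma pow4_sum_le {R : realType} (I : Type) (r : seq I) (y : I -> R) :
  (\sum_(i <- r) y i) ^+ 4 <= 8 ^+ size r * \sum_(i <- r) y i ^+ 4.
Proof.
elim: r => [|i r ih]; first by rewrite !big_nil expr0n mulr0.
rewrite !big_cons/=; set S := \sum_(j <- r) y j in ih *.
set S4 := \sum_(j <- r) _ in ih *.
have h : (y i + S) ^+ 4 <= 8 * (y i ^+ 4 + S ^+ 4).
  have sq (a b : R) : (a + b) ^+ 2 <= 2 * (a ^+ 2 + b ^+ 2).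
    by have := sqr_ge0 (a - b); nra.
  have e4 (z : R) : z ^+ 4 = (z ^+ 2) ^+ 2 by rewrite -exprM.
  have h1 := sq (y i) S; have h2 := sq (y i ^+ 2) (S ^+ 2).
  rewrite !e4; have : ((y i + S) ^+ 2) ^+ 2 <= (2 * (y i ^+ 2 + S ^+ 2)) ^+ 2.
    by rewrite lerXn2r ?nnegrE ?sqr_ge0 ?mulr_ge0 ?addr_ge0 ?sqr_ge0//.
  by rewrite [(2 * _) ^+ 2]exprMn; lra.
have y4 : 0 <= y i ^+ 4 by exact: exprn_even_ge0.
have e1 : 1 <= 8 ^+ size r :> R by rewrite exprn_ege1// ler1n.
rewrite [8 ^+ (size r).+1]exprS; apply: (le_trans h); rewrite -mulrA ler_pM2l//.
by rewrite mulrDr lerD// ler_peMl.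
Qed.

Section WienerProcess.
Context {R : realType} {d : measure_display} {T : measurableType d}.
Variables (Q : probability T R) (m sigma2 : R) (W : R -> T -> R).
Hypothesis sigma2_ge0 : 0 <= sigma2.
Hypothesis hW : wiener_process Q m sigma2 W.

Lemma wiener_path_regular : path_regular Q m (sigma2 ^+ 2 * (2 * 4 ^+ 4 * expR 1)) W.
Proof.
have [B [hB WE]] := hW; split.
- move=> t t0; rewrite (_ : W t = fun w => m + Num.sqrt sigma2 * B t w); last first.
    by apply/funext => w; exact: WE.
  apply: measurable_funD => //; apply: measurable_funM => //.
  exact: (brownian_measurable hB).
- by move=> w; rewrite WE// (brownian_start hB) mulr0 addr0.
- move=> w; apply: (@subspace_eq_continuous _ _ _ (fun t => m + Num.sqrt sigma2 * B t w)).
    by move=> t; rewrite inE/= in_itv/= andbT => t0; rewrite /from_subspace WE.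
  have cB := @brownian_continuous _ _ _ _ _ hB w.
  move=> t; apply: cvgD; first exact: cvg_cst.
  by apply: cvgMr; exact: cB.
- move=> s t s0 st; have t0 := le_trans s0 st.
  have mB : measurable_fun setT (fun w => (B t w - B s w) ^+ 4).
    apply: measurable_funX; apply: measurable_funB; exact: (brownian_measurable hB).
  rewrite (_ : (fun w => _) = fun w => ((sigma2 ^+ 2)%:E * ((B t w - B s w) ^+ 4)%:E)%E).
    rewrite ge0_integralZl//; last 3 first.
    - exact/measurable_EFinP.
    - by move=> w _; rewrite lee_fin exprn_even_ge0.
    - by rewrite lee_fin sqr_ge0.
    rewrite -(mulrA (sigma2 ^+ 2) (2 * 4 ^+ 4 * expR 1)) (EFinM (sigma2 ^+ 2) (_ * _ ^+ 2)); apply: lee_pmul => //.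
    - by rewrite lee_fin sqr_ge0.
    - by apply: integral_ge0 => w _; rewrite lee_fin exprn_even_ge0.
    - exact: brownian_moment4.
  apply/funext => w; rewrite !WE// -EFinM; congr (_%:E).
  rewrite -[X in X ^+ 2 * _](sqr_sqrtr sigma2_ge0); ring.
Qed.

Lemma wiener_trigonometric s phi : (forall p, p \in s -> 0 <= p.2) ->
  \int[Q]_w trigonometric s phi (W ^~ w) =
  cos (m * (\sum_(p <- s) p.1) + phi) * expR (- (sigma2 * covariance_form s / 2)).
Proof.
move=> s0; have [B [hB WE]] := hW.
have := brownian_cos hB (scale_weights_ge0 (c := Num.sqrt sigma2) s0)
  (m * (\sum_(p <- s) p.1) + phi).
rewrite covariance_form_scale sqr_sqrtr// => <-.
apply: eq_Rintegral => w _; rewrite /trigonometric addrA; congr (cos (_ + _)).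
by apply: evaluation_affine => // t; exact: WE.
Qed.

End WienerProcess.

Section TelegraphCombination.
Context {R : realType} {d : measure_display} {T : measurableType d} {n : nat}.
Variables (P : probability T R) (a x0 c lam : 'I_n -> R).
Variables (N : 'I_n -> R -> T -> nat) (X : 'I_n -> R -> T -> R).
Hypothesis c0 : forall k, 0 < c k.
Hypothesis lam0 : forall k, 0 < lam k.
Hypothesis hX : forall k, telegraph_process P (c k) (lam k) (x0 k) (N k) (X k).

(** The regularity constant depends on the speeds and rates only through [M]. A bound on c^2 / lam
    valid along the whole sequence thus gives one constant for all its members. *)
Lemma linear_combination_path_regular (M : 'I_n -> R) :
  (forall k, c k ^+ 2 / lam k <= M k) ->
  path_regular P (\sum_k a k * x0 k)
    (8 ^+ n * \sum_k a k ^+ 4 * (24 * M k ^+ 2)) (linear_combination a X).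
Proof.
move=> cM; split.
- move=> t t0; apply: measurable_sum => k; apply: measurable_funM => //.
  exact: (telegraph_measurable (hX k)).
- move=> w; rewrite /linear_combination; apply: eq_bigr => k _.
  by rewrite (telegraph_start (hX k)).
- move=> w t; apply: cvg_big => [|k _]; first exact: add_continuous.
  by apply: cvgMr; exact: (telegraph_continuous (c0 k) (hX k)).
- move=> s t s0 st.
  pose Y k w := X k t w - X k s w.
  have hY k := telegraph_moment4 (c0 k) (lam0 k) (hX k) s0 st.
  pose G w := 8 ^+ n * \sum_k a k ^+ 4 * Y k w ^+ 4.
  have bG : bounded_measurable G.
    apply: bounded_measurableZ; apply: bounded_measurable_sum => k.
    by apply: bounded_measurableZ; exact: (hY k).1.
  have LG w : (linear_combination a X t w - linear_combination a X s w) ^+ 4 <= G w.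
    rewrite /linear_combination -sumrB.
    have := pow4_sum_le (index_enum 'I_n) (fun k => a k * X k t w - a k * X k s w).
    rewrite (_ : size (index_enum 'I_n) = n); last first.
      by rewrite -[RHS](card_ord n) cardT enumT.
    move=> /le_trans; apply; rewrite ler_pM2l ?exprn_gt0//.
    by apply: ler_sum => k _; rewrite -mulrBr exprMn.
  apply: (@le_trans _ _ (\int[P]_w (G w)%:E)%E).
    apply: ge0_le_integral => //.
    - by move=> w _; rewrite lee_fin exprn_even_ge0.
    - apply/measurable_EFinP; apply: measurable_funX; apply: measurable_funB.
        apply: measurable_sum => k; apply: measurable_funM => //.
        by apply: (telegraph_measurable (hX k)); exact: le_trans st.
      apply: measurable_sum => k; apply: measurable_funM => //.
      exact: (telegraph_measurable (hX k)).
    - by apply/measurable_EFinP; exact: bG.1.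
    - by move=> w _; rewrite lee_fin.
  have := EFin_expect P bG; rewrite unlock => ->; rewrite lee_fin.
  rewrite /G expectZ; last first.
    by apply: bounded_measurable_sum => k; apply: bounded_measurableZ; exact: (hY k).1.
  rewrite -mulrA ler_pM2l ?exprn_gt0// expect_sum; last first.
    by move=> k; apply: bounded_measurableZ; exact: (hY k).1.
  rewrite mulr_suml; apply: ler_sum => k _.
  rewrite expectZ; last exact: (hY k).1.
  rewrite -mulrA ler_wpM2l ?exprn_even_ge0// (le_trans (hY k).2)//.
  rewrite ler_wpM2r ?sqr_ge0// ler_pM2l// lerXn2r ?nnegrE//.
    by rewrite divr_ge0 ?sqr_ge0// ltW.
  by rewrite (le_trans _ (cM k))// divr_ge0 ?sqr_ge0// ltW.
Qed.

(** The starting points are moved into the phase. The centred parts are independent with vanishing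
    sine expectations, which is the setting of [expect_cos_sum_indep]. *)
Lemma linear_combination_trigonometric s phi : independent_processes P X ->
  (forall p, p \in s -> 0 <= p.2) ->
  \int[P]_w trigonometric s phi (linear_combination a X ^~ w) =
  cos ((\sum_k a k * x0 k) * (\sum_(p <- s) p.1) + phi) *
  \prod_k \int[P]_w cos (evaluation (scale_weights (a k) s) (fun t => X k t w - x0 k)).
Proof.
move=> ind s0.
pose th k w := evaluation (scale_weights (a k) s) (fun t => X k t w - x0 k).
have sk k := scale_weights_ge0 (c := a k) s0.
rewrite -(expect_cos_sum_indep (th := th) _ ind); last 4 first.
- by move=> k A; apply: process_sigma_algebra_sub; exact: (telegraph_measurable (hX k)).
- move=> k A mA; apply: process_sigma_algebra_preimage => //.
  apply: (@measurable_evaluation _ _ (process_type (X k)) (fun t w => X k t w - x0 k)) => //.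
    by move=> t t0; apply: measurable_funB => //; exact: process_measurable_eval.
  exact: sk.
- by [].
- by move=> k; apply: (telegraph_sin (hX k)); exact: sk.
apply: eq_Rintegral => w _; rewrite /trigonometric addrA; congr (cos (_ + _)).
rewrite /th mulr_suml -big_split/= {1}/evaluation /linear_combination.
under [LHS]eq_bigr do rewrite mulr_sumr.
rewrite exchange_big/=; apply: eq_bigr => k _.
rewrite evaluation_scale /evaluation !mulr_sumr -big_split/=.
by apply: eq_bigr => p _; ring.
Qed.

End TelegraphCombination.

Lemma telegraph_cos_cvg {R : realType} (c lam : nat -> R) (x0 rho : R)
    (hc : forall j, 0 < c j) (hlam : forall j, 0 < lam j)
    (hkac : kac_scaling lam c rho)
    (d : nat -> measure_display) (T : forall j, measurableType (d j))
    (P : forall j, probability (T j) R)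
    (N : forall j, R -> T j -> nat) (X : forall j, R -> T j -> R)
    (hX : forall j, telegraph_process (P j) (c j) (lam j) x0 (N j) (X j))
    (s : seq (R * R)) (s0 : forall p, p \in s -> 0 <= p.2) :
  \int[P j]_w cos (evaluation s (fun t => X j t w - x0)) @[j --> \oo] -->
    expR (- (rho * covariance_form s / 2)).
Proof.
have [_ coo crho] := hkac.
set A := \sum_(p <- s) `|p.1|; set b := \sum_(p <- s) p.2.
(* The error is of order c / lam = (c^2 / lam) / c: a convergent factor times one that tends to
   zero. *)
have ck : c j / (2 * lam j) @[j --> \oo] --> 0.
  rewrite (_ : (fun j => _) = fun j => (c j ^+ 2 / lam j) * ((c j)^-1 / 2)); last first.
    by apply/funext => j; field; rewrite !gt_eqF.
  rewrite -[X in _ --> X](mulr0 rho); apply: cvgM => //.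
  rewrite -[X in _ --> X](mul0r (2^-1)); apply: cvgMl.
  by apply/gtr0_cvgV0 => //; exact: nearW.
have cE : expR (- (c j ^+ 2 / lam j * covariance_form s / 2)) @[j --> \oo] -->
    expR (- (rho * covariance_form s / 2)).
  apply: (cvg_comp _ (@expR R)); last exact: continuous_expR.
  by apply: cvgN; apply: cvgMl; apply: cvgMl.
set F := fun j => \int[P j]_w cos (evaluation s (fun t => X j t w - x0)).
set G := fun j => expR (- (c j ^+ 2 / lam j * covariance_form s / 2)).
rewrite (_ : F = fun j => (F j - G j) + G j); last by apply/funext => j; rewrite subrK.
rewrite -[X in _ --> X]add0r; apply: cvgD => //.
apply: norm_cvg0.
apply: (@squeeze_cvgr _ _ _ _ (fun=> 0) (fun j => 2 * (c j / (2 * lam j)) * A +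
  b * (c j ^+ 2 / lam j) * (6 * A ^+ 3 * (c j / (2 * lam j))))).
- by apply: nearW => j; rewrite normr_ge0/=; exact: (telegraph_cos (hc j) (hlam j) (hX j) s0).
- exact: cvg_cst.
- rewrite -[X in _ --> X](_ : 2 * 0 * A + b * rho * (6 * A ^+ 3 * 0) = 0); last first.
    by rewrite !mulr0 mul0r addr0.
  apply: cvgD; first by apply: cvgMl; apply: cvgMr.
  by apply: cvgM; apply: cvgMr.
Qed.

Theorem theorem3 (R : realType) (n : nat) (hn : (2 <= n)%N)
    (a x0 rho : 'I_n -> R)
    (ha : forall k, a k != 0)
    (hrho : forall k, 0 < rho k)
    (c lam : nat -> 'I_n -> R)
    (hc : forall j k, 0 < c j k)
    (hlam : forall j k, 0 < lam j k)
    (hkac : forall k, kac_scaling (lam ^~ k) (c ^~ k) (rho k))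
    (d : nat -> measure_display) (T : forall j, measurableType (d j))
    (P : forall j, probability (T j) R)
    (N : forall j, 'I_n -> R -> T j -> nat)
    (X : forall j, 'I_n -> R -> T j -> R)
    (hX : forall j k,
      telegraph_process (P j) (c j k) (lam j k) (x0 k) (N j k) (X j k))
    (hXindep : forall j, independent_processes (P j) (X j))
    (hNindep : forall j, independent_processes (P j) (N j))
    (d' : measure_display) (T' : measurableType d') (Q : probability T' R)
    (W : R -> T' -> R)
    (hW : wiener_process Q (\sum_(k < n) a k * x0 k)
            (\sum_(k < n) rho k * a k ^+ 2) W) :
  weak_convergence P (fun j => linear_combination a (X j)) Q W.
Proof.
(* The ratios converge, hence are bounded over all j, including the initial ones; this makes the
   moment bound uniform in j. *)
have [M cM] : {M : 'I_n -> R & forall k j, c j k ^+ 2 / lam j k <= M k}.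
  apply: (@choice _ _ (fun k r => forall j, c j k ^+ 2 / lam j k <= r)) => k; have [_ _ ck] := hkac k.
  have [K [_ hK]] := cvg_seq_bounded (cvgP _ ck).
  exists (K + 1) => j; rewrite (le_trans (ler_norm _))//.
  by apply: (hK (K + 1) _ j); rewrite // ltrDl.
set sigma2 := \sum_(k < n) rho k * a k ^+ 2 in hW.
have sigma2_ge0 : 0 <= sigma2.
  by apply: sumr_ge0 => k _; rewrite mulr_ge0 ?sqr_ge0// ltW.
(* The criterion wants one constant for the combinations and for W; the sum of the two constants is
   used. *)
set CW := sigma2 ^+ 2 * (2 * 4 ^+ 4 * expR 1).
set CL := 8 ^+ n * \sum_k a k ^+ 4 * (24 * M k ^+ 2).
have CL0 : 0 <= CL.
  rewrite mulr_ge0 ?exprn_ge0// sumr_ge0// => k _.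
  by rewrite mulr_ge0 ?exprn_even_ge0// mulr_ge0 ?sqr_ge0.
have CW0 : 0 <= CW by rewrite !mulr_ge0 ?exprn_ge0 ?expR_ge0.
have path_regular_le d1 (T1 : measurableType d1) (P1 : probability T1 R) x C C' Y :
    C <= C' -> path_regular P1 x C Y -> path_regular P1 x C' Y.
  move=> CC [h1 h2 h3 h4]; split => // s t s0 st; apply: (le_trans (h4 s t s0 st)).
  by rewrite lee_fin ler_wpM2r ?sqr_ge0.
apply: (@weak_convergence_criterion _ _ _ _ _ _ _ _ _ (\sum_(k < n) a k * x0 k) (CL + CW)).
- exact: addr_ge0.
- move=> j; apply: (@path_regular_le _ _ _ _ CL); first by rewrite lerDl.
  by have := @linear_combination_path_regular _ _ _ _ _ a _ _ _ _ _ (hc j) (hlam j) (hX j) M; apply => k; exact: cM.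
- apply: (@path_regular_le _ _ _ _ CW); first by rewrite lerDr.
  exact: wiener_path_regular.
move=> s phi s0; rewrite (wiener_trigonometric sigma2_ge0 hW phi s0).
rewrite (_ : (fun j => _) = fun j =>
  cos ((\sum_k a k * x0 k) * (\sum_(p <- s) p.1) + phi) *
  \prod_k \int[P j]_w cos (evaluation (scale_weights (a k) s) (fun t => X j k t w - x0 k))); last first.
  by apply/funext => j; exact: (linear_combination_trigonometric a (hX j)).
apply: cvgMr.
(* The Gaussian limit is factored over k to match the product given by independence: scaling the
   weights by a_k multiplies the covariance form by a_k^2. *)
have -> : expR (- (sigma2 * covariance_form s / 2)) =
    \prod_k expR (- (rho k * covariance_form (scale_weights (a k) s) / 2)).
  rewrite -expR_sum sumrN; congr (expR (- _)); rewrite !mulr_suml.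
  by apply: eq_bigr => k _; rewrite covariance_form_scale mulrA.
apply: cvgr_prod => k _.
apply: (@telegraph_cos_cvg _ (c ^~ k) (lam ^~ k) _ _ _ _ (hkac k) _ _ _ (fun j => N j k) (fun j => X j k)) => //.
by move=> p; exact: scale_weights_ge0.
Qed.
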